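(* The following correspond through the equivalence between $\mathbf{BiCat}$ (bicategories and functors) and $\mathbf{MrgBiCat}_\otimes$ (representable merge-bicategories and strong morphisms), given by the functors $\int:\mathbf{BiCat}\to\mathbf{MrgBiCat}_\otimes$ and $G:\mathbf{MrgBiCat}_\otimes\to\mathbf{BiCat}$: 1. oplax transformations and modifications in $\mathbf{BiCat}$, and fair oplax transformations and modifications in $\mathbf{MrgBiCat}_\otimes$; 2. pseudo-natural transformations in $\mathbf{BiCat}$ and in $\mathbf{MrgBiCat}_\otimes$; 3. pseudo-natural equivalences in $\mathbf{BiCat}$ and in $\mathbf{MrgBiCat}_\otimes$.
   Context: Merge-bicategories. A regular 2-polygraph $X$ consists of 0-cells, 1-cells $a: x \to y$, and, for all $n,m\ge 1$, 2-cells $p:(a_1,\ldots,a_n)\to(b_1,\ldots,b_m)$ between non-empty composable sequences of 1-cells with the same initial source and the same final target. Greek capitals denote possibly empty composable sequences; commas denote concatenation. A merge-bicategory is a regular 2-polygraph with operations: given $t:(\Gamma)\to(\Delta_1,\Lambda,\Delta_2)$ and $s:(\Gamma_1,\Lambda,\Gamma_2)\to(\Delta)$ with $\Lambda$ non-empty, occupying outputs $j_1,\ldots,j_2$ of $t$ and inputs $i_1,\ldots,i_2$ of $s$, such that ($\Gamma_1$ or $\Delta_1$ is empty) and ($\Gamma_2$ or $\Delta_2$ is empty), a 2-cell $\mathrm{mrg}_{[j_1,j_2]}^{[i_1,i_2]}(t,s):(\Gamma_1,\Gamma,\Gamma_2)\to(\Delta_1,\Delta,\Delta_2)$; whenever the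 same pasting diagram of three 2-cells (with the same identifications of output with input 1-cells) can be evaluated by two successive merges in two different orders, the results are equal. No units are part of the structure. Morphisms preserve boundaries and merges. Write $\mathrm{cut}_{j,i}=\mathrm{mrg}_{[j,j]}^{[i,i]}$. A unit on a non-empty sequence $\Gamma$ is a 2-cell $\mathrm{id}_\Gamma:(\Gamma)\to(\Gamma)$ such that merging any 2-cell with it along $\Gamma$, on either side, returns that 2-cell; $X$ is unital if every non-empty composable sequence has a unit. $t:(\Gamma)\to(\Delta_1,a,\Delta_2)$, with $a$ its $j$-th output, is universal at $\partial_j^+$ if for all $\Gamma_1,\Gamma_2$ and non-empty $\Delta$ with ($\Gamma_1$ or $\Delta_1$ empty) and ($\Gamma_2$ or $\Delta_2$ empty), every $s:(\Gamma_1,\Gamma,\Gamma_2)\to(\Delta_1,\Delta,\Delta_2)$ is the merge along $a$ of $t$ and a unique $r:(\Gamma_1,a,\Gamma_2)\to(\Delta)$; universality at $\partial_i^-$ is dual (reversing 2-cells). A 2-cell $t:(\Gamma)\to(\Delta)$ is universal if every $s:(\Gamma_1,\Gamma,\Gamma_2)\to(\Delta')$ factors uniquely as the merge along $\Delta$ of $t$ and some $r:(\Gamma_1,\Delta,\Gamma_2)\to(\Delta')$, and dually; in the unital case this is equivalent to $t$ having an inverse. A tensor of $a,b$ is $t_{a,b}:(a,b)\to(a\otimes b)$ universal at $\partial_1^+$. A tensor unit on $x$ is $1_x:x\to x$ such that for all $a:x\to y$ there is $l_a:(1_x,a)\to(a)$ universal at $\partial_1^+$ and $\partial_2^-$, and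 for all $b:z\to x$ there is $r_b:(b,1_x)\to(b)$ universal at $\partial_1^+$ and $\partial_1^-$. A 1-cell $e:x\to x'$ is tensor universal if for each $a:x\to y$ there is a 2-cell $(e,u)\to(a)$, and for each $a':x'\to y$ a 2-cell $(e,a')\to(v)$, both universal at $\partial_1^+$ and $\partial_2^-$; and for each $b':z\to x'$ there is a 2-cell $(u',e)\to(b')$, and for each $b:z\to x$ a 2-cell $(b,e)\to(v')$, both universal at $\partial_1^+$ and $\partial_1^-$ (for some $u,v,u',v'$). Pars, par units, par universal 1-cells are the duals (reverse all 2-cells). A 1-cell is universal if it is tensor and par universal. $X$ is representable if it is unital, every 0-cell has a tensor unit and a par unit, and every composable pair of 1-cells has a tensor and a par. A morphism of representable merge-bicategories is strong if it maps units on 1-cells to units, tensor (par) universal 1-cells to such, tensors to tensors and pars to pars. Transformations and modifications for merge-bicategories. Let $f,g:X\to Y$ be morphisms of merge-bicategories. An oplax transformation $\sigma:f\to g$ assigns to each 0-cell $x$ of $X$ a 1-cell $\sigma_x:f(x)\to g(x)$ and to each 1-cell $a:x\to y$ of $X$ a 2-cell $\sigma_a:(f(a),\sigma_y)\to(\sigma_x,g(a))$ of $Y$, such that for all 2-cells $p:(a_1,\ldots,a_n)\to(b_1,\ldots,b_m)$ of $X$, with initial and final 0-cells $x^-$, $x^+$, the two composites $(f(a_1),\ldots,f(a_n),\sigma_{x^+})\to(\sigma_{x^-},g(b_1),\ldots,g(b_m))$ given by $f(p)$ followed by $\sigma_{b_m},\ldots,\sigma_{b_1}$, and by $\sigma_{a_n},\ldots,\sigma_{a_1}$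 followed by $g(p)$, are equal. It is fair if $\sigma_e$ is a universal 2-cell for every universal 1-cell $e$ of $X$; pseudo-natural if all $\sigma_a$ are universal 2-cells; a pseudo-natural equivalence if all $\sigma_a$ and all $\sigma_x$ are universal. Given two composable sequences of oplax transformations $\sigma^1,\ldots,\sigma^n$ and $\tau^1,\ldots,\tau^m$ ($n,m\ge1$), both starting at $f$ and ending at $g$, a modification $\mu:(\sigma^1,\ldots,\sigma^n)\to(\tau^1,\ldots,\tau^m)$ assigns to each 0-cell $x$ of $X$ a 2-cell $\mu_x:(\sigma^1_x,\ldots,\sigma^n_x)\to(\tau^1_x,\ldots,\tau^m_x)$ of $Y$ such that, for all 1-cells $a:x\to y$ of $X$, the two composites $(f(a),\sigma^1_y,\ldots,\sigma^n_y)\to(\tau^1_x,\ldots,\tau^m_x,g(a))$ given by $\mu_y$ followed by $\tau^1_a,\ldots,\tau^m_a$, and by $\sigma^1_a,\ldots,\sigma^n_a$ followed by $\mu_x$, are equal. In $\mathbf{MrgBiCat}_\otimes$ these notions are considered for strong morphisms $f,g$ of representable merge-bicategories. Bicategories. Horizontal composition is written $a\otimes b$ in diagrammatic order, vertical composition $p;q$, with associators $\alpha_{a,b,c}:(a\otimes b)\otimes c\to a\otimes(b\otimes c)$ and unitors $\lambda_a:1_x\otimes a\to a$, $\rho_a:a\otimes 1_y\to a$. Functors are pseudofunctors, with structural isomorphisms $f_{a,b}:f(a)\otimes f(b)\to f(a\otimes b)$ (natural in $a,b$) and $f_x:1_{f(x)}\to f(1_x)$ compatible with associators and unitors. An oplax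 transformation $\sigma:f\to g$ of functors $f,g:B\to C$ has 1-cells $\sigma_x:f(x)\to g(x)$ and 2-cells $\sigma_a:f(a)\otimes\sigma_y\to\sigma_x\otimes g(a)$, natural in $a$ with respect to 2-cells, satisfying, up to associators, $(f_{a,b}\otimes\sigma_z);\sigma_{a\otimes b}=(f(a)\otimes\sigma_b);(\sigma_a\otimes g(b));(\sigma_x\otimes g_{a,b})$, for all $a:x\to y$, $b:y\to z$, and $(f_x\otimes\sigma_x);\sigma_{1_x}=\lambda_{\sigma_x};\rho_{\sigma_x}^{-1};(\sigma_x\otimes g_x)$. It is a pseudo-natural transformation if all $\sigma_a$ are isomorphisms, and a pseudo-natural equivalence if moreover all $\sigma_x$ are equivalences (invertible up to isomorphism with respect to $\otimes$). A modification $\mu:\sigma\to\tau$ of oplax transformations $\sigma,\tau:f\to g$ is a family of 2-cells $\mu_x:\sigma_x\to\tau_x$ with $\sigma_a;(\mu_x\otimes g(a))=(f(a)\otimes\mu_y);\tau_a$ for all $a:x\to y$. The functors. $\int B$ has the 0-cells and 1-cells of $B$; its 2-cells $(a_1,\ldots,a_n)\to(b_1,\ldots,b_m)$ are the 2-cells of $B$ from the left-bracketed $\otimes$-composite of the $a_i$ to that of the $b_j$; merges use the unique coherence re-bracketings. $\int f$ equals $f$ on 0- and 1-cells and sends $p$ to $f(p)$ composed on both sides with the unique coherence cells built from $f_{a,b}$ and associators. $GX$ has the 0- and 1-cells of $X$ and the 2-cells with one input and one output, with vertical composition $\mathrm{cut}_{1,1}$ and horizontal structure defined from chosen tensors $t_{a,b}$,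 tensor units $1_x$ and coherent witnesses $\{l_a,r_a\}$ (i.e. $\mathrm{cut}_{1,2}(p,l_b)=\mathrm{cut}_{1,1}(l_a,p)$ for $p:(a,\Gamma)\to(b,\Delta)$; $\mathrm{cut}_{m,1}(p',r_b)=\mathrm{cut}_{1,n}(r_a,p')$ for $p':(\Gamma',a)\to(\Delta',b)$ with $n$ inputs, $m$ outputs; $\mathrm{cut}_{1,j}(r_a,q)=\mathrm{cut}_{1,j+1}(l_b,q)$ for $q$ with $j$-th, $(j+1)$-st inputs $a,b$; $l_{1_x}=r_{1_x}$) by $\mathrm{cut}_{1,1}(t_{a,b},p\otimes q)=\mathrm{cut}_{1,2}(q,\mathrm{cut}_{1,1}(p,t_{c,d}))$ for $p:(a)\to(c)$, $q:(b)\to(d)$, $\mathrm{cut}_{1,1}(\mathrm{cut}_{1,1}(t_{a,b},t_{a\otimes b,c}),\alpha_{a,b,c})=\mathrm{cut}_{1,2}(t_{b,c},t_{a,b\otimes c})$, $\mathrm{cut}_{1,1}(t_{1_x,a},\lambda_a)=l_a$, $\mathrm{cut}_{1,1}(t_{a,1_y},\rho_a)=r_a$; $Gf$ is the restriction of $f$ with $\mathrm{cut}_{1,1}(t_{f(a),f(b)},f_{a,b})=f(t_{a,b})$, $\mathrm{cut}_{1,1}(f_x,f(l_{1_x}))=l_{f(1_x)}$. *)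

(* Defs.v *)
From mathcomp Require Import all_boot.
From Stdlib Require Import IndefiniteDescription.

Set Implicit Arguments.
Unset Strict Implicit.
Unset Printing Implicit Defensive.

(* [npath E x y] : non-empty composable sequences, built by appending on the
   right (so that left-bracketed composites are structural recursions);
   [opath E x y] : possibly empty ones. *)
Inductive npath (V : Type) (E : V -> V -> Type) (x : V) : V -> Type :=
| one y : E x y -> npath E x y
| snoc y z : npath E x y -> E y z -> npath E x z.
Arguments one {V E x y}.
Arguments snoc {V E x y z}.

Inductive opath (V : Type) (E : V -> V -> Type) (x : V) : V -> Type :=
| onil : opath E x x
| osome y : npath E x y -> opath E x y.
Arguments onil {V E x}.
Arguments osome {V E x y}.

Section Paths.
Variables (V : Type) (E : V -> V -> Type).

Fixpoint nlen x y (Γ : npath E x y) : nat :=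
  match Γ with one _ _ => 1 | snoc _ _ Γ' _ => (nlen Γ').+1 end.

Definition olen x y (Γ : opath E x y) : nat :=
  match Γ with onil => 0 | osome _ Γ' => nlen Γ' end.

Fixpoint cat x y z (Γ : npath E x y) (Δ : npath E y z) {struct Δ} : npath E x z :=
  match Δ in npath _ _ z return npath E x z with
  | one _ a => snoc Γ a
  | snoc _ _ Δ' a => snoc (cat Γ Δ') a
  end.

Definition cat_on x y z (Γ : opath E x y) : npath E y z -> npath E x z :=
  match Γ in opath _ _ y return npath E y z -> npath E x z with
  | onil => id
  | osome _ Γ' => cat Γ'
  end.

Definition cat_no x y z (Γ : npath E x y) (Δ : opath E y z) : npath E x z :=
  match Δ in opath _ _ z return npath E x z with
  | onil => Γ
  | osome _ Δ' => cat Γ Δ'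
  end.

(* [lside x'' Δ1 Γ1], for Δ1 : x -> u and Γ1 : x' -> u, says that Γ1 or Δ1 is
   empty; [x''] is then the common source of (Γ1,Γ) and (Δ1,Δ), for any Γ
   starting at x and Δ starting at x'.  The two constructors do not overlap:
   in [LD] the sequence Δ1 is non-empty. *)
Inductive lside (u : V) :
    forall x x' : V, V -> opath E x u -> opath E x' u -> Type :=
| LG x' (Γ1 : opath E x' u) : @lside u u x' x' onil Γ1
| LD x (Δ1 : npath E x u) : @lside u x u x (osome Δ1) onil.

Inductive rside (v : V) :
    forall y y' : V, V -> opath E v y -> opath E v y' -> Type :=
| RG y' (Γ2 : opath E v y') : @rside v v y' y' onil Γ2
| RD y (Δ2 : npath E v y) : @rside v y v y (osome Δ2) onil.

(* Γ |-> (Γ1,Γ) *)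
Definition lin u x x' x'' (Δ1 : opath E x u) (Γ1 : opath E x' u)
    (l : lside x'' Δ1 Γ1) w : npath E x w -> npath E x'' w :=
  match l in @lside _ x x' x'' _ _ return npath E x w -> npath E x'' w with
  | LG _ Γ1 => cat_on Γ1
  | LD _ _ => id
  end.

(* Δ |-> (Δ1,Δ) *)
Definition lout u x x' x'' (Δ1 : opath E x u) (Γ1 : opath E x' u)
    (l : lside x'' Δ1 Γ1) w : npath E x' w -> npath E x'' w :=
  match l in @lside _ x x' x'' _ _ return npath E x' w -> npath E x'' w with
  | LG _ _ => id
  | LD _ Δ1 => cat Δ1
  end.

(* Γ |-> (Γ,Γ2) *)
Definition rin v y y' y'' (Δ2 : opath E v y) (Γ2 : opath E v y')
    (r : rside y'' Δ2 Γ2) w : npath E w y -> npath E w y'' :=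
  match r in @rside _ y y' y'' _ _ return npath E w y -> npath E w y'' with
  | RG _ Γ2 => fun Γ => cat_no Γ Γ2
  | RD _ _ => id
  end.

(* Δ |-> (Δ,Δ2) *)
Definition rout v y y' y'' (Δ2 : opath E v y) (Γ2 : opath E v y')
    (r : rside y'' Δ2 Γ2) w : npath E w y' -> npath E w y'' :=
  match r in @rside _ y y' y'' _ _ return npath E w y' -> npath E w y'' with
  | RG _ _ => id
  | RD _ Δ2 => fun Δ => cat Δ Δ2
  end.

(* [glue Γ Θ Ξ Δ A B] : the ways in which some t : (Γ) -> (Θ) and
   s : (Ξ) -> (Δ) can be merged into a 2-cell (A) -> (B), namely
   Θ = (Δ1,Λ,Δ2), Ξ = (Γ1,Λ,Γ2), A = (Γ1,Γ,Γ2) and B = (Δ1,Δ,Δ2).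
   As an indexed family it can be used for boundaries that have this shape only
   up to a propositional equality, so that no casts are needed below. *)
Inductive glue : forall x y (Γ Θ : npath E x y) x' y' (Ξ Δ : npath E x' y')
    x'' y'' (A B : npath E x'' y''), Type :=
| Glue u v x x' x'' y y' y''
    (Δ1 : opath E x u) (Γ1 : opath E x' u) (l : lside x'' Δ1 Γ1)
    (Δ2 : opath E v y) (Γ2 : opath E v y') (r : rside y'' Δ2 Γ2)
    (Γ : npath E x y) (Λ : npath E u v) (Δ : npath E x' y') :
    glue Γ (cat_on Δ1 (cat_no Λ Δ2))
         (cat_on Γ1 (cat_no Λ Γ2)) Δ
         (lin l (rin r Γ)) (lout l (rout r Δ)).

(* (|Δ1|, |Γ1|, |Λ|) : Λ occupies the outputs |Δ1|+1, .., |Δ1|+|Λ| of t and the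
   inputs |Γ1|+1, .., |Γ1|+|Λ| of s.  Since endpoints are typed and identity
   proofs are unique, a [glue] with given boundaries is determined by this. *)
Definition gpos x y (Γ Θ : npath E x y) x' y' (Ξ Δ : npath E x' y')
    x'' y'' (A B : npath E x'' y'') (W : glue Γ Θ Ξ Δ A B) : nat * nat * nat :=
  match W with
  | Glue _ _ _ _ _ _ _ _ Δ1 Γ1 _ _ _ _ _ Λ _ => (olen Δ1, olen Γ1, nlen Λ)
  end.

End Paths.

Arguments LG {V E u x'} Γ1.
Arguments LD {V E u x} Δ1.
Arguments RG {V E v y'} Γ2.
Arguments RD {V E v y} Δ2.

Fixpoint npmap V V' (E : V -> V -> Type) (E' : V' -> V' -> Type) (h : V -> V')
    (k : forall x y, E x y -> E' (h x) (h y)) x y (Γ : npath E x y) :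
    npath E' (h x) (h y) :=
  match Γ in npath _ _ y return npath E' (h x) (h y) with
  | one _ a => one (k _ _ a)
  | snoc _ _ Γ' a => snoc (npmap k Γ') (k _ _ a)
  end.

(* The port (c, k) is the k-th input, or output, of the c-th cell of the
   diagram; [wires] lists the identified pairs (output, input). *)
Definition port : Type := (nat * nat)%type.
Record diagram := Diagram {
  ins : seq port;
  outs : seq port;
  wires : seq (port * port) }.

Definition single (c n m : nat) : diagram :=
  Diagram [seq (c, k) | k <- iota 0 n] [seq (c, k) | k <- iota 0 m] [::].

Definition paste (p : nat * nat * nat) (D D' : diagram) : diagram :=
  let: (j, i, k) := p in
  Diagram
    (take i (ins D') ++ ins D ++ drop (i + k) (ins D'))
    (take j (outs D) ++ outs D' ++ drop (j + k) (outs D))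
    (wires D ++ wires D' ++
       zip (take k (drop j (outs D))) (take k (drop i (ins D')))).

Record mbicat_data := MBicatData {
  mob :> Type;
  mhom : mob -> mob -> Type;
  mcell : forall x y, npath mhom x y -> npath mhom x y -> Type;
  mrg : forall x y (Γ Θ : npath mhom x y) x' y' (Ξ Δ : npath mhom x' y')
    x'' y'' (A B : npath mhom x'' y''),
    glue Γ Θ Ξ Δ A B -> mcell Γ Θ -> mcell Ξ Δ -> mcell A B }.
Arguments mhom {m}.
Arguments mcell {m x y}.
Arguments mrg {m x y Γ Θ x' y' Ξ Δ x'' y'' A B}.

(* Up to renaming, the pairs of different evaluations by two merges of one and
   the same diagram of three 2-cells are: t before s before u;
   t before both s and u; both t and s before u. *)
Record is_mbicat (X : mbicat_data) : Prop := IsMBicat {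
  mrg_assoc : forall x1 y1 x2 y2 x3 y3
    (Γt Θt : npath (@mhom X) x1 y1) (Γs Θs : npath (@mhom X) x2 y2)
    (Γu Θu : npath (@mhom X) x3 y3)
    (t : mcell Γt Θt) (s : mcell Γs Θs) (u : mcell Γu Θu)
    x4 y4 (A1 B1 : npath (@mhom X) x4 y4) x5 y5 (A2 B2 : npath (@mhom X) x5 y5)
    x6 y6 (A B : npath (@mhom X) x6 y6)
    (W1 : glue Γt Θt Γs Θs A1 B1) (W2 : glue A1 B1 Γu Θu A B)
    (W3 : glue Γs Θs Γu Θu A2 B2) (W4 : glue Γt Θt A2 B2 A B),
    let T := single 0 (nlen Γt) (nlen Θt) in
    let S := single 1 (nlen Γs) (nlen Θs) in
    let U := single 2 (nlen Γu) (nlen Θu) in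
    wires (paste (gpos W2) (paste (gpos W1) T S) U)
      =i wires (paste (gpos W4) T (paste (gpos W3) S U)) ->
    mrg W2 (mrg W1 t s) u = mrg W4 t (mrg W3 s u);
  mrg_fork : forall x1 y1 x2 y2 x3 y3
    (Γt Θt : npath (@mhom X) x1 y1) (Γs Θs : npath (@mhom X) x2 y2)
    (Γu Θu : npath (@mhom X) x3 y3)
    (t : mcell Γt Θt) (s : mcell Γs Θs) (u : mcell Γu Θu)
    x4 y4 (A1 B1 : npath (@mhom X) x4 y4) x5 y5 (A2 B2 : npath (@mhom X) x5 y5)
    x6 y6 (A B : npath (@mhom X) x6 y6)
    (W1 : glue Γt Θt Γs Θs A1 B1) (W2 : glue A1 B1 Γu Θu A B)
    (W3 : glue Γt Θt Γu Θu A2 B2) (W4 : glue A2 B2 Γs Θs A B),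
    let T := single 0 (nlen Γt) (nlen Θt) in
    let S := single 1 (nlen Γs) (nlen Θs) in
    let U := single 2 (nlen Γu) (nlen Θu) in
    wires (paste (gpos W2) (paste (gpos W1) T S) U)
      =i wires (paste (gpos W4) (paste (gpos W3) T U) S) ->
    mrg W2 (mrg W1 t s) u = mrg W4 (mrg W3 t u) s;
  mrg_join : forall x1 y1 x2 y2 x3 y3
    (Γt Θt : npath (@mhom X) x1 y1) (Γs Θs : npath (@mhom X) x2 y2)
    (Γu Θu : npath (@mhom X) x3 y3)
    (t : mcell Γt Θt) (s : mcell Γs Θs) (u : mcell Γu Θu)
    x4 y4 (A1 B1 : npath (@mhom X) x4 y4) x5 y5 (A2 B2 : npath (@mhom X) x5 y5)
    x6 y6 (A B : npath (@mhom X) x6 y6)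
    (W1 : glue Γs Θs Γu Θu A1 B1) (W2 : glue Γt Θt A1 B1 A B)
    (W3 : glue Γt Θt Γu Θu A2 B2) (W4 : glue Γs Θs A2 B2 A B),
    let T := single 0 (nlen Γt) (nlen Θt) in
    let S := single 1 (nlen Γs) (nlen Θs) in
    let U := single 2 (nlen Γu) (nlen Θu) in
    wires (paste (gpos W2) T (paste (gpos W1) S U))
      =i wires (paste (gpos W4) S (paste (gpos W3) T U)) ->
    mrg W2 t (mrg W1 s u) = mrg W4 s (mrg W3 t u) }.

Arguments mrg_assoc {X} _ {x1 y1 x2 y2 x3 y3 Γt Θt Γs Θs Γu Θu} t s u
  {x4 y4 A1 B1 x5 y5 A2 B2 x6 y6 A B} W1 W2 W3 W4.
Arguments mrg_fork {X} _ {x1 y1 x2 y2 x3 y3 Γt Θt Γs Θs Γu Θu} t s u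
  {x4 y4 A1 B1 x5 y5 A2 B2 x6 y6 A B} W1 W2 W3 W4.
Arguments mrg_join {X} _ {x1 y1 x2 y2 x3 y3 Γt Θt Γs Θs Γu Θu} t s u
  {x4 y4 A1 B1 x5 y5 A2 B2 x6 y6 A B} W1 W2 W3 W4.

Definition plug (X : mbicat_data) (x u v y : X) (Γ1 : opath (@mhom X) x u)
    (Γ2 : opath (@mhom X) v y) (Γ Λ : npath (@mhom X) u v)
    (Δ : npath (@mhom X) x y)
    (t : mcell Γ Λ) (s : mcell (cat_on Γ1 (cat_no Λ Γ2)) Δ) :
    mcell (cat_on Γ1 (cat_no Γ Γ2)) Δ :=
  mrg (Glue (LG Γ1) (RG Γ2) Γ Λ Δ) t s.
Arguments plug {X x u v y} Γ1 Γ2 {Γ Λ Δ}.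

Section Universality.
Variable X : mbicat_data.
Implicit Types x y z u v : X.

(* (gpos W).2 = nlen Γ says that all of Γ is merged; the boundaries of the merge
   are then those of the 2-cell s or t. *)
Definition is_unit x y (Γ : npath (@mhom X) x y) (i : mcell Γ Γ) : Prop :=
  (forall x' y' (Ξ Δ : npath (@mhom X) x' y') (W : glue Γ Γ Ξ Δ Ξ Δ)
     (s : mcell Ξ Δ), (gpos W).2 = nlen Γ -> mrg W i s = s) /\
  (forall x' y' (Ξ Δ : npath (@mhom X) x' y') (W : glue Ξ Δ Γ Γ Ξ Δ)
     (t : mcell Ξ Δ), (gpos W).2 = nlen Γ -> mrg W t i = t).

Definition unital : Prop :=
  forall x y (Γ : npath (@mhom X) x y), exists i : mcell Γ Γ, is_unit i.

(* universal at the output a, preceded by Δ1 and followed by Δ2 *)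
Definition univ_out x u v y (Δ1 : opath mhom x u) (a : mhom u v)
    (Δ2 : opath mhom v y) (Γ : npath (@mhom X) x y)
    (t : mcell Γ (cat_on Δ1 (cat_no (one a) Δ2))) : Prop :=
  forall x' x'' (Γ1 : opath mhom x' u) (l : lside x'' Δ1 Γ1)
         y' y'' (Γ2 : opath mhom v y') (r : rside y'' Δ2 Γ2)
         (Δ : npath mhom x' y')
         (s : mcell (lin l (rin r Γ)) (lout l (rout r Δ))),
  exists! q : mcell (cat_on Γ1 (cat_no (one a) Γ2)) Δ,
    mrg (Glue l r Γ (one a) Δ) t q = s.

(* universal at the input a, preceded by Γ1 and followed by Γ2 *)
Definition univ_in x' u v y' (Γ1 : opath mhom x' u) (a : mhom u v)
    (Γ2 : opath mhom v y') (Δ : npath (@mhom X) x' y')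
    (t : mcell (cat_on Γ1 (cat_no (one a) Γ2)) Δ) : Prop :=
  forall x x'' (Δ1 : opath mhom x u) (l : lside x'' Δ1 Γ1)
         y y'' (Δ2 : opath mhom v y) (r : rside y'' Δ2 Γ2)
         (Γ : npath mhom x y)
         (s : mcell (lin l (rin r Γ)) (lout l (rout r Δ))),
  exists! q : mcell Γ (cat_on Δ1 (cat_no (one a) Δ2)),
    mrg (Glue l r Γ (one a) Δ) q t = s.

(* In the second clause l and r only record that nothing is added to the
   inputs of q. *)
Definition universal2 u v (Γ Δ : npath (@mhom X) u v) (t : mcell Γ Δ) : Prop :=
  (forall x y (Γ1 : opath mhom x u) (Γ2 : opath mhom v y)
     (Δ' : npath mhom x y) (s : mcell (cat_on Γ1 (cat_no Γ Γ2)) Δ'),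
   exists! q : mcell (cat_on Γ1 (cat_no Δ Γ2)) Δ', plug Γ1 Γ2 t q = s) /\
  (forall x x'' (Δ1 : opath mhom x u) (l : lside x'' Δ1 onil)
          y y'' (Δ2 : opath mhom v y) (r : rside y'' Δ2 onil)
          (Γ' : npath mhom x y)
          (s : mcell (lin l (rin r Γ')) (lout l (rout r Δ))),
   exists! q : mcell Γ' (cat_on Δ1 (cat_no Γ Δ2)),
     mrg (Glue l r Γ' Γ Δ) q t = s).

(* universality of (a,b) -> (c) at ∂_1^+, ∂_1^- and ∂_2^- *)
Definition out1 x y z (a : mhom x y) (b : mhom y z) (c : mhom x z)
    (t : mcell (snoc (one a) b) (one c)) : Prop :=
  @univ_out x x z z onil c onil (snoc (one a) b) t.
Definition in1 x y z (a : mhom x y) (b : mhom y z) (c : mhom x z)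
    (t : mcell (snoc (one a) b) (one c)) : Prop :=
  @univ_in x x y z onil a (osome (one b)) (one c) t.
Definition in2 x y z (a : mhom x y) (b : mhom y z) (c : mhom x z)
    (t : mcell (snoc (one a) b) (one c)) : Prop :=
  @univ_in x y z z (osome (one a)) b onil (one c) t.

(* universality of (c) -> (a,b) at ∂_1^-, ∂_1^+ and ∂_2^+ *)
Definition co_in1 x y z (a : mhom x y) (b : mhom y z) (c : mhom x z)
    (t : mcell (one c) (snoc (one a) b)) : Prop :=
  @univ_in x x z z onil c onil (snoc (one a) b) t.
Definition co_out1 x y z (a : mhom x y) (b : mhom y z) (c : mhom x z)
    (t : mcell (one c) (snoc (one a) b)) : Prop :=
  @univ_out x x y z onil a (osome (one b)) (one c) t.
Definition co_out2 x y z (a : mhom x y) (b : mhom y z) (c : mhom x z)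
    (t : mcell (one c) (snoc (one a) b)) : Prop :=
  @univ_out x y z z (osome (one a)) b onil (one c) t.

Definition is_tensor x y z (a : mhom x y) (b : mhom y z) (c : mhom x z)
    (t : mcell (snoc (one a) b) (one c)) : Prop := out1 t.
Definition is_par x y z (a : mhom x y) (b : mhom y z) (c : mhom x z)
    (t : mcell (one c) (snoc (one a) b)) : Prop := co_in1 t.

Definition tensor_unit x (e : mhom x x) : Prop :=
  (forall y (a : mhom x y),
     exists l : mcell (snoc (one e) a) (one a), out1 l /\ in2 l) /\
  (forall z (b : mhom z x),
     exists r : mcell (snoc (one b) e) (one b), out1 r /\ in1 r).

Definition par_unit x (e : mhom x x) : Prop :=
  (forall y (a : mhom x y),
     exists l : mcell (one a) (snoc (one e) a), co_in1 l /\ co_out2 l) /\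
  (forall z (b : mhom z x),
     exists r : mcell (one b) (snoc (one b) e), co_in1 r /\ co_out1 r).

Definition tensor_universal x x' (e : mhom x x') : Prop :=
  [/\ forall y (a : mhom x y), exists (u : mhom x' y)
        (t : mcell (snoc (one e) u) (one a)), out1 t /\ in2 t,
      forall y (a' : mhom x' y), exists (v : mhom x y)
        (t : mcell (snoc (one e) a') (one v)), out1 t /\ in2 t,
      forall z (b' : mhom z x'), exists (u' : mhom z x)
        (t : mcell (snoc (one u') e) (one b')), out1 t /\ in1 t
    & forall z (b : mhom z x), exists (v' : mhom z x')
        (t : mcell (snoc (one b) e) (one v')), out1 t /\ in1 t].

Definition par_universal x x' (e : mhom x x') : Prop :=
  [/\ forall y (a : mhom x y), exists (u : mhom x' y)
        (t : mcell (one a) (snoc (one e) u)), co_in1 t /\ co_out2 t,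
      forall y (a' : mhom x' y), exists (v : mhom x y)
        (t : mcell (one v) (snoc (one e) a')), co_in1 t /\ co_out2 t,
      forall z (b' : mhom z x'), exists (u' : mhom z x)
        (t : mcell (one b') (snoc (one u') e)), co_in1 t /\ co_out1 t
    & forall z (b : mhom z x), exists (v' : mhom z x')
        (t : mcell (one v') (snoc (one b) e)), co_in1 t /\ co_out1 t].

Definition universal1 x x' (e : mhom x x') : Prop :=
  tensor_universal e /\ par_universal e.

Record representable : Prop := Representable {
  rep_unital : unital;
  rep_tensor_unit : forall x, exists e : mhom x x, tensor_unit e;
  rep_par_unit : forall x, exists e : mhom x x, par_unit e;
  rep_tensor : forall x y z (a : mhom x y) (b : mhom y z), exists (c : mhom x z)
    (t : mcell (snoc (one a) b) (one c)), is_tensor t;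
  rep_par : forall x y z (a : mhom x y) (b : mhom y z), exists (c : mhom x z)
    (t : mcell (one c) (snoc (one a) b)), is_par t }.

End Universality.

Record rep_mbicat := RepMBicat {
  rep_data :> mbicat_data;
  rep_is_mbicat : is_mbicat rep_data;
  rep_representable : representable rep_data }.

Record mor_data (X Y : mbicat_data) := MorData {
  m0 :> X -> Y;
  m1 : forall x y, @mhom X x y -> @mhom Y (m0 x) (m0 y);
  m2 : forall x y (Γ Δ : npath (@mhom X) x y),
    mcell Γ Δ -> mcell (npmap m1 Γ) (npmap m1 Δ) }.
Arguments m1 {X Y} m {x y}.
Arguments m2 {X Y} m {x y Γ Δ}.

Notation mpath f := (npmap (fun x y => @m1 _ _ f x y)).

Definition is_mor X Y (f : mor_data X Y) : Prop :=
  forall x y (Γ Θ : npath (@mhom X) x y) x' y' (Ξ Δ : npath (@mhom X) x' y')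
    x'' y'' (A B : npath (@mhom X) x'' y'') (W : glue Γ Θ Ξ Δ A B)
    (W' : glue (mpath f Γ) (mpath f Θ) (mpath f Ξ) (mpath f Δ)
               (mpath f A) (mpath f B)) (t : mcell Γ Θ) (s : mcell Ξ Δ),
  gpos W = gpos W' -> m2 f (mrg W t s) = mrg W' (m2 f t) (m2 f s).

Record is_strong X Y (f : mor_data X Y) : Prop := IsStrong {
  strong_unit : forall x y (a : mhom x y) (i : mcell (one a) (one a)),
    is_unit i -> is_unit (m2 f i : mcell (one _) (one _));
  strong_tensor1 : forall x y (e : @mhom X x y),
    tensor_universal e -> tensor_universal (m1 f e);
  strong_par1 : forall x y (e : @mhom X x y),
    par_universal e -> par_universal (m1 f e);
  strong_tensor : forall x y z (a : mhom x y) (b : mhom y z) (c : mhom x z)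
    (t : mcell (snoc (one a) b) (one c)), is_tensor t ->
    is_tensor (m2 f t : mcell (snoc (one _) _) (one _));
  strong_par : forall x y z (a : mhom x y) (b : mhom y z) (c : mhom x z)
    (t : mcell (one c) (snoc (one a) b)), is_par t ->
    is_par (m2 f t : mcell (one _) (snoc (one _) _)) }.

Record strong_mor (X Y : mbicat_data) := StrongMor {
  strong_data :> mor_data X Y;
  strong_is_mor : is_mor strong_data;
  strong_is_strong : is_strong strong_data }.

Record mtrans (X Y : mbicat_data) (f g : mor_data X Y) := MTrans {
  mt0 :> forall x, mhom (f x) (g x);
  mt1 : forall x y (a : mhom x y),
    mcell (snoc (one (m1 f a)) (mt0 y)) (snoc (one (mt0 x)) (m1 g a)) }.
Arguments mt1 {X Y f g} m {x y}.

Section MTrans.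
Variables X Y : mbicat_data.

(* The pasting of σ_{a_n}, .., σ_{a_1}.  By associativity of merges, f(p)
   followed by σ_{b_m}, .., σ_{b_1} one at a time is f(p) followed by this
   pasting, and similarly for the other composites below. *)
Fixpoint mt_seq (f g : mor_data X Y) (σ : mtrans f g) x y
    (Γ : npath mhom x y) :
    mcell (snoc (mpath f Γ) (σ y)) (cat (one (σ x)) (mpath g Γ)) :=
  match Γ in npath _ _ y return
    mcell (snoc (mpath f Γ) (σ y)) (cat (one (σ x)) (mpath g Γ)) with
  | one _ a => mt1 σ a
  | snoc y z Γ' a =>
    mrg (Glue (LG (osome (mpath f Γ'))) (RD (one (m1 g a)))
              (snoc (one (m1 f a)) (σ z)) (one (σ y))
              (cat (one (σ x)) (mpath g Γ')))
        (mt1 σ a) (mt_seq σ Γ')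
  end.

Definition is_moplax (f g : mor_data X Y) (σ : mtrans f g) : Prop :=
  forall x y (Γ Δ : npath (@mhom X) x y) (p : mcell Γ Δ),
  mrg (Glue (LG onil) (RG (osome (one (σ y)))) (mpath f Γ) (mpath f Δ)
            (cat (one (σ x)) (mpath g Δ)))
      (m2 f p) (mt_seq σ Δ)
  = mrg (Glue (LD (one (σ x))) (RG onil) (snoc (mpath f Γ) (σ y)) (mpath g Γ)
              (mpath g Δ))
        (mt_seq σ Γ) (m2 g p).

Definition is_fair (f g : mor_data X Y) (σ : mtrans f g) : Prop :=
  is_moplax σ /\
  forall x y (e : @mhom X x y), universal1 e -> universal2 (mt1 σ e).

Definition is_mpseudo (f g : mor_data X Y) (σ : mtrans f g) : Prop :=
  is_moplax σ /\ forall x y (a : @mhom X x y), universal2 (mt1 σ a).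

Definition is_mequiv (f g : mor_data X Y) (σ : mtrans f g) : Prop :=
  [/\ is_moplax σ, forall x y (a : @mhom X x y), universal2 (mt1 σ a)
    & forall x, universal1 (σ x)].

Record fair_trans (f g : mor_data X Y) := FairTrans {
  fair_data :> mtrans f g;
  fair_is_fair : is_fair fair_data }.

(* Composable sequences of transformations are presented by paths in a quiver
   Q whose vertices and edges are sent by F and S to morphisms and
   transformations. *)
Section Modifications.
Variables (I : Type) (Q : I -> I -> Type) (F : I -> mor_data X Y).
Variable S : forall i j, Q i j -> mtrans (F i) (F j).

Definition mts0 i j (Σ : npath Q i j) (x : X) : npath mhom (F i x) (F j x) :=
  npmap (fun i j (q : Q i j) => S q x) Σ.

Fixpoint mts1 i j (Σ : npath Q i j) (x y : X) (a : mhom x y) :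
    mcell (cat (one (m1 (F i) a)) (mts0 Σ y)) (snoc (mts0 Σ x) (m1 (F j) a)) :=
  match Σ in npath _ _ j return
    mcell (cat (one (m1 (F i) a)) (mts0 Σ y)) (snoc (mts0 Σ x) (m1 (F j) a))
  with
  | one _ q => mt1 (S q) a
  | snoc j k Σ' q =>
    mrg (Glue (LD (mts0 Σ' x)) (RG (osome (one (S q y))))
              (cat (one (m1 (F i) a)) (mts0 Σ' y)) (one (m1 (F j) a))
              (snoc (one (S q x)) (m1 (F k) a)))
        (mts1 Σ' a) (mt1 (S q) a)
  end.

Definition is_mmod i j (Σ T : npath Q i j)
    (μ : forall x, mcell (mts0 Σ x) (mts0 T x)) : Prop :=
  forall x y (a : mhom x y),
  mrg (Glue (LG (osome (one (m1 (F i) a)))) (RG onil) (mts0 Σ y) (mts0 T y)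
            (snoc (mts0 T x) (m1 (F j) a)))
      (μ y) (mts1 T a)
  = mrg (Glue (LG onil) (RD (one (m1 (F j) a)))
              (cat (one (m1 (F i) a)) (mts0 Σ y)) (mts0 Σ x) (mts0 T x))
        (mts1 Σ a) (μ x).

End Modifications.
End MTrans.

Definition fair_quiver (X Y : mbicat_data) (h k : strong_mor X Y) : Type :=
  fair_trans h k.
Definition fair_tr (X Y : mbicat_data) (h k : strong_mor X Y)
    (σ : fair_quiver h k) : mtrans h k := σ.

Record bicat_data := BicatData {
  bob :> Type;
  bhom : bob -> bob -> Type;
  bcell : forall x y, bhom x y -> bhom x y -> Type;
  bid2 : forall x y (a : bhom x y), bcell a a;
  vcomp : forall x y (a b c : bhom x y), bcell a b -> bcell b c -> bcell a c;
  bid1 : forall x, bhom x x;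
  tens : forall x y z, bhom x y -> bhom y z -> bhom x z;
  htens : forall x y z (a c : bhom x y) (b d : bhom y z),
    bcell a c -> bcell b d -> bcell (tens a b) (tens c d);
  bassoc : forall x y z w (a : bhom x y) (b : bhom y z) (c : bhom z w),
    bcell (tens (tens a b) c) (tens a (tens b c));
  bassocV : forall x y z w (a : bhom x y) (b : bhom y z) (c : bhom z w),
    bcell (tens a (tens b c)) (tens (tens a b) c);
  blun : forall x y (a : bhom x y), bcell (tens (bid1 x) a) a;
  blunV : forall x y (a : bhom x y), bcell a (tens (bid1 x) a);
  brun : forall x y (a : bhom x y), bcell (tens a (bid1 y)) a;
  brunV : forall x y (a : bhom x y), bcell a (tens a (bid1 y)) }.
Arguments bhom {_}.
Arguments bcell {_ _ _}.
Arguments bid2 {_ _ _}.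
Arguments vcomp {_ _ _ _ _ _}.
Arguments bid1 {_}.
Arguments tens {_ _ _ _}.
Arguments htens {_ _ _ _ _ _ _ _}.
Arguments bassoc {_ _ _ _ _}.
Arguments bassocV {_ _ _ _ _}.
Arguments blun {_ _ _}.
Arguments blunV {_ _ _}.
Arguments brun {_ _ _}.
Arguments brunV {_ _ _}.

Declare Scope bicat_scope.
Delimit Scope bicat_scope with bicat.
Notation "p ;; q" := (vcomp p q) (at level 49, left associativity) : bicat_scope.
Notation "a ⊗ b" := (tens a b) (at level 40, left associativity) : bicat_scope.
Notation "p ⊠ q" := (htens p q) (at level 40, left associativity) : bicat_scope.
Local Open Scope bicat_scope.

Definition mutual_inverse (B : bicat_data) (x y : B) (a b : bhom x y)
    (p : bcell a b) (q : bcell b a) : Prop :=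
  p ;; q = bid2 a /\ q ;; p = bid2 b.

Definition is_iso2 (B : bicat_data) (x y : B) (a b : bhom x y)
    (p : bcell a b) : Prop := exists q, mutual_inverse p q.

Definition is_equiv1 (B : bicat_data) (x y : B) (e : bhom x y) : Prop :=
  exists u : bhom y x,
    (exists p : bcell (e ⊗ u) (bid1 x), is_iso2 p) /\
    (exists q : bcell (u ⊗ e) (bid1 y), is_iso2 q).

Record is_bicat (B : bicat_data) : Prop := IsBicat {
  vcompA : forall (x y : B) (a b c d : bhom x y)
    (p : bcell a b) (q : bcell b c) (r : bcell c d),
    p ;; (q ;; r) = p ;; q ;; r;
  vcomp1p : forall (x y : B) (a b : bhom x y) (p : bcell a b),
    bid2 a ;; p = p;
  vcompp1 : forall (x y : B) (a b : bhom x y) (p : bcell a b),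
    p ;; bid2 b = p;
  htens_id : forall (x y z : B) (a : bhom x y) (b : bhom y z),
    bid2 a ⊠ bid2 b = bid2 (a ⊗ b);
  htens_vcomp : forall (x y z : B) (a a' a'' : bhom x y) (b b' b'' : bhom y z)
    (p : bcell a a') (p' : bcell a' a'') (q : bcell b b') (q' : bcell b' b''),
    (p ;; p') ⊠ (q ;; q') = (p ⊠ q) ;; (p' ⊠ q');
  bassocK : forall (x y z w : B) (a : bhom x y) (b : bhom y z) (c : bhom z w),
    mutual_inverse (bassoc a b c) (bassocV a b c);
  blunK : forall (x y : B) (a : bhom x y), mutual_inverse (blun a) (blunV a);
  brunK : forall (x y : B) (a : bhom x y), mutual_inverse (brun a) (brunV a);
  bassoc_nat : forall (x y z w : B) (a a' : bhom x y) (b b' : bhom y z)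
    (c c' : bhom z w) (p : bcell a a') (q : bcell b b') (r : bcell c c'),
    (p ⊠ q ⊠ r) ;; bassoc a' b' c' = bassoc a b c ;; (p ⊠ (q ⊠ r));
  blun_nat : forall (x y : B) (a b : bhom x y) (p : bcell a b),
    (bid2 (bid1 x) ⊠ p) ;; blun b = blun a ;; p;
  brun_nat : forall (x y : B) (a b : bhom x y) (p : bcell a b),
    (p ⊠ bid2 (bid1 y)) ;; brun b = brun a ;; p;
  pentagon : forall (x y z w v : B)
    (a : bhom x y) (b : bhom y z) (c : bhom z w) (d : bhom w v),
    (bassoc a b c ⊠ bid2 d) ;; bassoc a (b ⊗ c) d ;; (bid2 a ⊠ bassoc b c d)
    = bassoc (a ⊗ b) c d ;; bassoc a b (c ⊗ d);
  triangle : forall (x y z : B) (a : bhom x y) (b : bhom y z),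
    bassoc a (bid1 y) b ;; (bid2 a ⊠ blun b) = brun a ⊠ bid2 b }.

Record bicat := Bicat {
  bicat_bdata :> bicat_data;
  bicat_is_bicat : is_bicat bicat_bdata }.

Record psf_data (B C : bicat_data) := PsfData {
  F0 :> B -> C;
  F1 : forall x y, @bhom B x y -> @bhom C (F0 x) (F0 y);
  F2 : forall x y (a b : @bhom B x y), bcell a b -> bcell (F1 a) (F1 b);
  Ft : forall x y z (a : bhom x y) (b : bhom y z),
    bcell (F1 a ⊗ F1 b) (F1 (a ⊗ b));
  FtV : forall x y z (a : bhom x y) (b : bhom y z),
    bcell (F1 (a ⊗ b)) (F1 a ⊗ F1 b);
  Fu : forall x, bcell (bid1 (F0 x)) (F1 (bid1 x)) }.
Arguments F1 {B C} p {x y}.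
Arguments F2 {B C} p {x y a b}.
Arguments Ft {B C} p {x y z}.
Arguments FtV {B C} p {x y z}.
Arguments Fu {B C}.

Record is_psf (B C : bicat_data) (f : psf_data B C) : Prop := IsPsf {
  F2_id : forall x y (a : bhom x y), F2 f (bid2 a) = bid2 (F1 f a);
  F2_vcomp : forall x y (a b c : bhom x y) (p : bcell a b) (q : bcell b c),
    F2 f (p ;; q) = F2 f p ;; F2 f q;
  FtK : forall x y z (a : bhom x y) (b : bhom y z),
    mutual_inverse (Ft f a b) (FtV f a b);
  FuK : forall x, is_iso2 (Fu f x);
  Ft_nat : forall x y z (a c : bhom x y) (b d : bhom y z)
    (p : bcell a c) (q : bcell b d),
    (F2 f p ⊠ F2 f q) ;; Ft f c d = Ft f a b ;; F2 f (p ⊠ q);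
  Ft_assoc : forall x y z w (a : bhom x y) (b : bhom y z) (c : bhom z w),
    (Ft f a b ⊠ bid2 (F1 f c)) ;; Ft f (a ⊗ b) c ;; F2 f (bassoc a b c)
    = bassoc (F1 f a) (F1 f b) (F1 f c) ;; (bid2 (F1 f a) ⊠ Ft f b c)
        ;; Ft f a (b ⊗ c);
  Fu_left : forall x y (a : bhom x y),
    (Fu f x ⊠ bid2 (F1 f a)) ;; Ft f (bid1 x) a ;; F2 f (blun a)
    = blun (F1 f a);
  Fu_right : forall x y (a : bhom x y),
    (bid2 (F1 f a) ⊠ Fu f y) ;; Ft f a (bid1 y) ;; F2 f (brun a)
    = brun (F1 f a) }.

Record psfunctor (B C : bicat_data) := Psfunctor {
  psf_pdata :> psf_data B C;
  psf_is_psf : is_psf psf_pdata }.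

Record btrans (B C : bicat_data) (f g : psf_data B C) := BTrans {
  bt0 :> forall x, bhom (f x) (g x);
  bt1 : forall x y (a : bhom x y),
    bcell (F1 f a ⊗ bt0 y) (bt0 x ⊗ F1 g a) }.
Arguments bt1 {B C f g} b {x y}.

Section BTrans.
Variables B C : bicat_data.

Record is_boplax (f g : psf_data B C) (σ : btrans f g) : Prop := IsBoplax {
  bt_nat : forall x y (a b : bhom x y) (p : bcell a b),
    (F2 f p ⊠ bid2 (σ y)) ;; bt1 σ b = bt1 σ a ;; (bid2 (σ x) ⊠ F2 g p);
  bt_tens : forall x y z (a : bhom x y) (b : bhom y z),
    (Ft f a b ⊠ bid2 (σ z)) ;; bt1 σ (a ⊗ b)
    = bassoc (F1 f a) (F1 f b) (σ z) ;; (bid2 (F1 f a) ⊠ bt1 σ b)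
        ;; bassocV (F1 f a) (σ y) (F1 g b) ;; (bt1 σ a ⊠ bid2 (F1 g b))
        ;; bassoc (σ x) (F1 g a) (F1 g b) ;; (bid2 (σ x) ⊠ Ft g a b);
  bt_unit : forall x,
    (Fu f x ⊠ bid2 (σ x)) ;; bt1 σ (bid1 x)
    = blun (σ x) ;; brunV (σ x) ;; (bid2 (σ x) ⊠ Fu g x) }.

Definition is_bpseudo (f g : psf_data B C) (σ : btrans f g) : Prop :=
  is_boplax σ /\ forall x y (a : @bhom B x y), is_iso2 (bt1 σ a).

Definition is_bequiv (f g : psf_data B C) (σ : btrans f g) : Prop :=
  is_bpseudo σ /\ forall x, is_equiv1 (σ x).

Record boplax (f g : psf_data B C) := Boplax {
  boplax_data :> btrans f g;
  boplax_is_boplax : is_boplax boplax_data }.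

Definition is_bmod (f g : psf_data B C) (σ τ : btrans f g)
    (μ : forall x, bcell (σ x) (τ x)) : Prop :=
  forall x y (a : bhom x y),
    bt1 σ a ;; (μ x ⊠ bid2 (F1 g a)) = (bid2 (F1 f a) ⊠ μ y) ;; bt1 τ a.

End BTrans.

Definition oplax_quiver (B C : bicat_data) (h k : psfunctor B C) : Type :=
  boplax h k.
Definition oplax_tr (B C : bicat_data) (h k : psfunctor B C)
    (σ : oplax_quiver h k) : btrans h k := σ.

Fixpoint lcomp (B : bicat_data) (x y : B) (Γ : npath bhom x y) : bhom x y :=
  match Γ in npath _ _ y return bhom x y with
  | one _ a => a
  | snoc _ _ Γ' a => lcomp Γ' ⊗ a
  end.

(* The left-bracketed composite of a sequence of oplax transformations, with
   (σ⊗τ)_a = σ_a followed by τ_a up to associators; sequences are presented as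
   for [mts0] and [mts1]. *)
Section BComposite.
Variables (B C : bicat_data) (I : Type) (Q : I -> I -> Type).
Variables (F : I -> psf_data B C).
Variable S : forall i j, Q i j -> btrans (F i) (F j).

Definition bts0 i j (Σ : npath Q i j) (x : B) : npath bhom (F i x) (F j x) :=
  npmap (fun i j (q : Q i j) => S q x) Σ.

Fixpoint bts1 i j (Σ : npath Q i j) (x y : B) (a : bhom x y) :
    bcell (F1 (F i) a ⊗ lcomp (bts0 Σ y)) (lcomp (bts0 Σ x) ⊗ F1 (F j) a) :=
  match Σ in npath _ _ j return
    bcell (F1 (F i) a ⊗ lcomp (bts0 Σ y)) (lcomp (bts0 Σ x) ⊗ F1 (F j) a) with
  | one _ q => bt1 (S q) a
  | snoc j k Σ' q =>
    bassocV _ _ _ ;; (bts1 Σ' a ⊠ bid2 (S q y)) ;; bassoc _ _ _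
      ;; (bid2 (lcomp (bts0 Σ' x)) ⊠ bt1 (S q) a) ;; bassocV _ _ _
  end.

Definition bcomposite i j (Σ : npath Q i j) : btrans (F i) (F j) :=
  BTrans (fun x y (a : bhom x y) => bts1 Σ a).

End BComposite.

Section Int.
Variable B : bicat_data.
Implicit Types x y z w : B.

(* Of the coherence isomorphisms that re-bracket, only those built as below are
   needed in order to define merges. *)
Fixpoint split x y z (Γ : npath bhom x y) (Δ : npath bhom y z) :
    bcell (lcomp (cat Γ Δ)) (lcomp Γ ⊗ lcomp Δ) :=
  match Δ in npath _ _ z return
    bcell (lcomp (cat Γ Δ)) (lcomp Γ ⊗ lcomp Δ) with
  | one _ a => bid2 (lcomp Γ ⊗ a)
  | snoc _ _ Δ' a => (split Γ Δ' ⊠ bid2 a) ;; bassoc _ _ _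
  end.

Fixpoint join x y z (Γ : npath bhom x y) (Δ : npath bhom y z) :
    bcell (lcomp Γ ⊗ lcomp Δ) (lcomp (cat Γ Δ)) :=
  match Δ in npath _ _ z return
    bcell (lcomp Γ ⊗ lcomp Δ) (lcomp (cat Γ Δ)) with
  | one _ a => bid2 (lcomp Γ ⊗ a)
  | snoc _ _ Δ' a => bassocV _ _ _ ;; (join Γ Δ' ⊠ bid2 a)
  end.

(* Whiskering, up to re-bracketing, by a possibly empty sequence. *)
Definition lwhisk x y z (Γ1 : opath bhom x y) :
    forall (Γ Δ : npath bhom y z), bcell (lcomp Γ) (lcomp Δ) ->
    bcell (lcomp (cat_on Γ1 Γ)) (lcomp (cat_on Γ1 Δ)) :=
  match Γ1 in opath _ _ y return
    forall (Γ Δ : npath bhom y z), bcell (lcomp Γ) (lcomp Δ) ->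
    bcell (lcomp (cat_on Γ1 Γ)) (lcomp (cat_on Γ1 Δ)) with
  | onil => fun _ _ p => p
  | osome _ Γ1' => fun Γ Δ p =>
    split Γ1' Γ ;; (bid2 (lcomp Γ1') ⊠ p) ;; join Γ1' Δ
  end.

Definition rwhisk x y z (Γ2 : opath bhom y z) (Γ Δ : npath bhom x y)
    (p : bcell (lcomp Γ) (lcomp Δ)) :
    bcell (lcomp (cat_no Γ Γ2)) (lcomp (cat_no Δ Γ2)) :=
  match Γ2 in opath _ _ z return
    bcell (lcomp (cat_no Γ Γ2)) (lcomp (cat_no Δ Γ2)) with
  | onil => p
  | osome _ Γ2' => split Γ Γ2' ;; (p ⊠ bid2 (lcomp Γ2')) ;; join Δ Γ2'
  end.

(* The coherence cells between ((Γ,Λ),Δ) and (Γ,(Λ,Δ)), which are equal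
   sequences only propositionally. *)
Definition regroupL x y z w (Γ : opath bhom x y) :
    forall (Λ : npath bhom y z) (Δ : npath bhom z w),
    bcell (lcomp (cat_on Γ (cat Λ Δ))) (lcomp (cat (cat_on Γ Λ) Δ)) :=
  match Γ in opath _ _ y return
    forall (Λ : npath bhom y z) (Δ : npath bhom z w),
    bcell (lcomp (cat_on Γ (cat Λ Δ))) (lcomp (cat (cat_on Γ Λ) Δ)) with
  | onil => fun Λ Δ => bid2 _
  | osome _ Γ' => fun Λ Δ =>
    split Γ' (cat Λ Δ) ;; (bid2 (lcomp Γ') ⊠ split Λ Δ) ;; bassocV _ _ _
      ;; (join Γ' Λ ⊠ bid2 (lcomp Δ)) ;; join (cat Γ' Λ) Δ
  end.

Definition regroupR x y z w (Γ : npath bhom x y) (Λ : npath bhom y z)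
    (Δ : opath bhom z w) :
    bcell (lcomp (cat_no (cat Γ Λ) Δ)) (lcomp (cat Γ (cat_no Λ Δ))) :=
  match Δ in opath _ _ w return
    bcell (lcomp (cat_no (cat Γ Λ) Δ)) (lcomp (cat Γ (cat_no Λ Δ))) with
  | onil => bid2 _
  | osome _ Δ' =>
    split (cat Γ Λ) Δ' ;; (split Γ Λ ⊠ bid2 (lcomp Δ')) ;; bassoc _ _ _
      ;; (bid2 (lcomp Γ) ⊠ join Λ Δ') ;; join Γ (cat Λ Δ')
  end.

Definition int_mrg_lr u v x x' x'' y y' y''
    (Δ1 : opath bhom x u) (Γ1 : opath bhom x' u) (l : lside x'' Δ1 Γ1)
    (Δ2 : opath bhom v y) (Γ2 : opath bhom v y') (r : rside y'' Δ2 Γ2) :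
  forall (Γ : npath bhom x y) (Λ : npath bhom u v) (Δ : npath bhom x' y'),
    bcell (lcomp Γ) (lcomp (cat_on Δ1 (cat_no Λ Δ2))) ->
    bcell (lcomp (cat_on Γ1 (cat_no Λ Γ2))) (lcomp Δ) ->
    bcell (lcomp (lin l (rin r Γ))) (lcomp (lout l (rout r Δ))) :=
  match l in @lside _ _ _ x x' x'' Δ1 Γ1, r in @rside _ _ _ y y' y'' Δ2 Γ2
  return
    forall (Γ : npath bhom x y) (Λ : npath bhom u v) (Δ : npath bhom x' y'),
    bcell (lcomp Γ) (lcomp (cat_on Δ1 (cat_no Λ Δ2))) ->
    bcell (lcomp (cat_on Γ1 (cat_no Λ Γ2))) (lcomp Δ) ->
    bcell (lcomp (lin l (rin r Γ))) (lcomp (lout l (rout r Δ)))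
  with
  | LG _ Γ1, RG _ Γ2 => fun Γ Λ Δ t s => lwhisk Γ1 (rwhisk Γ2 t) ;; s
  | LG _ Γ1, RD _ Δ2 => fun Γ Λ Δ t s =>
    lwhisk Γ1 t ;; regroupL Γ1 Λ Δ2 ;; rwhisk (osome Δ2) s
  | LD _ Δ1, RG _ Γ2 => fun Γ Λ Δ t s =>
    rwhisk Γ2 t ;; regroupR Δ1 Λ Γ2 ;; lwhisk (osome Δ1) s
  | LD _ Δ1, RD _ Δ2 => fun Γ Λ Δ t s =>
    t ;; lwhisk (osome Δ1) (rwhisk (osome Δ2) s)
  end.

Definition int_mrg x y (Γ Θ : npath bhom x y) x' y' (Ξ Δ : npath bhom x' y')
    x'' y'' (A A' : npath bhom x'' y'') (W : glue Γ Θ Ξ Δ A A') :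
    bcell (lcomp Γ) (lcomp Θ) -> bcell (lcomp Ξ) (lcomp Δ) ->
    bcell (lcomp A) (lcomp A') :=
  match W in @glue _ _ _ _ Γ Θ _ _ Ξ Δ _ _ A A' return
    bcell (lcomp Γ) (lcomp Θ) -> bcell (lcomp Ξ) (lcomp Δ) ->
    bcell (lcomp A) (lcomp A') with
  | Glue _ _ _ _ _ _ _ _ _ _ l _ _ r Γ Λ Δ => @int_mrg_lr _ _ _ _ _ _ _ _ _ _ l _ _ r Γ Λ Δ
  end.

Definition int_bicat : mbicat_data :=
  @MBicatData B bhom (fun x y Γ Δ => bcell (lcomp Γ) (lcomp Δ)) int_mrg.

End Int.

Section IntFun.
Variables (B C : bicat_data) (f : psf_data B C).

Fixpoint Fseq x y (Γ : npath (@bhom B) x y) :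
    bcell (lcomp (npmap (@F1 _ _ f) Γ)) (F1 f (lcomp Γ)) :=
  match Γ in npath _ _ y return
    bcell (lcomp (npmap (@F1 _ _ f) Γ)) (F1 f (lcomp Γ)) with
  | one _ a => bid2 (F1 f a)
  | snoc _ _ Γ' a => (Fseq Γ' ⊠ bid2 (F1 f a)) ;; Ft f (lcomp Γ') a
  end.

Fixpoint FseqV x y (Γ : npath (@bhom B) x y) :
    bcell (F1 f (lcomp Γ)) (lcomp (npmap (@F1 _ _ f) Γ)) :=
  match Γ in npath _ _ y return
    bcell (F1 f (lcomp Γ)) (lcomp (npmap (@F1 _ _ f) Γ)) with
  | one _ a => bid2 (F1 f a)
  | snoc _ _ Γ' a => FtV f (lcomp Γ') a ;; (FseqV Γ' ⊠ bid2 (F1 f a))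
  end.

Definition int_fun : mor_data (int_bicat B) (int_bicat C) :=
  @MorData (int_bicat B) (int_bicat C) f (@F1 _ _ f)
    (fun x y Γ Δ p => Fseq Γ ;; F2 f p ;; FseqV Δ).

End IntFun.

(* The 2-cells (f(a),σ_y) -> (σ_x,g(a)) of ∫C are the 2-cells
   f(a) ⊗ σ_y -> σ_x ⊗ g(a) of C. *)
Definition int_trans (B C : bicat_data) (f g : psf_data B C) (σ : btrans f g) :
    mtrans (int_fun f) (int_fun g) :=
  @MTrans (int_bicat B) (int_bicat C) (int_fun f) (int_fun g) σ (@bt1 _ _ _ _ σ).

Definition choose_ex (T : Type) (P : T -> Prop) (h : exists t, P t) : T :=
  proj1_sig (constructive_indefinite_description P h).

Lemma choose_exP (T : Type) (P : T -> Prop) (h : exists t, P t) :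
  P (choose_ex h).
Proof. exact: (proj2_sig (constructive_indefinite_description P h)). Qed.

Definition the (T : Type) (P : T -> Prop) (h : exists! t, P t) : T :=
  choose_ex h.

(* Chosen tensors, tensor units and coherent witnesses of unitality.  The
   condition [gpos W = (j.-1, i.-1, 1)] says that W describes cut_{j,i}. *)
Record tensor_choice (X : mbicat_data) := TensorChoice {
  ct_ob : forall (x y z : X), mhom x y -> mhom y z -> mhom x z;
  ct : forall (x y z : X) (a : mhom x y) (b : mhom y z),
    mcell (snoc (one a) b) (one (ct_ob a b));
  ctP : forall (x y z : X) (a : mhom x y) (b : mhom y z), is_tensor (ct a b);
  cu : forall x : X, mhom x x;
  cl : forall (x y : X) (a : mhom x y), mcell (snoc (one (cu x)) a) (one a);
  cr : forall (x y : X) (b : mhom x y), mcell (snoc (one b) (cu y)) (one b);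
  clP : forall (x y : X) (a : mhom x y), out1 (cl a) /\ in2 (cl a);
  crP : forall (x y : X) (b : mhom x y), out1 (cr b) /\ in1 (cr b);
  cl_coh : forall (x u v y : X) (a : mhom x u) (b : mhom x v)
    (Γ : opath mhom u y) (Δ : opath mhom v y)
    (p : mcell (cat_no (one a) Γ) (cat_no (one b) Δ))
    x' y' (A A' : npath mhom x' y') (W : glue _ _ _ _ A A')
    (W' : glue _ _ _ _ A A'),
    gpos W = (0, 1, 1) -> gpos W' = (0, 0, 1) ->
    mrg W p (cl b) = mrg W' (cl a) p;
  cr_coh : forall (x u v y : X) (a : mhom u y) (b : mhom v y)
    (Γ : opath mhom x u) (Δ : opath mhom x v)
    (p : mcell (cat_on Γ (one a)) (cat_on Δ (one b)))
    x' y' (A A' : npath mhom x' y') (W : glue _ _ _ _ A A')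
    (W' : glue _ _ _ _ A A'),
    gpos W = (olen Δ, 0, 1) -> gpos W' = (0, olen Γ, 1) ->
    mrg W p (cr b) = mrg W' (cr a) p;
  clr_coh : forall (x u v w y : X) (a : mhom u v) (b : mhom v w)
    (Γ1 : opath mhom x u) (Γ2 : opath mhom w y) (Δ : npath mhom x y)
    (q : mcell (cat_on Γ1 (cat_no (snoc (one a) b) Γ2)) Δ)
    x' y' (A A' : npath mhom x' y') (W : glue _ _ _ _ A A')
    (W' : glue _ _ _ _ A A'),
    gpos W = (0, olen Γ1, 1) -> gpos W' = (0, (olen Γ1).+1, 1) ->
    mrg W (cr a) q = mrg W' (cl b) q;
  clr_unit : forall x : X, cl (cu x) = cr (cu x) }.
Arguments ct_ob {X} t {x y z}.
Arguments ct {X} t {x y z}.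
Arguments ctP {X} t {x y z}.
Arguments cu {X}.
Arguments cl {X} t {x y}.
Arguments cr {X} t {x y}.
Arguments clP {X} t {x y}.
Arguments crP {X} t {x y}.

(* The factorisation through t : (Γ) -> (c) of a 2-cell (Γ1,Γ,Γ2) -> (Δ). *)
Definition factor (X : mbicat_data) (x y : X) (Γ : npath mhom x y)
    (c : mhom x y) (t : mcell Γ (one c))
    (h : @univ_out X x x y y onil c onil Γ t)
    (x' y' : X) (Γ1 : opath mhom x' x) (Γ2 : opath mhom y y')
    (Δ : npath mhom x' y') (s : mcell (cat_on Γ1 (cat_no Γ Γ2)) Δ) :
    mcell (cat_on Γ1 (cat_no (one c) Γ2)) Δ :=
  the (h _ _ Γ1 (LG Γ1) _ _ Γ2 (RG Γ2) Δ s).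

Section GBicat.
Variables (X : rep_mbicat) (c : tensor_choice X).

Definition unit2 (x y : X) (Γ : npath mhom x y) : mcell Γ Γ :=
  choose_ex (rep_unital (rep_representable X) Γ).

Definition Gvcomp (x y : X) (a b d : mhom x y)
    (p : mcell (one a) (one b)) (q : mcell (one b) (one d)) :
    mcell (one a) (one d) :=
  plug onil onil p q.

Definition Ghtens (x y z : X) (a a' : mhom x y) (b b' : mhom y z)
    (p : mcell (one a) (one a')) (q : mcell (one b) (one b')) :
    mcell (one (ct_ob c a b)) (one (ct_ob c a' b')) :=
  factor (ctP c a b) (Γ1 := onil) (Γ2 := onil)
    (plug (osome (one a)) onil q (plug onil (osome (one b')) p (ct c a' b'))).

Definition tern_l (x y z w : X) (a : mhom x y) (b : mhom y z) (d : mhom z w) :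
    mcell (snoc (snoc (one a) b) d) (one (ct_ob c (ct_ob c a b) d)) :=
  plug onil (osome (one d)) (ct c a b) (ct c (ct_ob c a b) d).
Definition tern_r (x y z w : X) (a : mhom x y) (b : mhom y z) (d : mhom z w) :
    mcell (snoc (snoc (one a) b) d) (one (ct_ob c a (ct_ob c b d))) :=
  plug (osome (one a)) onil (ct c b d) (ct c a (ct_ob c b d)).

(* [tern_r] is factored through [tern_l], and conversely, in two steps, by
   mrg (mrg t t') α = mrg t (mrg t' α). *)
Definition Gassoc (x y z w : X) (a : mhom x y) (b : mhom y z) (d : mhom z w) :
    mcell (one (ct_ob c (ct_ob c a b) d)) (one (ct_ob c a (ct_ob c b d))) :=
  factor (ctP c (ct_ob c a b) d) (Γ1 := onil) (Γ2 := onil)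
    (factor (ctP c a b) (Γ1 := onil) (Γ2 := osome (one d)) (tern_r a b d)).
Definition GassocV (x y z w : X) (a : mhom x y) (b : mhom y z) (d : mhom z w) :
    mcell (one (ct_ob c a (ct_ob c b d))) (one (ct_ob c (ct_ob c a b) d)) :=
  factor (ctP c a (ct_ob c b d)) (Γ1 := onil) (Γ2 := onil)
    (factor (ctP c b d) (Γ1 := osome (one a)) (Γ2 := onil) (tern_l a b d)).

Definition Glun (x y : X) (a : mhom x y) :
    mcell (one (ct_ob c (cu c x) a)) (one a) :=
  factor (ctP c (cu c x) a) (Γ1 := onil) (Γ2 := onil) (cl c a).
Definition GlunV (x y : X) (a : mhom x y) :
    mcell (one a) (one (ct_ob c (cu c x) a)) :=
  factor (proj1 (clP c a)) (Γ1 := onil) (Γ2 := onil) (ct c (cu c x) a).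
Definition Grun (x y : X) (a : mhom x y) :
    mcell (one (ct_ob c a (cu c y))) (one a) :=
  factor (ctP c a (cu c y)) (Γ1 := onil) (Γ2 := onil) (cr c a).
Definition GrunV (x y : X) (a : mhom x y) :
    mcell (one a) (one (ct_ob c a (cu c y))) :=
  factor (proj1 (crP c a)) (Γ1 := onil) (Γ2 := onil) (ct c a (cu c y)).

Definition G_bicat : bicat_data :=
  @BicatData X (@mhom X) (fun x y a b => mcell (one a) (one b))
    (fun x y a => unit2 (one a)) Gvcomp (cu c) (@ct_ob _ c) Ghtens
    Gassoc GassocV Glun GlunV Grun GrunV.

(* (a_1,..,a_n) -> (a_1 ⊗ .. ⊗ a_n) *)
Fixpoint ct_seq (x y : X) (Γ : npath mhom x y) :
    mcell Γ (one (@lcomp G_bicat x y Γ)) :=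
  match Γ in npath _ _ y return mcell Γ (one (@lcomp G_bicat x y Γ)) with
  | one _ a => unit2 (one a)
  | snoc _ _ Γ' a =>
    plug onil (osome (one a)) (ct_seq Γ') (ct c (@lcomp G_bicat _ _ Γ') a)
  end.

End GBicat.

(* Existence of the 2-cell f_x of [G_fun], for e = f(1_x), m = f(l_{1_x}) and
   s = l_{f(1_x)}; it is also unique, but only existence
   is needed in order to define it. *)
Lemma tensor_universal_factor (Y : mbicat_data) (hY : is_mbicat Y)
    (rY : representable Y) (x : Y) (e j : mhom x x)
    (m : mcell (snoc (one e) e) (one e)) (s : mcell (snoc (one j) e) (one e)) :
  tensor_universal e -> out1 m ->
  exists w : mcell (one j) (one e), plug onil (osome (one e)) w m = s.
Proof.
case=> _ _ _ /(_ x e) [v [u [u_out u_in]]] m_out.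
have [p [pE _]] := u_out _ _ onil (LG onil) _ _ onil (RG onil) (one e) m.
have [q [qE _]] := m_out _ _ onil (LG onil) _ _ onil (RG onil) (one v) u.
have [i [iL iR]] := rep_unital rY (one e).
have [w [wE _]] := u_in _ _ onil (LG onil) _ _ onil (RG (osome (one e)))
  (one j) (plug onil onil s q).
have qp : plug onil onil q p = i.
  have [i' [_ i'U]] := m_out _ _ onil (LG onil) _ _ onil (RG onil) (one e) m.
  rewrite -(i'U (plug onil onil q p)) ?(i'U i) //.
    exact: (iR _ _ _ _ (Glue (LG onil) (RG onil) (snoc (one e) e) (one e) (one e))).
  rewrite -[RHS]pE -[in RHS]qE; symmetry.
  by apply: (mrg_assoc hY _ _ _ (Glue (LG onil) (RG onil) (snoc (one e) e) (one e) (one v))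
    (Glue (LG onil) (RG onil) (snoc (one e) e) (one v) (one e))
    (Glue (LG onil) (RG onil) (one e) (one v) (one e))
    (Glue (LG onil) (RG onil) (snoc (one e) e) (one e) (one e))) => ?; rewrite !inE orbC.
exists w.
transitivity (plug onil onil (plug onil (osome (one e)) w u) p).
  rewrite -[in LHS]pE; symmetry.
  by apply: (mrg_assoc hY _ _ _ (Glue (LG onil) (RG (osome (one e))) (one j) (one e) (one v))
    (Glue (LG onil) (RG onil) (snoc (one j) e) (one v) (one e))
    (Glue (LG onil) (RG onil) (snoc (one e) e) (one v) (one e))
    (Glue (LG onil) (RG (osome (one e))) (one j) (one e) (one e))) => ?; rewrite !inE orbC.

transitivity (plug onil onil (plug onil onil s q) p).
  by rewrite -wE.
transitivity (plug onil onil s (plug onil onil q p)).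
  by apply: (mrg_assoc hY _ _ _ (Glue (LG onil) (RG onil) (snoc (one j) e) (one e) (one v))
    (Glue (LG onil) (RG onil) (snoc (one j) e) (one v) (one e))
    (Glue (LG onil) (RG onil) (one e) (one v) (one e))
    (Glue (LG onil) (RG onil) (snoc (one j) e) (one e) (one e))) => ?; rewrite !inE orbC.
rewrite qp.
exact: (iR _ _ _ _ (Glue (LG onil) (RG onil) (snoc (one j) e) (one e) (one e))).
Qed.

Section GFun.
Variables (X Y : rep_mbicat) (cX : tensor_choice X) (cY : tensor_choice Y).
Variable f : strong_mor X Y.

Lemma cu_tensor_universal (x : X) : tensor_universal (cu cX x).
Proof.
split=> y a.
- by exists a, (cl cX a); exact: clP.
- by exists a, (cl cX a); exact: clP.
- by exists a, (cr cX a); exact: crP.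
- by exists a, (cr cX a); exact: crP.
Qed.

Lemma Gfun_tensor (x y z : X) (a : mhom x y) (b : mhom y z) :
  is_tensor (m2 f (ct cX a b) : mcell (snoc (one _) _) (one _)).
Proof. by apply: (strong_tensor (strong_is_strong f)); exact: ctP. Qed.

Lemma Gfun_unit (x : X) :
  exists p : mcell (one (cu cY (f x))) (one (m1 f (cu cX x))),
    plug onil (osome (one (m1 f (cu cX x)))) p
      (m2 f (cl cX (cu cX x)) : mcell (snoc (one _) _) (one _))
    = cl cY (m1 f (cu cX x)).
Proof.
apply: (@tensor_universal_factor Y (rep_is_mbicat Y) (rep_representable Y)
          (f x) (m1 f (cu cX x)) (cu cY (f x))).
  exact: (strong_tensor1 (strong_is_strong f) (cu_tensor_universal x)).
exact: (strong_tensor (strong_is_strong f) (proj1 (clP cX (cu cX x)))).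
Qed.

Definition G_fun : psf_data (G_bicat cX) (G_bicat cY) :=
  @PsfData (G_bicat cX) (G_bicat cY) f (fun x y a => m1 f a)
    (fun x y a b p => m2 f p)
    (fun x y z a b =>
       factor (ctP cY (m1 f a) (m1 f b)) (Γ1 := onil) (Γ2 := onil)
         (m2 f (ct cX a b)))
    (fun x y z a b =>
       factor (@Gfun_tensor x y z a b) (Γ1 := onil) (Γ2 := onil)
         (ct cY (m1 f a) (m1 f b)))
    (fun x => choose_ex (Gfun_unit x)).

End GFun.

Section GTrans.
Variables (X Y : rep_mbicat) (cX : tensor_choice X) (cY : tensor_choice Y).

(* (Gσ)_a is determined by t_{f(a),σ_y} ; (Gσ)_a = σ_a ; t_{σ_x,g(a)}. *)
Definition G_trans (f g : strong_mor X Y) (σ : mtrans f g) :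
    btrans (G_fun cX cY f) (G_fun cX cY g) :=
  @BTrans (G_bicat cX) (G_bicat cY) (G_fun cX cY f) (G_fun cX cY g) σ
    (fun x y a =>
       factor (ctP cY (m1 f a) (σ y)) (Γ1 := onil) (Γ2 := onil)
         (plug onil onil (mt1 σ a) (ct cY (σ x) (m1 g a)))).


(* For μ : (σ^1,..,σ^n) -> (τ^1,..,τ^m), Gμ is determined by
   t_Σ ; (Gμ)_x = μ_x ; t_T, with t_Σ and t_T the iterated tensors of the
   components of the two sequences at x. *)
Definition is_Gmod (f g : strong_mor X Y) (Σ T : npath (@fair_quiver X Y) f g)
    (μ : forall x, mcell (mts0 (@fair_tr X Y) Σ x) (mts0 (@fair_tr X Y) T x))
    (μ' : forall x, bcell
       (bcomposite (fun h k (σ : fair_quiver h k) => G_trans (fair_tr σ)) Σ x)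
       (bcomposite (fun h k (σ : fair_quiver h k) => G_trans (fair_tr σ)) T x)) :
    Prop :=
  forall x,
    plug onil onil (ct_seq cY (mts0 (@fair_tr X Y) Σ x)) (μ' x)
    = plug onil onil (μ x) (ct_seq cY (mts0 (@fair_tr X Y) T x)).

End GTrans.

Definition bij_between (T T' : Type) (φ : T -> T') (P : T -> Prop)
    (Q : T' -> Prop) : Prop :=
  (forall t, P t -> Q (φ t)) /\
  (forall t', Q t' -> exists! t, P t /\ φ t = t').

Definition one_to_one (T T' : Type) (R : T -> T' -> Prop) (P : T -> Prop)
    (Q : T' -> Prop) : Prop :=
  (forall t, P t -> exists! t', Q t' /\ R t t') /\
  (forall t', Q t' -> exists! t, P t /\ R t t').

(* Main.v *)
From mathcomp Require Import all_boot.
From Stdlib Require Import ClassicalEpsilon FunctionalExtensionality Eqdep.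
From Stdlib Require Import Program.Equality.
Require Import Defs.

Set Implicit Arguments.
Unset Strict Implicit.
Unset Printing Implicit Defensive.

(**
The two structures have the same 0-cells and 1-cells, so the theorem is about
equations between 2-cells whose boundaries are sequences of 1-cells.  The merge
of two 2-cells is always a vertical composite of two whiskered ones, and
whiskering and vertical composition obey the laws of a strict 2-category whose
1-cells are sequences.  This calculus [strict] exists on ∫C ([int_strict], by
the pentagon: regrouping a left-bracketed composite is the transport along
associativity of concatenation) and on a representable merge-bicategory
([rep_strict]: whiskering is merging with a unit, and each law is an instance of
the associativity of merges).  Everything that both halves of the theorem share
is proved in it.

In the calculus a 2-cell is universal exactly when it is invertible
([universal2P]), and likewise when it is universal at its only output or only
input ([univ_outP], [univ_inP]); so tensors are invertible 2-cells.  A 1-cell e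
is universal exactly when it is an equivalence ([universal1P]), because
whiskering with an equivalence is a bijection on 2-cells, which gives the
factorisations required at the other port of (e,u) -> (a).

Fix a family σ.  The 2-cells at which σ is natural are closed under identities,
vertical composition, inverses and whiskering, and with the help of tensors each
2-cell is built from those with one input and one output.  So σ is oplax, in
the merge-bicategory sense, as soon as it is natural at 2-cells between single
1-cells and at tensors ([moplax_gen]); these are the naturality axiom and the
axiom on f_{a,b} of an oplax transformation of functors.  The remaining axiom
of the latter, on units, corresponds to fairness, through the invertibility of
the component of σ at unit 1-cells:
- it expresses these components as composites of invertible 2-cells;
- if they are invertible, then σ_e is invertible for each equivalence e, with
  inverse u, since naturality at (e,u) -> (1) and (u,e) -> (1) gives σ_e a
  section and a retraction ([oplax_equiv1]), and so σ is fair ([is_fairP]);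
- conversely, naturality at (1,1) -> (1) says that σ_1, compared with the two
  unitors of σ_x, is an idempotent; if invertible, it is an identity, which is
  the unit axiom ([oplax_unit]).

For ∫ the equations to compare reduce to those of the bicategory
([int_boplaxP]).  For G each operation is characterised by composing it with
invertible tensors, which turns every axiom into its counterpart and σ ↦ Gσ
into a bijection ([G_boplaxP], [G_transK], [G_transVK]).  The pseudo-natural
cases follow, as invertible means universal.  For modifications, the composite
of a sequence of transformations in the bicategory is, after composing with
iterated tensors, the pasting in the merge-bicategory ([int_mts1], [Gmts1]).
*)

(** * Paths *)

Section PathLemmas.
Variables (V : Type) (E : V -> V -> Type).

Definition ocat x y z (Γ1 : opath E x y) (Γ2 : opath E y z) : opath E x z :=
  match Γ2 in opath _ _ z return opath E x z with
  | onil => Γ1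
  | osome _ Γ2' => osome (cat_on Γ1 Γ2')
  end.

Lemma catA x y z w (Γ : npath E x y) (Δ : npath E y z) (Θ : npath E z w) :
  cat Γ (cat Δ Θ) = cat (cat Γ Δ) Θ.
Proof. by elim: Θ => [u a|u v Θ IH a] //=; rewrite IH. Qed.

Lemma nlen_gt0 x y (Γ : npath E x y) : 0 < nlen Γ.
Proof. by case: Γ. Qed.

Lemma nlen_cat x y z (Γ : npath E x y) (Δ : npath E y z) :
  nlen (cat Γ Δ) = nlen Γ + nlen Δ.
Proof. by elim: Δ => [u a|u v Δ IH a] /=; rewrite ?addn1 // IH addnS. Qed.

Lemma nlen_cat_on x y z (Γ : opath E x y) (Δ : npath E y z) :
  nlen (cat_on Γ Δ) = olen Γ + nlen Δ.
Proof. by case: _ / Γ Δ => [|u Γ] Δ //=; rewrite nlen_cat. Qed.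

Lemma nlen_cat_no x y z (Γ : npath E x y) (Δ : opath E y z) :
  nlen (cat_no Γ Δ) = nlen Γ + olen Δ.
Proof. by case: Δ => [|u Δ] //=; rewrite ?addn0 // nlen_cat. Qed.

Lemma ocat0 x y (Γ : opath E x y) : ocat onil Γ = Γ.
Proof. by case: Γ. Qed.

Lemma cat_on_ocat x y z w (Γ1 : opath E x y) (Γ2 : opath E y z)
    (Γ : npath E z w) : cat_on (ocat Γ1 Γ2) Γ = cat_on Γ1 (cat_on Γ2 Γ).
Proof.
case: _ / Γ2 Γ => [|u Γ2] Γ //=; case: _ / Γ1 Γ2 => [|v Γ1] Γ2 //=.
by rewrite catA.
Qed.

Lemma cat_no_ocat x y z w (Γ : npath E x y) (Γ1 : opath E y z)
    (Γ2 : opath E z w) : cat_no Γ (ocat Γ1 Γ2) = cat_no (cat_no Γ Γ1) Γ2.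
Proof.
case: Γ2 => [|u Γ2] //=; case: _ / Γ1 Γ2 => [|v Γ1] Γ2 //=.
by rewrite catA.
Qed.

Lemma cat_on_no x y z w (Γ1 : opath E x y) (Γ : npath E y z)
    (Γ2 : opath E z w) : cat_on Γ1 (cat_no Γ Γ2) = cat_no (cat_on Γ1 Γ) Γ2.
Proof.
case: Γ2 => [|u Γ2] //=; case: _ / Γ1 Γ => [|v Γ1] Γ //=.
by rewrite catA.
Qed.

Lemma olen_ocat x y z (Γ1 : opath E x y) (Γ2 : opath E y z) :
  olen (ocat Γ1 Γ2) = olen Γ1 + olen Γ2.
Proof. by case: Γ2 => [|u Γ2] /=; rewrite ?addn0 // nlen_cat_on. Qed.

Lemma cat_injr x y z (Γ Γ' : npath E x y) (Δ : npath E y z) :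
  cat Γ Δ = cat Γ' Δ -> Γ = Γ'.
Proof.
by elim: Δ => [u a|u v Δ IH a] /= H; [|apply: IH];
   injection H => H1; apply: inj_pair2 H1.
Qed.

Lemma cat_injl x y z (Γ : npath E x y) (Δ Δ' : npath E y z) :
  cat Γ Δ = cat Γ Δ' -> Δ = Δ'.
Proof.
elim: Δ Δ' => [u a|u v Δ IH a] Δ'.
  case: _ / Δ' a => [v b|v w Δ' b] a /= [].
    by move=> H; rewrite (inj_pair2 _ _ _ _ _ (inj_pair2 _ _ _ _ _ H)).
  move=> e; subst v => H _.
  have := f_equal (@nlen V E _ _) (inj_pair2 _ _ _ _ _ H).
  by move/esym/eqP; rewrite nlen_cat -[X in _ == X]addn0 eqn_add2l eqn0Ngt nlen_gt0.
case: _ / Δ' a => [w b|w t Δ' b] a /= [].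
  move=> e; subst u => H _.
  have := f_equal (@nlen V E _ _) (inj_pair2 _ _ _ _ _ H).
  by move/eqP; rewrite nlen_cat -[X in _ == X]addn0 eqn_add2l eqn0Ngt nlen_gt0.
move=> e; subst u => H1 H2.
by rewrite (IH _ (inj_pair2 _ _ _ _ _ H1))
  (inj_pair2 _ _ _ _ _ (inj_pair2 _ _ _ _ _ H2)).
Qed.

Lemma cat_on_inj x y z (Γ : opath E x y) (Δ Δ' : npath E y z) :
  cat_on Γ Δ = cat_on Γ Δ' -> Δ = Δ'.
Proof. by case: _ / Γ Δ Δ' => [|u Γ] Δ Δ' //=; apply: cat_injl. Qed.

Lemma cat_no_inj x y z (Δ : opath E y z) (Γ Γ' : npath E x y) :
  cat_no Γ Δ = cat_no Γ' Δ -> Γ = Γ'.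
Proof. by case: Δ => [|u Δ] //=; apply: cat_injr. Qed.

(** This and the next seven lemmas are case analyses of [lside] and [rside] when
    one of the two sequences has a known shape, as in the universal
    properties. *)
Lemma lside_nil_ind (u : V)
    (P : forall x x'' (Δ1 : opath E x u), lside x'' Δ1 (@onil V E u) -> Prop) :
  P u u onil (LG onil) -> (forall x (Δ1 : npath E x u), P x x _ (LD Δ1)) ->
  forall x x'' Δ1 l, P x x'' Δ1 l.
Proof. by move=> HG HD x x'' Δ1 l; dependent destruction l. Qed.

Lemma rside_nil_ind (v : V)
    (P : forall y y'' (Δ2 : opath E v y), rside y'' Δ2 (@onil V E v) -> Prop) :
  P v v onil (RG onil) -> (forall y (Δ2 : npath E v y), P y y _ (RD Δ2)) ->
  forall y y'' Δ2 r, P y y'' Δ2 r.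
Proof. by move=> HG HD y y'' Δ2 r; dependent destruction r. Qed.

Lemma lside_some_ind (u x' : V) (Γ1 : npath E x' u)
    (P : forall x x'' (Δ1 : opath E x u), lside x'' Δ1 (osome Γ1) -> Prop) :
  P u x' onil (LG (osome Γ1)) -> forall x x'' Δ1 l, P x x'' Δ1 l.
Proof. by move=> HG x x'' Δ1 l; dependent destruction l. Qed.

Lemma rside_some_ind (v y' : V) (Γ2 : npath E v y')
    (P : forall y y'' (Δ2 : opath E v y), rside y'' Δ2 (osome Γ2) -> Prop) :
  P v y' onil (RG (osome Γ2)) -> forall y y'' Δ2 r, P y y'' Δ2 r.
Proof. by move=> HG y y'' Δ2 r; dependent destruction r. Qed.

Lemma lside_outnil_ind (u : V)
    (P : forall x' x'' (Γ1 : opath E x' u), lside x'' (@onil V E u) Γ1 -> Prop) :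
  (forall x' (Γ1 : opath E x' u), P x' x' Γ1 (LG Γ1)) ->
  forall x' x'' Γ1 l, P x' x'' Γ1 l.
Proof. by move=> HG x' x'' Γ1 l; dependent destruction l. Qed.

Lemma rside_outnil_ind (v : V)
    (P : forall y' y'' (Γ2 : opath E v y'), rside y'' (@onil V E v) Γ2 -> Prop) :
  (forall y' (Γ2 : opath E v y'), P y' y' Γ2 (RG Γ2)) ->
  forall y' y'' Γ2 r, P y' y'' Γ2 r.
Proof. by move=> HG y' y'' Γ2 r; dependent destruction r. Qed.

Lemma lside_outsome_ind (u x : V) (Δ1 : npath E x u)
    (P : forall x' x'' (Γ1 : opath E x' u), lside x'' (osome Δ1) Γ1 -> Prop) :
  P u x onil (LD Δ1) -> forall x' x'' Γ1 l, P x' x'' Γ1 l.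
Proof. by move=> HD x' x'' Γ1 l; dependent destruction l. Qed.

Lemma rside_outsome_ind (v y : V) (Δ2 : npath E v y)
    (P : forall y' y'' (Γ2 : opath E v y'), rside y'' (osome Δ2) Γ2 -> Prop) :
  P v y onil (RD Δ2) -> forall y' y'' Γ2 r, P y' y'' Γ2 r.
Proof. by move=> HD y' y'' Γ2 r; dependent destruction r. Qed.

End PathLemmas.

Notation "⌊ a ⌋" := (osome (one a)) (format "⌊ a ⌋").

Section PathMap.
Variables (V V' : Type) (E : V -> V -> Type) (E' : V' -> V' -> Type).
Variables (h : V -> V') (k : forall x y, E x y -> E' (h x) (h y)).

Lemma npmap_cat x y z (Γ : npath E x y) (Δ : npath E y z) :
  npmap k (cat Γ Δ) = cat (npmap k Γ) (npmap k Δ).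
Proof. by elim: Δ => [u a|u v Δ IH a] //=; rewrite IH. Qed.

Lemma nlen_npmap x y (Γ : npath E x y) : nlen (npmap k Γ) = nlen Γ.
Proof. by elim: Γ => [u a|u v Γ IH a] //=; rewrite IH. Qed.

End PathMap.

(** * Two-cells as a strict calculus *)

Section Packed.
Variable X : mbicat_data.
Implicit Types x y z w : X.

(** Sequences are associative only up to a propositional equality, so that most
    laws of whiskering do not typecheck between 2-cells.  Between 2-cells packed
    with their boundaries they are plain equations.  [None] is the value of a
    composite of 2-cells with different intermediate boundaries; thanks to it
    the laws of [hcomp] and of whiskering need no side conditions. *)
Definition hcell x y : Type :=
  option {Γ : npath (@mhom X) x y & {Δ : npath (@mhom X) x y & mcell Γ Δ}}.

Definition pk x y (Γ Δ : npath (@mhom X) x y) (p : mcell Γ Δ) : hcell x y :=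
  Some (existT _ Γ (existT _ Δ p)).

Lemma pk_inj x y (Γ Δ : npath (@mhom X) x y) (p q : mcell Γ Δ) :
  pk p = pk q -> p = q.
Proof.
by move=> H; injection H => H1;
   exact: (inj_pair2 _ _ _ _ _ (inj_pair2 _ _ _ _ _ H1)).
Qed.

Definition hty x y (P : hcell x y) (Γ Δ : npath (@mhom X) x y) : Prop :=
  exists p : mcell Γ Δ, P = pk p.

Lemma hty_pk x y (Γ Δ : npath (@mhom X) x y) (p : mcell Γ Δ) :
  hty (pk p) Γ Δ.
Proof. by exists p. Qed.

Definition comp x y (Γ Δ Θ : npath (@mhom X) x y) (p : mcell Γ Δ)
  (q : mcell Δ Θ) : mcell Γ Θ := plug onil onil p q.

Definition hcomp x y (P Q : hcell x y) : hcell x y :=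
  match P, Q with
  | Some (existT Γ (existT Δ p)), Some (existT Δ' (existT Θ q)) =>
    match excluded_middle_informative (Δ' = Δ) with
    | left e => pk (comp p (eq_rect Δ' (fun Z => mcell Z Θ) q Δ e))
    | right _ => None
    end
  | _, _ => None
  end.

Lemma pk_comp x y (Γ Δ Θ : npath (@mhom X) x y) (p : mcell Γ Δ)
  (q : mcell Δ Θ) : pk (comp p q) = hcomp (pk p) (pk q).
Proof.
rewrite /hcomp /=; case: excluded_middle_informative => // e.
by rewrite -Eqdep.EqdepTheory.eq_rect_eq.
Qed.

Lemma hcomp_none x y (Γ Δ Γ' Δ' : npath (@mhom X) x y) (p : mcell Γ Δ)
  (q : mcell Γ' Δ') : Γ' <> Δ -> hcomp (pk p) (pk q) = None.
Proof. by move=> h; rewrite /hcomp /=; case: excluded_middle_informative. Qed.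

End Packed.

Arguments pk {X x y Γ Δ} p.
Arguments comp {X x y Γ Δ Θ} p q.
Arguments hcomp {X x y} P Q.

Declare Scope hcell_scope.
Delimit Scope hcell_scope with hcell.
Bind Scope hcell_scope with hcell.
Notation "P * Q" := (hcomp P Q) : hcell_scope.
Local Open Scope hcell_scope.

(** The 2-category whose 1-cells are non-empty sequences and whose vertical
    composition is [comp].  The letters of [mrg_GD] etc. name the constructors
    of [lside] and [rside], i.e. which sequences may be non-empty on the left and
    on the right of the merged part; the merge is in each case a composite of
    whiskered 2-cells. *)
Class strict (X : mbicat_data) := Strict {
  cid : forall (x y : X) (Γ : npath (@mhom X) x y), mcell Γ Γ;
  lw : forall (x y z : X) (Θ : opath (@mhom X) x y) (Γ Δ : npath (@mhom X) y z),
    mcell Γ Δ -> mcell (cat_on Θ Γ) (cat_on Θ Δ);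
  rw : forall (x y z : X) (Θ : opath (@mhom X) y z) (Γ Δ : npath (@mhom X) x y),
    mcell Γ Δ -> mcell (cat_no Γ Θ) (cat_no Δ Θ);
  comp1p : forall (x y : X) (Γ Δ : npath (@mhom X) x y) (p : mcell Γ Δ),
    comp (cid Γ) p = p;
  compp1 : forall (x y : X) (Γ Δ : npath (@mhom X) x y) (p : mcell Γ Δ),
    comp p (cid Δ) = p;
  compA : forall (x y : X) (Γ Δ Θ Λ : npath (@mhom X) x y) (p : mcell Γ Δ)
    (q : mcell Δ Θ) (r : mcell Θ Λ), comp p (comp q r) = comp (comp p q) r;
  lw_id : forall (x y z : X) (Θ : opath (@mhom X) x y) (Γ : npath (@mhom X) y z),
    lw Θ (cid Γ) = cid (cat_on Θ Γ);
  rw_id : forall (x y z : X) (Θ : opath (@mhom X) y z) (Γ : npath (@mhom X) x y),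
    rw Θ (cid Γ) = cid (cat_no Γ Θ);
  lw_comp : forall (x y z : X) (Θ : opath (@mhom X) x y)
    (Γ Δ Λ : npath (@mhom X) y z) (p : mcell Γ Δ) (q : mcell Δ Λ),
    lw Θ (comp p q) = comp (lw Θ p) (lw Θ q);
  rw_comp : forall (x y z : X) (Θ : opath (@mhom X) y z)
    (Γ Δ Λ : npath (@mhom X) x y) (p : mcell Γ Δ) (q : mcell Δ Λ),
    rw Θ (comp p q) = comp (rw Θ p) (rw Θ q);
  lw_onil : forall (x y : X) (Γ Δ : npath (@mhom X) x y) (p : mcell Γ Δ),
    lw onil p = p;
  rw_onil : forall (x y : X) (Γ Δ : npath (@mhom X) x y) (p : mcell Γ Δ),
    rw onil p = p;
  lw_ocat : forall (x y z w : X) (Θ : opath (@mhom X) x y)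
    (Θ' : opath (@mhom X) y z) (Γ Δ : npath (@mhom X) z w) (p : mcell Γ Δ),
    pk (lw (ocat Θ Θ') p) = pk (lw Θ (lw Θ' p));
  rw_ocat : forall (x y z w : X) (Θ : opath (@mhom X) y z)
    (Θ' : opath (@mhom X) z w) (Γ Δ : npath (@mhom X) x y) (p : mcell Γ Δ),
    pk (rw (ocat Θ Θ') p) = pk (rw Θ' (rw Θ p));
  lw_rw : forall (x y z w : X) (Θ : opath (@mhom X) x y)
    (Θ' : opath (@mhom X) z w) (Γ Δ : npath (@mhom X) y z) (p : mcell Γ Δ),
    pk (lw Θ (rw Θ' p)) = pk (rw Θ' (lw Θ p));
  exch : forall (x y z : X) (Γ Γ' : npath (@mhom X) x y)
    (Δ Δ' : npath (@mhom X) y z) (p : mcell Γ Γ') (q : mcell Δ Δ'),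
    comp (rw (osome Δ) p) (lw (osome Γ') q)
    = comp (lw (osome Γ) q) (rw (osome Δ') p);
  mrg_GG : forall (x u v y : X) (Γ1 : opath (@mhom X) x u)
    (Γ2 : opath (@mhom X) v y) (Γ Λ : npath (@mhom X) u v)
    (Δ : npath (@mhom X) x y) (t : mcell Γ Λ)
    (s : mcell (cat_on Γ1 (cat_no Λ Γ2)) Δ),
    mrg (Glue (LG Γ1) (RG Γ2) Γ Λ Δ) t s = comp (lw Γ1 (rw Γ2 t)) s;
  mrg_GD : forall (x u v y : X) (Γ1 : opath (@mhom X) x u)
    (Δ2 : npath (@mhom X) v y) (Γ : npath (@mhom X) u y)
    (Λ : npath (@mhom X) u v) (Δ : npath (@mhom X) x v)
    (t : mcell Γ (cat Λ Δ2)) (s : mcell (cat_on Γ1 Λ) Δ),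
    pk (mrg (Glue (LG Γ1) (RD Δ2) Γ Λ Δ) t s)
    = pk (lw Γ1 t) * pk (rw (osome Δ2) s);
  mrg_DG : forall (x u v y : X) (Δ1 : npath (@mhom X) x u)
    (Γ2 : opath (@mhom X) v y) (Γ : npath (@mhom X) x v)
    (Λ : npath (@mhom X) u v) (Δ : npath (@mhom X) u y)
    (t : mcell Γ (cat Δ1 Λ)) (s : mcell (cat_no Λ Γ2) Δ),
    pk (mrg (Glue (LD Δ1) (RG Γ2) Γ Λ Δ) t s)
    = pk (rw Γ2 t) * pk (lw (osome Δ1) s);
  mrg_DD : forall (x u v y : X) (Δ1 : npath (@mhom X) x u)
    (Δ2 : npath (@mhom X) v y) (Γ : npath (@mhom X) x y)
    (Λ : npath (@mhom X) u v) (Δ : npath (@mhom X) u v)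
    (t : mcell Γ (cat Δ1 (cat Λ Δ2))) (s : mcell Λ Δ),
    mrg (Glue (LD Δ1) (RD Δ2) Γ Λ Δ) t s
    = comp t (lw (osome Δ1) (rw (osome Δ2) s)) }.

Section Calculus.
Context {X : mbicat_data} {S : strict X}.
Implicit Types x y z w : X.

Definition hlw x y z (Θ : opath mhom x y) (P : hcell y z) : hcell x z :=
  match P with
  | Some (existT Γ (existT Δ p)) => pk (lw Θ p)
  | None => None
  end.

Definition hrw x y z (P : hcell x y) (Θ : opath mhom y z) : hcell x z :=
  match P with
  | Some (existT Γ (existT Δ p)) => pk (rw Θ p)
  | None => None
  end.

Local Notation "Θ ▷ P" := (hlw Θ P) (at level 37, right associativity).
Local Notation "P ◁ Θ" := (hrw P Θ) (at level 38, left associativity).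

Lemma pk_lw x y z (Θ : opath mhom x y) (Γ Δ : npath mhom y z)
  (p : mcell Γ Δ) : pk (lw Θ p) = Θ ▷ pk p.
Proof. by []. Qed.

Lemma pk_rw x y z (Θ : opath mhom y z) (Γ Δ : npath mhom x y)
  (p : mcell Γ Δ) : pk (rw Θ p) = pk p ◁ Θ.
Proof. by []. Qed.

Lemma hcompA x y (P Q R : hcell x y) : P * (Q * R) = P * Q * R.
Proof.
case: P => [[Γ [Δ p]]|] //; case: Q => [[Γ' [Δ' q]]|] //.
case: R => [[Γ'' [Δ'' r]]|]; last by rewrite /=; case: excluded_middle_informative.
rewrite -!/(pk _).
case: (excluded_middle_informative (Γ' = Δ)) => [e|ne]; last first.
  rewrite (hcomp_none p q ne) /=; case: excluded_middle_informative => //= e.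
  by case: excluded_middle_informative.
subst Γ'; case: (excluded_middle_informative (Γ'' = Δ')) => [e|ne].
  by subst Γ''; rewrite -!pk_comp compA.
by rewrite -pk_comp !hcomp_none.
Qed.

(** Holds for non-composable P and Q because concatenation is injective: both
    sides are then [None]. *)
Lemma hlw_comp x y z (Θ : opath mhom x y) (P Q : hcell y z) :
  Θ ▷ (P * Q) = Θ ▷ P * Θ ▷ Q.
Proof.
case: P => [[Γ [Δ p]]|] //; case: Q => [[Γ' [Δ' q]]|] //.
rewrite -!/(pk _).
case: (excluded_middle_informative (Γ' = Δ)) => [e|ne].
  by subst Γ'; rewrite -!pk_comp /hlw /= lw_comp pk_comp.
rewrite hcomp_none // (hcomp_none (lw Θ p) (lw Θ q)) //.
by move=> e; apply: ne; exact: cat_on_inj e.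
Qed.

Lemma hrw_comp x y z (Θ : opath mhom y z) (P Q : hcell x y) :
  (P * Q) ◁ Θ = P ◁ Θ * Q ◁ Θ.
Proof.
case: P => [[Γ [Δ p]]|] //; case: Q => [[Γ' [Δ' q]]|] //.
rewrite -!/(pk _).
case: (excluded_middle_informative (Γ' = Δ)) => [e|ne].
  by subst Γ'; rewrite -!pk_comp /hrw /= rw_comp pk_comp.
rewrite hcomp_none // (hcomp_none (rw Θ p) (rw Θ q)) //.
by move=> e; apply: ne; exact: cat_no_inj e.
Qed.

Lemma hlw_onil x y (P : hcell x y) : onil ▷ P = P.
Proof. by case: P => [[Γ [Δ p]]|] //=; rewrite lw_onil. Qed.

Lemma hrw_onil x y (P : hcell x y) : P ◁ onil = P.
Proof. by case: P => [[Γ [Δ p]]|] //=; rewrite rw_onil. Qed.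

Lemma hlw_ocat x y z w (Θ : opath mhom x y) (Θ' : opath mhom y z)
  (P : hcell z w) : ocat Θ Θ' ▷ P = Θ ▷ Θ' ▷ P.
Proof. by case: P => [[Γ [Δ p]]|] //=; rewrite lw_ocat. Qed.

Lemma hrw_ocat x y z w (Θ : opath mhom y z) (Θ' : opath mhom z w)
  (P : hcell x y) : P ◁ ocat Θ Θ' = P ◁ Θ ◁ Θ'.
Proof. by case: P => [[Γ [Δ p]]|] //=; rewrite rw_ocat. Qed.

Lemma hlw_hrw x y z w (Θ : opath mhom x y) (Θ' : opath mhom z w)
  (P : hcell y z) : Θ ▷ (P ◁ Θ') = Θ ▷ P ◁ Θ'.
Proof. by case: P => [[Γ [Δ p]]|] //=; rewrite lw_rw. Qed.

Lemma hty_comp x y (P Q : hcell x y) Γ Δ Θ :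
  hty P Γ Δ -> hty Q Δ Θ -> hty (P * Q) Γ Θ.
Proof. by move=> [p ->] [q ->]; exists (comp p q); rewrite pk_comp. Qed.

Lemma hty_lw x y z (Θ : opath mhom x y) (P : hcell y z) Γ Δ :
  hty P Γ Δ -> hty (Θ ▷ P) (cat_on Θ Γ) (cat_on Θ Δ).
Proof. by move=> [p ->]; exists (lw Θ p). Qed.

Lemma hty_rw x y z (Θ : opath mhom y z) (P : hcell x y) Γ Δ :
  hty P Γ Δ -> hty (P ◁ Θ) (cat_no Γ Θ) (cat_no Δ Θ).
Proof. by move=> [p ->]; exists (rw Θ p). Qed.

Definition hid x y (Γ : npath mhom x y) : hcell x y := pk (cid Γ).

Lemma hty_id x y (Γ : npath mhom x y) : hty (hid Γ) Γ Γ.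
Proof. exact: hty_pk. Qed.

Lemma hid_comp x y (P : hcell x y) Γ Δ : hty P Γ Δ -> hid Γ * P = P.
Proof. by move=> [p ->]; rewrite -pk_comp comp1p. Qed.

Lemma hcomp_id x y (P : hcell x y) Γ Δ : hty P Γ Δ -> P * hid Δ = P.
Proof. by move=> [p ->]; rewrite -pk_comp compp1. Qed.

Lemma hlw_id x y z (Θ : opath mhom x y) (Γ : npath mhom y z) :
  Θ ▷ hid Γ = hid (cat_on Θ Γ).
Proof. by rewrite /hlw /= lw_id. Qed.

Lemma hrw_id x y z (Θ : opath mhom y z) (Γ : npath mhom x y) :
  hid Γ ◁ Θ = hid (cat_no Γ Θ).
Proof. by rewrite /hrw /= rw_id. Qed.

Lemma hexch x y z (P : hcell x y) (Q : hcell y z) Γ Γ' Δ Δ' :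
  hty P Γ Γ' -> hty Q Δ Δ' ->
  P ◁ osome Δ * osome Γ' ▷ Q = osome Γ ▷ Q * P ◁ osome Δ'.
Proof. by move=> [p ->] [q ->]; rewrite -!pk_lw -!pk_rw -!pk_comp exch. Qed.

Lemma pk_plug x u v y (Γ1 : opath mhom x u)
    (Γ2 : opath mhom v y) (Γ Λ : npath mhom u v)
    (Δ : npath mhom x y) (t : mcell Γ Λ)
    (s : mcell (cat_on Γ1 (cat_no Λ Γ2)) Δ) :
  pk (plug Γ1 Γ2 t s) = Γ1 ▷ (pk t ◁ Γ2) * pk s.
Proof. by rewrite /plug mrg_GG pk_comp pk_lw pk_rw. Qed.

End Calculus.

Notation "Θ ▷ P" := (hlw Θ P) (at level 37, right associativity) : hcell_scope.
Notation "P ◁ Θ" := (hrw P Θ) (at level 38, left associativity) : hcell_scope.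


(* The boundaries of a composite are computed from those of its factors, which
   are left to be matched by conversion with the expected ones. *)
Ltac hty_of P :=
  match goal with
  | H : hty P _ _ |- _ => H
  | _ => lazymatch P with
    | pk ?p => constr:(hty_pk p)
    | hid ?G => constr:(hty_id G)
    | ?Q * ?R =>
      let a := hty_of Q in let b := hty_of R in constr:(hty_comp a b)
    | ?T ▷ ?Q => let a := hty_of Q in constr:(hty_lw T a)
    | ?Q ◁ ?T => let a := hty_of Q in constr:(hty_rw T a)
    end
  end.
Ltac hty := lazymatch goal with |- hty ?P _ _ => let a := hty_of P in exact a end.

(** * Invertible 2-cells *)

Section Iso.
Context {X : mbicat_data} {S : strict X}.
Implicit Types x y z w : X.

Lemma hty_cast x y (P : hcell x y) Γ Δ Γ' Δ' :
  hty P Γ Δ -> Γ = Γ' -> Δ = Δ' -> hty P Γ' Δ'.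
Proof. by move=> ? <- <-. Qed.

Definition iso2 x y (Γ Δ : npath (@mhom X) x y) (p : mcell Γ Δ) : Prop :=
  exists q : mcell Δ Γ, comp p q = cid Γ /\ comp q p = cid Δ.

Definition hinv x y (P Q : hcell x y) Γ Δ : Prop :=
  [/\ hty P Γ Δ, hty Q Δ Γ, P * Q = hid Γ & Q * P = hid Δ].
Definition hiso x y (P : hcell x y) Γ Δ : Prop := exists Q, hinv P Q Γ Δ.

Lemma hisoP x y (Γ Δ : npath (@mhom X) x y) (p : mcell Γ Δ) :
  iso2 p <-> hiso (pk p) Γ Δ.
Proof.
split=> [[q [pq qp]]|[Q [_ [q ->] pq qp]]].
  by exists (pk q); split; rewrite -?pk_comp ?pq ?qp; first [hty | done].
by exists q; split; apply: pk_inj; rewrite pk_comp.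
Qed.

Lemma hiso_hty x y (P : hcell x y) Γ Δ : hiso P Γ Δ -> hty P Γ Δ.
Proof. by case=> Q []. Qed.

Lemma hinv_sym x y (P Q : hcell x y) Γ Δ : hinv P Q Γ Δ -> hinv Q P Δ Γ.
Proof. by case. Qed.

Lemma hiso_inv x y (P Q : hcell x y) Γ Δ : hinv P Q Γ Δ -> hiso Q Δ Γ.
Proof. by move/hinv_sym; exists P. Qed.

Lemma hiso_id x y (Γ : npath (@mhom X) x y) : hiso (hid Γ) Γ Γ.
Proof.
by exists (hid Γ); split; try hty; rewrite (hid_comp (hty_id Γ)).
Qed.

Lemma hinv_lw x y z (Θ : opath mhom x y) (P Q : hcell y z) Γ Δ :
  hinv P Q Γ Δ -> hinv (Θ ▷ P) (Θ ▷ Q) (cat_on Θ Γ) (cat_on Θ Δ).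
Proof.
by move=> [tP tQ PQ QP]; split; try hty; rewrite -hlw_comp ?PQ ?QP hlw_id.
Qed.

Lemma hinv_rw x y z (Θ : opath mhom y z) (P Q : hcell x y) Γ Δ :
  hinv P Q Γ Δ -> hinv (P ◁ Θ) (Q ◁ Θ) (cat_no Γ Θ) (cat_no Δ Θ).
Proof.
by move=> [tP tQ PQ QP]; split; try hty; rewrite -hrw_comp ?PQ ?QP hrw_id.
Qed.

Lemma hiso_lw x y z (Θ : opath mhom x y) (P : hcell y z) Γ Δ :
  hiso P Γ Δ -> hiso (Θ ▷ P) (cat_on Θ Γ) (cat_on Θ Δ).
Proof. by case=> Q /(hinv_lw Θ); exists (Θ ▷ Q). Qed.

Lemma hiso_rw x y z (Θ : opath mhom y z) (P : hcell x y) Γ Δ :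
  hiso P Γ Δ -> hiso (P ◁ Θ) (cat_no Γ Θ) (cat_no Δ Θ).
Proof. by case=> Q /(hinv_rw Θ); exists (Q ◁ Θ). Qed.

Lemma hinvK x y (P Q R : hcell x y) Γ Δ Θ :
  hinv P Q Γ Δ -> hty R Γ Θ -> P * (Q * R) = R.
Proof. by case=> _ _ PQ _ tR; rewrite hcompA PQ (hid_comp tR). Qed.

Lemma hinvKr x y (P Q R : hcell x y) Γ Δ Θ :
  hinv P Q Γ Δ -> hty R Θ Γ -> R * P * Q = R.
Proof. by case=> _ _ PQ _ tR; rewrite -hcompA PQ (hcomp_id tR). Qed.

Lemma hcancell x y (P R R' : hcell x y) Γ Δ Θ Θ' :
  hiso P Γ Δ -> hty R Δ Θ -> hty R' Δ Θ' -> P * R = P * R' -> R = R'.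
Proof.
move=> [Q /hinv_sym PQ] tR tR' e.
by rewrite -(hinvK PQ tR) e (hinvK PQ tR').
Qed.

Lemma hcancelr x y (P R R' : hcell x y) Γ Δ Θ Θ' :
  hiso P Γ Δ -> hty R Θ Γ -> hty R' Θ' Γ -> R * P = R' * P -> R = R'.
Proof.
move=> [Q PQ] tR tR' e.
by rewrite -(hinvKr PQ tR) e (hinvKr PQ tR').
Qed.

Lemma hinv_comp x y (P P' Q Q' : hcell x y) Γ Δ Θ :
  hinv P P' Γ Δ -> hinv Q Q' Δ Θ -> hinv (P * Q) (Q' * P') Γ Θ.
Proof.
move=> PP QQ; have [tP tP' e1 e2] := PP; have [tQ tQ' e3 e4] := QQ.
split; try hty.
  by rewrite -hcompA (hinvK QQ tP').
by rewrite -hcompA (hinvK (hinv_sym PP) tQ).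
Qed.

Lemma hiso_comp x y (P Q : hcell x y) Γ Δ Θ :
  hiso P Γ Δ -> hiso Q Δ Θ -> hiso (P * Q) Γ Θ.
Proof. by move=> [P' PP] [Q' QQ]; exists (Q' * P'); apply: hinv_comp PP QQ. Qed.

Lemma hiso_compl x y (P Q : hcell x y) Γ Δ Θ :
  hiso P Γ Δ -> hty Q Δ Θ -> hiso (P * Q) Γ Θ -> hiso Q Δ Θ.
Proof.
move=> [P' PP] tQ H.
rewrite -(hinvK (hinv_sym PP) tQ); apply: hiso_comp H; exact: hiso_inv PP.
Qed.

Lemma hiso_compr x y (P Q : hcell x y) Γ Δ Θ :
  hiso Q Δ Θ -> hty P Γ Δ -> hiso (P * Q) Γ Θ -> hiso P Γ Δ.
Proof.
move=> [Q' QQ] tP H.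
rewrite -(hinvKr QQ tP); apply: hiso_comp H _; exact: hiso_inv QQ.
Qed.

End Iso.

(** * Universality is invertibility *)

Section Universal.
Context {X : mbicat_data} {S : strict X}.
Implicit Types x y z u v w : X.

(** The factorisation is the composite with the whiskered inverse. *)
Lemma iso2_plug u v (Γ Δ : npath (@mhom X) u v) (t : mcell Γ Δ) : iso2 t ->
  forall x y (Γ1 : opath mhom x u) (Γ2 : opath mhom v y)
    (Δ' : npath mhom x y) (s : mcell (cat_on Γ1 (cat_no Γ Γ2)) Δ'),
  exists! q : mcell (cat_on Γ1 (cat_no Δ Γ2)) Δ', plug Γ1 Γ2 t q = s.
Proof.
move=> /hisoP [Q tQ] x y Γ1 Γ2 Δ' s.
have {}tQ := hinv_lw Γ1 (hinv_rw Γ2 tQ); have [_ tQ' _ _] := tQ.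
have [q qE] : hty (Γ1 ▷ (Q ◁ Γ2) * pk s) (cat_on Γ1 (cat_no Δ Γ2)) Δ' by hty.
exists q; split=> [|q' e]; apply: pk_inj; last subst s.
  by rewrite pk_plug -qE (hinvK tQ (hty_pk s)).
by rewrite -qE pk_plug (hinvK (hinv_sym tQ) (hty_pk q')).
Qed.

Lemma iso2_coplug u v (Γ Δ : npath (@mhom X) u v) (t : mcell Γ Δ) : iso2 t ->
  forall x x'' (Δ1 : opath mhom x u) (l : lside x'' Δ1 onil)
    y y'' (Δ2 : opath mhom v y) (r : rside y'' Δ2 onil)
    (Γ' : npath mhom x y) (s : mcell (lin l (rin r Γ')) (lout l (rout r Δ))),
  exists! q : mcell Γ' (cat_on Δ1 (cat_no Γ Δ2)),
    mrg (Glue l r Γ' Γ Δ) q t = s.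
Proof.
move=> /hisoP [Q tQ] x x'' Δ1 l y y'' Δ2 r Γ' s.
have {}tQ := hinv_lw Δ1 (hinv_rw Δ2 tQ); have [_ tQ' _ _] := tQ.
have [E [tE mE]] : exists E : hcell x y, hty E Γ' (cat_on Δ1 (cat_no Δ Δ2)) /\
    forall q, mrg (Glue l r Γ' Γ Δ) q t = s <-> pk q * Δ1 ▷ (pk t ◁ Δ2) = E; last first.
  have [q qE] : hty (E * Δ1 ▷ (Q ◁ Δ2)) Γ' (cat_on Δ1 (cat_no Γ Δ2)) by hty.
  exists q; split=> [|q' /mE q'E].
    by apply/mE; rewrite -qE (hinvKr (hinv_sym tQ) tE).
  by apply: pk_inj; rewrite -qE -q'E (hinvKr tQ (hty_pk q')).
clear Q tQ tQ'.
elim/lside_nil_ind: x x'' Δ1 / l Γ' s => [|x Δ1];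
  elim/rside_nil_ind: y y'' Δ2 / r => [|y Δ2] Γ' s; exists (pk s);
  (split; first exact: hty_pk); move=> q;
  (split=> [<-|e]; [|apply: pk_inj; rewrite -e]).
- by rewrite mrg_GG pk_comp pk_lw pk_rw !hlw_onil !hrw_onil.
- by rewrite mrg_GG pk_comp pk_lw pk_rw !hlw_onil !hrw_onil.
- by rewrite mrg_GD pk_lw pk_rw !hlw_onil.
- by rewrite mrg_GD pk_lw pk_rw !hlw_onil.
- by rewrite mrg_DG pk_lw pk_rw !hrw_onil.
- by rewrite mrg_DG pk_lw pk_rw !hrw_onil.
- by rewrite mrg_DD pk_comp (pk_lw (osome Δ1) (rw (osome Δ2) t)) pk_rw.
- by rewrite mrg_DD pk_comp (pk_lw (osome Δ1) (rw (osome Δ2) t)) pk_rw.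
Qed.

(** The factorisation q of the identity through t is a right inverse, and t
    factors through itself both by the identity and by the composite of q
    and t. *)
Lemma iso2_of_out u v (Γ Δ : npath (@mhom X) u v) (t : mcell Γ Δ) :
  (forall (Θ : npath mhom u v) (s : mcell Γ Θ), exists! q, comp t q = s) ->
  iso2 t.
Proof.
move=> H; have [q [tq _]] := H _ (cid Γ); exists q; split=> //.
have [r [_ U]] := H _ t; rewrite -(U (comp q t)) ?(U (cid Δ)) ?compp1 //.
by rewrite compA tq comp1p.
Qed.

Lemma iso2_of_in u v (Γ Δ : npath (@mhom X) u v) (t : mcell Γ Δ) :
  (forall (Θ : npath mhom u v) (s : mcell Θ Δ), exists! q, comp q t = s) ->
  iso2 t.
Proof.
move=> H; have [q [tq _]] := H _ (cid Δ); exists q; split=> //.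
have [r [_ U]] := H _ t; rewrite -(U (comp t q)) ?(U (cid Γ)) ?comp1p //.
by rewrite -compA tq compp1.
Qed.

Lemma universal2P u v (Γ Δ : npath (@mhom X) u v) (t : mcell Γ Δ) :
  universal2 t <-> iso2 t.
Proof.
split=> [[H _]|h]; last by split; [exact: iso2_plug | exact: iso2_coplug].
by apply: iso2_of_out => Θ s; exact: (H _ _ onil onil Θ s).
Qed.

Lemma univ_outP x y (Γ : npath (@mhom X) x y) c (t : mcell Γ (one c)) :
  @univ_out X x x y y onil c onil Γ t <-> iso2 t.
Proof.
split=> [H|h].
  by apply: iso2_of_out => Θ s; exact: (H _ _ onil (LG onil) _ _ onil (RG onil)).
move=> x' x'' Γ1 l y' y'' Γ2 r Δ s.
elim/lside_outnil_ind: x' x'' Γ1 / l Δ s => x' Γ1.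
by elim/rside_outnil_ind: y' y'' Γ2 / r => y' Γ2 Δ s; exact: (iso2_plug h).
Qed.

Lemma univ_inP x y (Δ : npath (@mhom X) x y) c (t : mcell (one c) Δ) :
  @univ_in X x x y y onil c onil Δ t <-> iso2 t.
Proof.
split=> [H|h]; last by move=> *; exact: (iso2_coplug h).
by apply: iso2_of_in => Θ s; exact: (H _ _ onil (LG onil) _ _ onil (RG onil)).
Qed.

End Universal.

(** * Units, equivalences and universal 1-cells *)

Section Units.
Context {X : mbicat_data} {S : strict X}.
Implicit Types x y z u v w : X.

Section Unitors.
Variables (i : forall x, @mhom X x x).
Variables (l : forall x y (a : @mhom X x y), mcell (snoc (one (i x)) a) (one a)).
Variables (r : forall x y (a : @mhom X x y), mcell (snoc (one a) (i y)) (one a)).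

Fixpoint lunit_seq x y (Γ : npath mhom x y) : mcell (cat (one (i x)) Γ) Γ :=
  match Γ in npath _ _ y return mcell (cat (one (i x)) Γ) Γ with
  | one _ a => l a
  | snoc _ _ Γ' a => rw ⌊a⌋ (lunit_seq Γ')
  end.

Definition runit_seq x y (Γ : npath mhom x y) : mcell (snoc Γ (i y)) Γ :=
  match Γ in npath _ _ y return mcell (snoc Γ (i y)) Γ with
  | one _ a => r a
  | snoc _ _ Γ' a => lw (osome Γ') (r a)
  end.
End Unitors.

(** Tensor units with coherent unitors.  Naturality is with respect to all
    2-cells between sequences. *)
Record units := Units {
  uob : forall x, @mhom X x x;
  ul : forall x y (a : @mhom X x y), mcell (snoc (one (uob x)) a) (one a);
  ur : forall x y (a : @mhom X x y), mcell (snoc (one a) (uob y)) (one a);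
  ul_iso : forall x y (a : @mhom X x y), iso2 (ul a);
  ur_iso : forall x y (a : @mhom X x y), iso2 (ur a);
  ul_nat : forall x y (Γ Δ : npath (@mhom X) x y) (p : mcell Γ Δ),
    comp (lw ⌊uob x⌋ p) (lunit_seq ul Δ) = comp (lunit_seq ul Γ) p;
  ur_nat : forall x y (Γ Δ : npath (@mhom X) x y) (p : mcell Γ Δ),
    comp (rw ⌊uob y⌋ p) (runit_seq ur Δ) = comp (runit_seq ur Γ) p;
  ulr : forall x y z (a : @mhom X x y) (b : @mhom X y z),
    rw ⌊b⌋ (ur a) = lw ⌊a⌋ (ul b) }.

(** Tensors as invertible 2-cells, in accordance with [univ_outP]: composing with
    them replaces each 2-cell with one that has a single input and a single
    output. *)
Record tensors := Tensors {
  tob : forall x y z, @mhom X x y -> @mhom X y z -> @mhom X x z;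
  tn : forall x y z (a : @mhom X x y) (b : @mhom X y z),
    mcell (snoc (one a) b) (one (tob a b));
  tn_iso : forall x y z (a : @mhom X x y) (b : @mhom X y z), iso2 (tn a b) }.

Definition lfaithful x y (e : @mhom X x y) : Prop :=
  forall z (Γ Δ : npath mhom y z) (p q : mcell Γ Δ),
  ⌊e⌋ ▷ pk p = ⌊e⌋ ▷ pk q -> p = q.
Definition lfull x y (e : @mhom X x y) : Prop :=
  forall z (Γ Δ : npath mhom y z) P,
  hty P (cat (one e) Γ) (cat (one e) Δ) ->
  exists p : mcell Γ Δ, ⌊e⌋ ▷ pk p = P.
Definition rfaithful x y (e : @mhom X x y) : Prop :=
  forall z (Γ Δ : npath mhom z x) (p q : mcell Γ Δ),
  pk p ◁ ⌊e⌋ = pk q ◁ ⌊e⌋ -> p = q.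
Definition rfull x y (e : @mhom X x y) : Prop :=
  forall z (Γ Δ : npath mhom z x) P,
  hty P (snoc Γ e) (snoc Δ e) ->
  exists p : mcell Γ Δ, pk p ◁ ⌊e⌋ = P.

Section FullyFaithful.
Variables (x y : X) (e : @mhom X x y).

(** A 2-cell of the form (e,Γ) -> (e,v,Δ2) is e whiskered with a unique 2-cell;
    composing P with the inverse of t brings it to this form.  The next three
    lemmas are its images under the two reversals. *)
Lemma fact_in2 z (v : @mhom X y z) (a : mhom x z)
    (t : mcell (snoc (one e) v) (one a)) :
  iso2 t -> lfaithful e -> lfull e ->
  forall z' (Δ2 : opath mhom z z') (Γ : npath mhom y z') P,
  hty P (cat (one e) Γ) (cat_no (one a) Δ2) ->
  exists! q : mcell Γ (cat_no (one v) Δ2), ⌊e⌋ ▷ pk q * pk t ◁ Δ2 = P.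
Proof.
move=> /hisoP [Q tQ] Fa Fu z' Δ2 Γ P tP.
have {}tQ := hinv_rw Δ2 tQ; have [_ tQ' _ _] := tQ.
have E := cat_on_no ⌊e⌋ (one v) Δ2.
have [q qE] : exists q : mcell Γ (cat_no (one v) Δ2), ⌊e⌋ ▷ pk q = P * (Q ◁ Δ2).
  by apply: Fu; apply: hty_cast (hty_comp tP tQ') _ _; rewrite ?E.
exists q; split=> [|q' q'E]; first by rewrite qE (hinvKr (hinv_sym tQ) tP).
apply: Fa; rewrite qE -q'E; apply: (hinvKr (Θ := cat (one e) Γ) tQ).
by apply: hty_cast (hty_lw ⌊e⌋ (hty_pk q')) _ _; rewrite ?E.
Qed.

Lemma fact_out2 z (v : @mhom X y z) (a : mhom x z)
    (t : mcell (one a) (snoc (one e) v)) :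
  iso2 t -> lfaithful e -> lfull e ->
  forall z' (Γ2 : opath mhom z z') (Δ : npath mhom y z') P,
  hty P (cat_no (one a) Γ2) (cat (one e) Δ) ->
  exists! q : mcell (cat_no (one v) Γ2) Δ, pk t ◁ Γ2 * ⌊e⌋ ▷ pk q = P.
Proof.
move=> /hisoP [Q tQ] Fa Fu z' Γ2 Δ P tP.
have {}tQ := hinv_rw Γ2 tQ; have [_ tQ' _ _] := tQ.
have E := cat_on_no ⌊e⌋ (one v) Γ2.
have [q qE] : exists q : mcell (cat_no (one v) Γ2) Δ, ⌊e⌋ ▷ pk q = Q ◁ Γ2 * P.
  by apply: Fu; apply: hty_cast (hty_comp tQ' tP) _ _; rewrite ?E.
exists q; split=> [|q' q'E]; first by rewrite qE (hinvK tQ tP).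
apply: Fa; rewrite qE -q'E; apply: (hinvK (Θ := cat (one e) Δ) (hinv_sym tQ)).
by apply: hty_cast (hty_lw ⌊e⌋ (hty_pk q')) _ _; rewrite ?E.
Qed.

Lemma fact_in1 z (v : @mhom X z x) (a : mhom z y)
    (t : mcell (snoc (one v) e) (one a)) :
  iso2 t -> rfaithful e -> rfull e ->
  forall z' (Δ1 : opath mhom z' z) (Γ : npath mhom z' x) P,
  hty P (snoc Γ e) (cat_on Δ1 (one a)) ->
  exists! q : mcell Γ (cat_on Δ1 (one v)), pk q ◁ ⌊e⌋ * Δ1 ▷ pk t = P.
Proof.
move=> /hisoP [Q tQ] Fa Fu z' Δ1 Γ P tP.
have {}tQ := hinv_lw Δ1 tQ; have [_ tQ' _ _] := tQ.
have E := cat_on_no Δ1 (one v) ⌊e⌋.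
have [q qE] : exists q : mcell Γ (cat_on Δ1 (one v)), pk q ◁ ⌊e⌋ = P * (Δ1 ▷ Q).
  by apply: Fu; apply: hty_cast (hty_comp tP tQ') _ _; rewrite ?E.
exists q; split=> [|q' q'E]; first by rewrite qE (hinvKr (hinv_sym tQ) tP).
apply: Fa; rewrite qE -q'E; apply: (hinvKr (Θ := snoc Γ e) tQ).
by apply: hty_cast (hty_rw ⌊e⌋ (hty_pk q')) _ _; rewrite ?E.
Qed.

Lemma fact_out1 z (v : @mhom X z x) (a : mhom z y)
    (t : mcell (one a) (snoc (one v) e)) :
  iso2 t -> rfaithful e -> rfull e ->
  forall z' (Γ1 : opath mhom z' z) (Δ : npath mhom z' x) P,
  hty P (cat_on Γ1 (one a)) (snoc Δ e) ->
  exists! q : mcell (cat_on Γ1 (one v)) Δ, Γ1 ▷ pk t * pk q ◁ ⌊e⌋ = P.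
Proof.
move=> /hisoP [Q tQ] Fa Fu z' Γ1 Δ P tP.
have {}tQ := hinv_lw Γ1 tQ; have [_ tQ' _ _] := tQ.
have E := cat_on_no Γ1 (one v) ⌊e⌋.
have [q qE] : exists q : mcell (cat_on Γ1 (one v)) Δ, pk q ◁ ⌊e⌋ = Γ1 ▷ Q * P.
  by apply: Fu; apply: hty_cast (hty_comp tQ' tP) _ _; rewrite ?E.
exists q; split=> [|q' q'E]; first by rewrite qE (hinvK tQ tP).
apply: Fa; rewrite qE -q'E; apply: (hinvK (Θ := snoc Δ e) (hinv_sym tQ)).
by apply: hty_cast (hty_rw ⌊e⌋ (hty_pk q')) _ _; rewrite ?E.
Qed.

Lemma ex_unique_iff (T : Type) (P Q : T -> Prop) :
  (forall t, Q t <-> P t) -> (exists! t, P t) -> exists! t, Q t.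
Proof.
by move=> PQ [t [/PQ Qt U]]; exists t; split=> // t' /PQ; exact: U.
Qed.

Lemma iso_in2 z (v : @mhom X y z) (a : mhom x z)
    (t : mcell (snoc (one e) v) (one a)) :
  iso2 t -> lfaithful e -> lfull e -> in2 t.
Proof.
move=> ht Fa Fu x0 x'' Δ1 l z0 z'' Δ2 r Γ s.
elim/lside_some_ind: x0 x'' Δ1 / l Γ s.
elim/rside_nil_ind: z0 z'' Δ2 / r => [|z0 Δ2] Γ s.
  apply: ex_unique_iff (fact_in2 (Δ2 := onil) ht Fa Fu (hty_pk s)) => q.
  split=> [<-|E]; first by rewrite mrg_GG pk_comp pk_lw pk_rw !hrw_onil.
  by apply: pk_inj; rewrite mrg_GG pk_comp pk_lw pk_rw -E !hrw_onil.
apply: ex_unique_iff (fact_in2 (Δ2 := osome Δ2) ht Fa Fu (hty_pk s)) => q.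
split=> [<-|E]; first by rewrite mrg_GD.
by apply: pk_inj; rewrite mrg_GD pk_lw pk_rw -E.
Qed.

Lemma iso_co_out2 z (v : @mhom X y z) (a : mhom x z)
    (t : mcell (one a) (snoc (one e) v)) :
  iso2 t -> lfaithful e -> lfull e -> co_out2 t.
Proof.
move=> ht Fa Fu x0 x'' Γ1 l z0 z'' Γ2 r Δ s.
elim/lside_outsome_ind: x0 x'' Γ1 / l Δ s.
elim/rside_outnil_ind: z0 z'' Γ2 / r => z0 Γ2 Δ s.
apply: ex_unique_iff (fact_out2 (Γ2 := Γ2) ht Fa Fu (hty_pk s)) => q.
split=> [<-|E]; first by rewrite mrg_DG.
by apply: pk_inj; rewrite mrg_DG pk_lw pk_rw -E.
Qed.

Lemma iso_in1 z (v : @mhom X z x) (a : mhom z y)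
    (t : mcell (snoc (one v) e) (one a)) :
  iso2 t -> rfaithful e -> rfull e -> in1 t.
Proof.
move=> ht Fa Fu x0 x'' Δ1 l z0 z'' Δ2 r Γ s.
elim/rside_some_ind: z0 z'' Δ2 / r Γ s.
elim/lside_nil_ind: x0 x'' Δ1 / l => [|x0 Δ1] Γ s.
  apply: ex_unique_iff (fact_in1 (Δ1 := onil) ht Fa Fu (hty_pk s)) => q.
  split=> [<-|E]; first by rewrite mrg_GG pk_comp pk_lw pk_rw !hlw_onil.
  by apply: pk_inj; rewrite mrg_GG pk_comp pk_lw pk_rw -E !hlw_onil.
apply: ex_unique_iff (fact_in1 (Δ1 := osome Δ1) ht Fa Fu (hty_pk s)) => q.
split=> [<-|E]; first by rewrite mrg_DG.
by apply: pk_inj; rewrite mrg_DG pk_lw pk_rw -E.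
Qed.

Lemma iso_co_out1 z (v : @mhom X z x) (a : mhom z y)
    (t : mcell (one a) (snoc (one v) e)) :
  iso2 t -> rfaithful e -> rfull e -> co_out1 t.
Proof.
move=> ht Fa Fu x0 x'' Γ1 l z0 z'' Γ2 r Δ s.
elim/rside_outsome_ind: z0 z'' Γ2 / r Δ s.
elim/lside_outnil_ind: x0 x'' Γ1 / l => x0 Γ1 Δ s.
apply: ex_unique_iff (fact_out1 (Γ1 := Γ1) ht Fa Fu (hty_pk s)) => q.
split=> [<-|E]; first by rewrite mrg_GD.
by apply: pk_inj; rewrite mrg_GD pk_lw pk_rw -E.
Qed.
End FullyFaithful.
End Units.
Arguments units X {S}.
Arguments tensors X {S}.

Section Equivalences.
Context {X : mbicat_data} {S : strict X} (U : units X).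
Implicit Types x y z u v w : X.

Local Notation "'𝟙'" := (uob U).

Definition lun x y (Γ : npath (@mhom X) x y) : mcell (cat (one (𝟙 x)) Γ) Γ :=
  lunit_seq (@ul _ _ U) Γ.
Definition run x y (Γ : npath (@mhom X) x y) : mcell (snoc Γ (𝟙 y)) Γ :=
  runit_seq (@ur _ _ U) Γ.

Lemma lun_nat x y (P : hcell x y) Γ Δ : hty P Γ Δ ->
  ⌊𝟙 x⌋ ▷ P * pk (lun Δ) = pk (lun Γ) * P.
Proof. by move=> [p ->]; rewrite -pk_lw -!pk_comp -ul_nat. Qed.

Lemma run_nat x y (P : hcell x y) Γ Δ : hty P Γ Δ ->
  P ◁ ⌊𝟙 y⌋ * pk (run Δ) = pk (run Γ) * P.
Proof. by move=> [p ->]; rewrite -pk_rw -!pk_comp -ur_nat. Qed.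

Lemma lun_iso x y (Γ : npath (@mhom X) x y) :
  hiso (pk (lun Γ)) (cat (one (𝟙 x)) Γ) Γ.
Proof.
elim: Γ => [z a|z w Γ IH a]; first exact/hisoP/ul_iso.
exact: (hiso_rw ⌊a⌋ IH).
Qed.

Lemma run_iso x y (Γ : npath (@mhom X) x y) :
  hiso (pk (run Γ)) (snoc Γ (𝟙 y)) Γ.
Proof.
case: Γ => [z a|z w Γ a]; first exact/hisoP/ur_iso.
exact: (hiso_lw (osome Γ) (proj1 (hisoP _) (ur_iso U a))).
Qed.

Lemma run_snoc x y z (Γ : npath (@mhom X) x y) (a : mhom y z) :
  pk (run (snoc Γ a)) = osome Γ ▷ pk (ur U a).
Proof. by []. Qed.

Definition equiv1 x x' (e : @mhom X x x') : Prop :=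
  exists u : mhom x' x,
    (exists i : mcell (snoc (one e) u) (one (𝟙 x)), iso2 i) /\
    (exists j : mcell (snoc (one u) e) (one (𝟙 x')), iso2 j).

Lemma equiv1_sym x x' (e : @mhom X x x') : equiv1 e -> exists u : mhom x' x,
  [/\ equiv1 u, exists i : mcell (snoc (one e) u) (one (𝟙 x)), iso2 i
    & exists j : mcell (snoc (one u) e) (one (𝟙 x')), iso2 j].
Proof. by move=> [u [hi hj]]; exists u; split=> //; exists e. Qed.

(** Conjugation with the unitors turns whiskering with the unit into the
    identity. *)
Lemma lfaithful1 x : lfaithful (𝟙 x).
Proof.
move=> z Γ Δ p q /(congr1 (fun P => P * pk (lun Δ))).
rewrite !(lun_nat (hty_pk _)) => /(hcancell (lun_iso Γ) (hty_pk p) (hty_pk q)).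
exact: pk_inj.
Qed.

Lemma rfaithful1 x : rfaithful (𝟙 x).
Proof.
move=> z Γ Δ p q /(congr1 (fun P => P * pk (run Δ))).
rewrite !(run_nat (hty_pk _)) => /(hcancell (run_iso Γ) (hty_pk p) (hty_pk q)).
exact: pk_inj.
Qed.

Lemma slidel x x' w (u : mhom x' x) (e : @mhom X x w) (v : mhom x' w) z
    (i : mcell (snoc (one u) e) (one v)) (P : hcell w z) Γ Δ : hty P Γ Δ ->
  ⌊u⌋ ▷ ⌊e⌋ ▷ P * pk i ◁ osome Δ = pk i ◁ osome Γ * ⌊v⌋ ▷ P.
Proof.
move=> tP; rewrite (hexch (hty_pk i) tP); congr (_ * _).
exact: esym (hlw_ocat ⌊u⌋ ⌊e⌋ P).
Qed.

Lemma slider x x' w (u : mhom x' x) (e : @mhom X x w) (v : mhom x' w) z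
    (i : mcell (snoc (one u) e) (one v)) (P : hcell z x') Γ Δ : hty P Γ Δ ->
  P ◁ ⌊u⌋ ◁ ⌊e⌋ * osome Δ ▷ pk i = osome Γ ▷ pk i * P ◁ ⌊v⌋.
Proof.
move=> tP; rewrite -(hexch tP (hty_pk i)); congr (_ * _).
exact: esym (hrw_ocat ⌊u⌋ ⌊e⌋ P).
Qed.

(** By exchange, u and e whiskered with p is conjugate to 1 whiskered with p. *)
Lemma lfaithful_inv x x' (e : @mhom X x x') (u : mhom x' x)
    (i : mcell (snoc (one u) e) (one (𝟙 x'))) : iso2 i -> lfaithful e.
Proof.
move=> /hisoP hi z Γ Δ p q /(congr1 (fun P => ⌊u⌋ ▷ P * pk i ◁ osome Δ)).
rewrite !(slidel _ (hty_pk _)) => E; apply: lfaithful1.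
by apply: hcancell (hiso_rw (osome Γ) hi) _ _ E; hty.
Qed.

Lemma rfaithful_inv x x' (e : @mhom X x x') (u : mhom x' x)
    (i : mcell (snoc (one e) u) (one (𝟙 x))) : iso2 i -> rfaithful e.
Proof.
move=> /hisoP hi z Γ Δ p q /(congr1 (fun P => P ◁ ⌊u⌋ * osome Δ ▷ pk i)).
rewrite !(slider _ (hty_pk _)) => E; apply: rfaithful1.
by apply: hcancell (hiso_lw (osome Γ) hi) _ _ E; hty.
Qed.

(** The preimage of P is obtained by whiskering P with the inverse u of e and
    then cancelling (u,e) and the unit; it is a preimage because whiskering with
    u is faithful. *)
Lemma lfull_equiv x x' (e : @mhom X x x') : equiv1 e -> lfull e.
Proof.
move=> [u [[j hj] [i /hisoP hi]]] z Γ Δ P tP.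
have [L hL] := lun_iso Γ; have [_ tL _ _] := hL.
have [I hI] := hi; have {}hI := hinv_rw (osome Γ) hI; have [_ tI _ _] := hI.
have tuP : hty (⌊u⌋ ▷ P) (cat (snoc (one u) e) Γ) (cat (snoc (one u) e) Δ).
  apply: hty_cast (hty_lw _ tP) _ _; exact: (catA (one u) (one e)).
have tQ0 : hty (I ◁ osome Γ * (⌊u⌋ ▷ P) * pk i ◁ osome Δ)
    (cat (one (𝟙 x')) Γ) (cat (one (𝟙 x')) Δ) by hty.
have [q qE] : hty (L * (I ◁ osome Γ * (⌊u⌋ ▷ P) * pk i ◁ osome Δ) * pk (lun Δ)) Γ Δ
  by hty.
exists q; have [p pE] := tP; rewrite pE -pk_lw; congr pk.
apply: (lfaithful_inv hj); rewrite pk_lw -pE.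
have tq : hty (⌊u⌋ ▷ ⌊e⌋ ▷ pk q) (cat (snoc (one u) e) Γ) (cat (snoc (one u) e) Δ).
  by apply: hty_cast (hty_lw ⌊u⌋ (hty_lw ⌊e⌋ (hty_pk q))) _ _;
     exact: (catA (one u) (one e)).
apply: (hcancelr (hiso_rw (osome Δ) hi) tq tuP _).
rewrite -(hinvK hI (hty_comp tuP (hty_rw (osome Δ) (hty_pk i)))).
rewrite (slidel i (hty_pk q)); congr (_ * _).
apply: (hcancelr (lun_iso Δ) _ (hty_comp tI (hty_comp tuP (hty_rw (osome Δ) (hty_pk i)))) _).
  exact: (hty_lw ⌊𝟙 x'⌋ (hty_pk q)).
rewrite (lun_nat (hty_pk q)) -qE -!hcompA.
by rewrite (hinvK hL (hty_comp tI (hty_comp tuP (hty_comp (hty_rw (osome Δ) (hty_pk i)) (hty_pk (lun Δ)))))).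
Qed.

Lemma rfull_equiv x x' (e : @mhom X x x') : equiv1 e -> rfull e.
Proof.
move=> [u [[i /hisoP hi] [j hj]]] z Γ Δ P tP.
have [L hL] := run_iso Γ; have [_ tL _ _] := hL.
have [I hI] := hi; have {}hI := hinv_lw (osome Γ) hI; have [_ tI _ _] := hI.
have tuP : hty (P ◁ ⌊u⌋) (cat Γ (snoc (one e) u)) (cat Δ (snoc (one e) u)).
  exact: (hty_rw ⌊u⌋ tP).
have ti : hty (osome Δ ▷ pk i) (cat Δ (snoc (one e) u)) (snoc Δ (𝟙 x)) by hty.
have tQ0 : hty (osome Γ ▷ I * (P ◁ ⌊u⌋) * osome Δ ▷ pk i)
    (snoc Γ (𝟙 x)) (snoc Δ (𝟙 x)) by hty.
have [q qE] : hty (L * (osome Γ ▷ I * (P ◁ ⌊u⌋) * osome Δ ▷ pk i) * pk (run Δ)) Γ Δ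
  by hty.
exists q; have [p pE] := tP; rewrite pE -(pk_rw ⌊e⌋ q); congr pk.
apply: (rfaithful_inv hj); rewrite -pE.
apply: (hcancelr (hiso_lw (osome Δ) hi) (hty_rw ⌊u⌋ (hty_rw ⌊e⌋ (hty_pk q))) tuP _).
rewrite -(hinvK hI (hty_comp tuP ti)).
rewrite (slider i (hty_pk q)); congr (_ * _).
apply: (hcancelr (run_iso Δ) _ (hty_comp tI (hty_comp tuP ti)) _).
  exact: (hty_rw ⌊𝟙 x⌋ (hty_pk q)).
rewrite (run_nat (hty_pk q)) -qE -!hcompA.
by rewrite (hinvK hL (hty_comp tI (hty_comp tuP (hty_comp ti (hty_pk (run Δ)))))).
Qed.

Lemma lfaithful_equiv x x' (e : @mhom X x x') : equiv1 e -> lfaithful e.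
Proof. by move=> [u [_ [j hj]]]; exact: lfaithful_inv hj. Qed.

Lemma rfaithful_equiv x x' (e : @mhom X x x') : equiv1 e -> rfaithful e.
Proof. by move=> [u [[i hi] _]]; exact: rfaithful_inv hi. Qed.
End Equivalences.

Section Universal1.
Context {X : mbicat_data} {S : strict X} (U : units X) (T : tensors X).
Implicit Types x y z : X.

Local Notation "'𝟙'" := (uob U).

Lemma hiso_cell x y (P : hcell x y) Γ Δ : hiso P Γ Δ ->
  exists2 p : mcell Γ Δ, P = pk p & iso2 p.
Proof. by move=> hP; have [p pE] := hiso_hty hP; exists p => //; apply/hisoP; rewrite -pE. Qed.

Lemma iso2_inv x y (Γ Δ : npath (@mhom X) x y) (p : mcell Γ Δ) : iso2 p ->
  exists q : mcell Δ Γ, iso2 q.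
Proof. by move=> [q [pq qp]]; exists q, p. Qed.

(** Solving (e,u) -> (1) and (u',e) -> (1) gives a right and a left inverse of e;
    they are isomorphic, by the usual comparison through (u',e,u). *)
Lemma tensor_universal_equiv1 x x' (e : @mhom X x x') :
  tensor_universal e -> equiv1 U e.
Proof.
case=> /(_ _ (𝟙 x)) [u [t [/univ_outP ht _]]] _.
move=> /(_ _ (𝟙 x')) [u' [t' [/univ_outP ht' _]]] _.
exists u; split; first by exists t.
move/hisoP in ht; have /hisoP ht'1 := ht'; have [I /hiso_inv hI] := ht'1.
have [L /hiso_inv hL] := lun_iso U (one u).
have hθ : hiso (L * (I ◁ ⌊u⌋) * (⌊u'⌋ ▷ pk t) * pk (run U (one u')))
    (one u) (one u').
  exact: (hiso_comp (hiso_comp (hiso_comp hL (hiso_rw ⌊u⌋ hI))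
    (hiso_lw ⌊u'⌋ ht)) (run_iso U (one u'))).
have [j _ hj] := hiso_cell (hiso_comp (hiso_rw ⌊e⌋ hθ) ht'1).
by exists j.
Qed.

Lemma equiv1_solve2 x x' (e : @mhom X x x') y (a : mhom x y) : equiv1 U e ->
  exists u (t : mcell (snoc (one e) u) (one a)), iso2 t.
Proof.
move=> [u [[i /hisoP hi] _]]; exists (tob T u a).
have /hisoP [I /hiso_inv hI] := tn_iso T u a.
have hl := lun_iso U (one a).
have [t _ ht] := hiso_cell (hiso_comp (hiso_comp (hiso_lw ⌊e⌋ hI)
  (hiso_rw ⌊a⌋ hi)) hl).
by exists t.
Qed.

Lemma equiv1_solve1 x x' (e : @mhom X x x') z (b : mhom z x') : equiv1 U e ->
  exists u (t : mcell (snoc (one u) e) (one b)), iso2 t.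
Proof.
move=> [u [_ [j /hisoP hj]]]; exists (tob T b u).
have /hisoP [I /hiso_inv hI] := tn_iso T b u.
have hr := run_iso U (one b).
have [t _ ht] := hiso_cell (hiso_comp (hiso_comp (hiso_rw ⌊e⌋ hI)
  (hiso_lw ⌊b⌋ hj)) hr).
by exists t.
Qed.

(** The 2-cells required are a tensor of e, or the canonical (e,u⊗a) -> (a), and
    their inverses; their universality at 1-cells other than e is that
    whiskering with e is fully faithful. *)
Lemma equiv1_universal x x' (e : @mhom X x x') : equiv1 U e -> universal1 e.
Proof.
move=> he; have Lf := lfaithful_equiv he; have Rf := rfaithful_equiv he.
have Lu := lfull_equiv he; have Ru := rfull_equiv he.
have L z (v : mhom x' z) a (t : mcell (snoc (one e) v) (one a)) :
    iso2 t -> out1 t /\ in2 t.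
  by move=> ht; split; [exact/univ_outP | exact: iso_in2].
have R z (v : mhom z x) a (t : mcell (snoc (one v) e) (one a)) :
    iso2 t -> out1 t /\ in1 t.
  by move=> ht; split; [exact/univ_outP | exact: iso_in1].
have L' z (v : mhom x' z) a (t : mcell (one a) (snoc (one e) v)) :
    iso2 t -> co_in1 t /\ co_out2 t.
  by move=> ht; split; [exact/univ_inP | exact: iso_co_out2].
have R' z (v : mhom z x) a (t : mcell (one a) (snoc (one v) e)) :
    iso2 t -> co_in1 t /\ co_out1 t.
  by move=> ht; split; [exact/univ_inP | exact: iso_co_out1].
split; split.
- by move=> y a; have [u [t /L]] := equiv1_solve2 a he; exists u, t.
- by move=> y a; exists (tob T e a), (tn T e a); exact/L/tn_iso.
- by move=> y b; have [u [t /R]] := equiv1_solve1 b he; exists u, t.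
- by move=> y b; exists (tob T b e), (tn T b e); exact/R/tn_iso.
- move=> y a; have [u [t /iso2_inv [t' /L' h]]] := equiv1_solve2 a he.
  by exists u, t'.
- move=> y a; have [t' /L' h] := iso2_inv (tn_iso T e a).
  by exists (tob T e a), t'.
- move=> y b; have [u [t /iso2_inv [t' /R' h]]] := equiv1_solve1 b he.
  by exists u, t'.
- move=> y b; have [t' /R' h] := iso2_inv (tn_iso T b e).
  by exists (tob T b e), t'.
Qed.

Lemma universal1P x x' (e : @mhom X x x') : universal1 e <-> equiv1 U e.
Proof.
by split=> [[/tensor_universal_equiv1]|]; last exact: equiv1_universal.
Qed.

Lemma equiv1_unit x : equiv1 U (𝟙 x).
Proof. by exists (𝟙 x); split; exists (ul U (𝟙 x)); exact: ul_iso. Qed.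

Lemma equiv1_iso x x' (e e' : @mhom X x x') (p : mcell (one e) (one e')) :
  iso2 p -> equiv1 U e -> equiv1 U e'.
Proof.
move=> /hisoP [Q /hiso_inv hQ] [u [[i /hisoP hi] [j /hisoP hj]]].
exists u.
have [i' _ hi'] := hiso_cell (hiso_comp (hiso_rw ⌊u⌋ hQ) hi).
have [j' _ hj'] := hiso_cell (hiso_comp (hiso_lw ⌊u⌋ hQ) hj).
by split; [exists i' | exists j'].
Qed.

End Universal1.


(** * Functors and transformations in the calculus *)

(** Functoriality for vertical composition and whiskering, to which both strong
    morphisms and ∫f are reduced. *)
Record pfun (X Y : mbicat_data) {SX : strict X} {SY : strict Y}
    (f : mor_data X Y) : Prop := PFun {
  pf_id : forall (x y : X) (Γ : npath (@mhom X) x y), m2 f (cid Γ) = cid _;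
  pf_comp : forall (x y : X) (Γ Δ Θ : npath (@mhom X) x y)
    (p : mcell Γ Δ) (q : mcell Δ Θ),
    m2 f (comp p q) = comp (m2 f p) (m2 f q);
  pf_lw : forall (x y z : X) (Θ : npath (@mhom X) x y)
    (Γ Δ : npath (@mhom X) y z) (p : mcell Γ Δ),
    pk (m2 f (lw (osome Θ) p)) = osome (mpath f Θ) ▷ pk (m2 f p);
  pf_rw : forall (x y z : X) (Θ : npath (@mhom X) y z)
    (Γ Δ : npath (@mhom X) x y) (p : mcell Γ Δ),
    pk (m2 f (rw (osome Θ) p)) = pk (m2 f p) ◁ osome (mpath f Θ) }.

Section Trans.
Context {X Y : mbicat_data} {SX : strict X} {SY : strict Y}.

Lemma pf_iso (f : mor_data X Y) (hf : pfun f) (x y : X)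
    (Γ Δ : npath (@mhom X) x y) (p : mcell Γ Δ) : iso2 p -> iso2 (m2 f p).
Proof.
by move=> [q [pq qp]]; exists (m2 f q); rewrite -!(pf_comp hf) pq qp !(pf_id hf).
Qed.

Variables (f g : mor_data X Y) (hf : pfun f) (hg : pfun g) (σ : mtrans f g).
Implicit Types x y z : X.

Local Notation S Γ := (pk (mt_seq σ Γ)).
Local Notation "'f_' p" := (pk (m2 f p)) (at level 10, p at level 9).
Local Notation "'g_' p" := (pk (m2 g p)) (at level 10, p at level 9).

Lemma mt_seq_snoc x y z (Γ : npath mhom x y) (a : mhom y z) :
  S (snoc Γ a) = osome (mpath f Γ) ▷ pk (mt1 σ a) * S Γ ◁ ⌊m1 g a⌋.
Proof.
exact: (mrg_GD (Γ1 := osome (mpath f Γ)) (Δ2 := one (m1 g a)) (mt1 σ a)).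
Qed.

Lemma mt_seq_cat x y z (Γ : npath mhom x y) (Δ : npath mhom y z) :
  S (cat Γ Δ)
  = osome (mpath f Γ) ▷ S Δ * S Γ ◁ osome (mpath g Δ).
Proof.
elim: Δ => [w a|w v Δ IH a]; first exact: mt_seq_snoc.
rewrite [cat _ _]/= !mt_seq_snoc IH hlw_comp hrw_comp !hcompA npmap_cat.
rewrite (hlw_ocat (osome (mpath f Γ)) (osome (mpath f Δ))) hlw_hrw.
by rewrite -(hrw_ocat (osome (mpath g Δ)) ⌊m1 g a⌋).
Qed.

(** The condition of [is_moplax] at p, as an equation between composites of
    whiskered 2-cells. *)
Definition nat_at x y (Γ Δ : npath mhom x y) (p : mcell Γ Δ) : Prop :=
  f_ p ◁ ⌊σ y⌋ * S Δ = S Γ * ⌊σ x⌋ ▷ g_ p.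

Lemma nat_atE x y (Γ Δ : npath mhom x y) (p : mcell Γ Δ) : nat_at p <->
  comp (rw ⌊σ y⌋ (m2 f p)) (mt_seq σ Δ) = comp (mt_seq σ Γ) (lw ⌊σ x⌋ (m2 g p)).
Proof.
rewrite /nat_at -pk_rw -pk_lw -(pk_comp (mt_seq σ Γ)) -(pk_comp (rw ⌊σ y⌋ _)).
by split=> [/pk_inj|->].
Qed.

Lemma is_moplaxP :
  is_moplax σ <-> forall x y (Γ Δ : npath mhom x y) (p : mcell Γ Δ), nat_at p.
Proof.
split=> H x y Γ Δ p.
  have := congr1 pk (H x y Γ Δ p); rewrite (mrg_GG (Γ2 := ⌊σ y⌋)).
  by rewrite (mrg_DG (Γ2 := onil)) pk_comp lw_onil rw_onil.
apply: pk_inj; rewrite (mrg_GG (Γ2 := ⌊σ y⌋)) (mrg_DG (Γ2 := onil)).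
by rewrite pk_comp lw_onil rw_onil; exact: H.
Qed.

Lemma nat_id x y (Γ : npath mhom x y) : nat_at (cid Γ).
Proof.
rewrite /nat_at (pf_id hf) (pf_id hg) hrw_id hlw_id.
by rewrite (hid_comp (hty_pk _)) (hcomp_id (hty_pk (mt_seq σ Γ))).
Qed.

Lemma nat_comp x y (Γ Δ Θ : npath mhom x y) (p : mcell Γ Δ) (q : mcell Δ Θ) :
  nat_at p -> nat_at q -> nat_at (comp p q).
Proof.
move=> np nq; rewrite /nat_at (pf_comp hf) (pf_comp hg) !pk_comp.
by rewrite hrw_comp hlw_comp -hcompA nq !hcompA np.
Qed.

Lemma nat_inv x y (Γ Δ : npath mhom x y) (p : mcell Γ Δ) (q : mcell Δ Γ) :
  comp p q = cid Γ -> comp q p = cid Δ -> nat_at p -> nat_at q.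
Proof.
move=> pq qp np; rewrite /nat_at.
have hF : hinv (f_ q ◁ ⌊σ y⌋) (f_ p ◁ ⌊σ y⌋) 
      (cat_no (mpath f Δ) ⌊σ y⌋) (cat_no (mpath f Γ) ⌊σ y⌋).
  apply: hinv_rw; split; try hty.
    by rewrite -pk_comp -(pf_comp hf) qp (pf_id hf).
  by rewrite -pk_comp -(pf_comp hf) pq (pf_id hf).
have hG : hinv (⌊σ x⌋ ▷ g_ p) (⌊σ x⌋ ▷ g_ q)
      (cat_on ⌊σ x⌋ (mpath g Γ)) (cat_on ⌊σ x⌋ (mpath g Δ)).
  apply: hinv_lw; split; try hty.
    by rewrite -pk_comp -(pf_comp hg) pq (pf_id hg).
  by rewrite -pk_comp -(pf_comp hg) qp (pf_id hg).
rewrite -(hinvKr hG (hty_pk (mt_seq σ Γ))) -np -!hcompA.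
by rewrite (hinvK hF (hty_comp (hty_pk (mt_seq σ Δ)) (hty_lw ⌊σ x⌋ (hty_pk (m2 g q))))).
Qed.

Lemma nat_rw x y z (Θ : npath mhom y z) (Γ Δ : npath mhom x y)
  (p : mcell Γ Δ) : nat_at p -> nat_at (rw (osome Θ) p).
Proof.
move=> np; rewrite /nat_at (pf_rw hf) (pf_rw hg) !mt_seq_cat.
rewrite hlw_hrw -hcompA -hrw_comp -np hrw_comp !hcompA; congr (_ * _).
rewrite -(hrw_ocat (osome (mpath f Θ)) ⌊σ z⌋).
rewrite -(hrw_ocat ⌊σ y⌋ (osome (mpath g Θ))).
exact: (hexch (hty_pk (m2 f p)) (hty_pk (mt_seq σ Θ))).
Qed.

(** Each p : (Γ) -> (Δ) is t ; (t^{-1} ; p ; s) ; s^{-1} with t and s iterated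
    tensors, and the middle part has one input and one output. *)
Lemma moplax_gen (T : tensors X) :
  (forall x y (a b : mhom x y) (p : mcell (one a) (one b)), nat_at p) ->
  (forall x y z (a : mhom x y) (b : mhom y z), nat_at (tn T a b)) ->
  is_moplax σ.
Proof.
move=> n1 nT.
have N x y (Γ : npath (@mhom X) x y) :
    exists c (t : mcell Γ (one c)), iso2 t /\ nat_at t.
  elim: Γ => [z a|z w Γ [c [t [ht nt]]] a].
    exists a, (cid (one a)); split; last exact: nat_id.
    by apply/hisoP; exact: hiso_id.
  exists (tob T c a), (comp (rw ⌊a⌋ t) (tn T c a)); split.
    apply/hisoP; rewrite pk_comp.
    exact: (hiso_comp (hiso_rw ⌊a⌋ (proj1 (hisoP t) ht))
             (proj1 (hisoP _) (tn_iso T c a))).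
  exact: (nat_comp (nat_rw (one a) nt) (nT _ _ _ c a)).
apply/is_moplaxP => x y Γ Δ p.
have [c [t [[t' [tt' t't]] nt]]] := N _ _ Γ.
have [d [s [[s' [ss' s's]] ns]]] := N _ _ Δ.
have -> : p = comp (comp t (comp (comp t' p) s)) s'.
  by rewrite -!compA ss' compp1 compA tt' comp1p.
apply: nat_comp (nat_inv ss' s's ns).
by apply: nat_comp nt _; exact: n1.
Qed.

Section Units.
Variables (UX : units X) (UY : units Y).

Lemma pf_equiv1 :
  (forall x, exists w : mcell (one (uob UY (f x))) (one (m1 f (uob UX x))), iso2 w) ->
  forall x y (e : @mhom X x y), equiv1 UX e -> equiv1 UY (m1 f e).
Proof.
move=> hu x y e [u [[i /(pf_iso hf) /hisoP hi] [j /(pf_iso hf) /hisoP hj]]].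
exists (m1 f u).
have [w /hisoP [W /hiso_inv hW]] := hu x.
have [w' /hisoP [W' /hiso_inv hW']] := hu y.
have [i' _ hi'] := hiso_cell (hiso_comp hi hW).
have [j' _ hj'] := hiso_cell (hiso_comp hj hW').
by split; [exists i' | exists j'].
Qed.
End Units.

(** Naturality at (e,u) -> (1) says that σ_u followed by σ_e, both whiskered, is
    invertible; so σ_e whiskered with g(u) has a section, and σ_e has one as
    whiskering with g(u) is fully faithful.  A retraction comes from
    (u,e) -> (1) and whiskering with f(u). *)
Lemma oplax_equiv1 (UX : units X) (UY : units Y) :
  (forall x y (e : @mhom X x y), equiv1 UX e -> equiv1 UY (m1 f e)) ->
  (forall x y (e : @mhom X x y), equiv1 UX e -> equiv1 UY (m1 g e)) ->
  is_moplax σ -> (forall x, iso2 (mt1 σ (uob UX x))) ->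
  forall x y (e : @mhom X x y), equiv1 UX e -> iso2 (mt1 σ e).
Proof.
move=> fE gE /is_moplaxP N h1 x y e.
have K z w (v : @mhom X z w) (v' : @mhom X w z)
    (t : mcell (snoc (one v) v') (one (uob UX z))) : iso2 t ->
    hiso (⌊m1 f v⌋ ▷ pk (mt1 σ v') * pk (mt1 σ v) ◁ ⌊m1 g v'⌋)
      (snoc (snoc (one (m1 f v)) (m1 f v')) (σ z))
      (snoc (snoc (one (σ z)) (m1 g v)) (m1 g v')).
  move=> ht; have := N _ _ _ _ t; rewrite /nat_at mt_seq_snoc => Nt.
  have hgt := hiso_lw ⌊σ z⌋ (proj1 (hisoP _) (pf_iso hg ht)).
  apply: (hiso_compr hgt).
    exact: (hty_comp (hty_lw ⌊m1 f v⌋ (hty_pk (mt1 σ v')))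
              (hty_rw ⌊m1 g v'⌋ (hty_pk (mt1 σ v)))).
  rewrite -Nt; apply: (hiso_comp (Δ := snoc (one (m1 f (uob UX z))) (σ z))).
    exact: (hiso_rw ⌊σ z⌋ (proj1 (hisoP _) (pf_iso hf ht))).
  exact/hisoP/h1.
move=> /equiv1_sym [u [hu [i /K [K1 [tK1 tK1' _ e1]]] [j /K [K2 [tK2 tK2' e2 _]]]]].
have hfu := fE _ _ _ hu; have hgu := gE _ _ _ hu.
have [p pE] : exists p : mcell (snoc (one (σ x)) (m1 g e)) (snoc (one (m1 f e)) (σ y)),
    pk p ◁ ⌊m1 g u⌋ = K1 * ⌊m1 f e⌋ ▷ pk (mt1 σ u).
  apply: (rfull_equiv hgu).
  exact: (hty_comp tK1' (hty_lw ⌊m1 f e⌋ (hty_pk (mt1 σ u)))).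
have [q qE] : exists q : mcell (snoc (one (σ x)) (m1 g e)) (snoc (one (m1 f e)) (σ y)),
    ⌊m1 f u⌋ ▷ pk q = pk (mt1 σ u) ◁ ⌊m1 g e⌋ * K2.
  apply: (lfull_equiv hfu).
  exact: (hty_comp (hty_rw ⌊m1 g e⌋ (hty_pk (mt1 σ u))) tK2').
have pσ : comp p (mt1 σ e) = cid _.
  apply: (rfaithful_equiv hgu).
  by rewrite pk_comp hrw_comp pE -hcompA e1 hrw_id.
have σq : comp (mt1 σ e) q = cid _.
  apply: (lfaithful_equiv hfu).
  by rewrite pk_comp hlw_comp qE hcompA e2 hlw_id.
exists p; split=> //.
by rewrite -[p]compp1 -σq (compA p) pσ comp1p.
Qed.

Lemma is_fairP (UX : units X) (UY : units Y) (TX : tensors X) :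
  (forall x y (e : @mhom X x y), equiv1 UX e -> equiv1 UY (m1 f e)) ->
  (forall x y (e : @mhom X x y), equiv1 UX e -> equiv1 UY (m1 g e)) ->
  is_fair σ <-> is_moplax σ /\ forall x, iso2 (mt1 σ (uob UX x)).
Proof.
move=> fE gE; split=> [[hm hu]|[hm h1]]; split=> //.
  by move=> x; apply/universal2P/hu/(universal1P UX TX); exact: equiv1_unit.
move=> x y e /(universal1P UX TX) he; apply/universal2P.
exact: (oplax_equiv1 fE gE hm h1).
Qed.

End Trans.

Section FunctorUnit.
Context {X Y : mbicat_data} {SX : strict X} {SY : strict Y}.
Variables (UX : units X) (UY : units Y).
Variables (f : mor_data X Y) (hf : pfun f).
Local Notation "'𝟙'" := (uob UX).
Local Notation "'𝕁'" := (uob UY).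

(** The left unitor at 1 is a multiplication on 1; naturality of the unitors
    with respect to itself is its associativity. *)
Lemma unit_mult_assoc (x : X) :
  ⌊𝟙 x⌋ ▷ pk (ul UX (𝟙 x)) * pk (ul UX (𝟙 x))
  = pk (ul UX (𝟙 x)) ◁ ⌊𝟙 x⌋ * pk (ul UX (𝟙 x)).
Proof. exact: (lun_nat UX (hty_pk (ul UX (𝟙 x)))). Qed.

(** A unit of the multiplication f(l_1) on one side is one on the other side: by
    associativity and the triangle both sides agree once whiskered with f(1)
    and multiplied. *)
Lemma funit_right (x : X) (w : mcell (one (𝕁 (f x))) (one (m1 f (𝟙 x)))) :
  iso2 w ->
  pk w ◁ ⌊m1 f (𝟙 x)⌋ * pk (m2 f (ul UX (𝟙 x))) = pk (ul UY (m1 f (𝟙 x))) ->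
  ⌊m1 f (𝟙 x)⌋ ▷ pk w * pk (m2 f (ul UX (𝟙 x))) = pk (ur UY (m1 f (𝟙 x))).
Proof.
set e := m1 f (𝟙 x); set m := m2 f (ul UX (𝟙 x)) => hw wE.
have hm : hiso (pk m) (snoc (one e) e) (one e).
  by apply/hisoP/(pf_iso hf)/ul_iso.
have he : equiv1 UY e by apply: equiv1_iso hw (equiv1_unit _ _).
have mA : ⌊e⌋ ▷ pk m * pk m = pk m ◁ ⌊e⌋ * pk m.
  have := unit_mult_assoc x; rewrite -pk_lw -(pk_rw ⌊𝟙 x⌋) -!pk_comp.
  move=> /pk_inj/(congr1 (fun p => pk (m2 f p))).
  by rewrite !(pf_comp hf) !pk_comp (pf_lw hf (one (𝟙 x))) (pf_rw hf (one (𝟙 x))).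
have [z zE] : hty (⌊e⌋ ▷ pk w * pk m) (snoc (one e) (𝕁 (f x))) (one e).
  exact: (hty_comp (hty_lw ⌊e⌋ (hty_pk w)) (hty_pk m)).
rewrite zE; congr pk; apply: (rfaithful_equiv he).
apply: (hcancelr hm (hty_rw ⌊e⌋ (hty_pk z)) (hty_rw ⌊e⌋ (hty_pk (ur UY e)))).
rewrite -zE hrw_comp -hcompA -mA hcompA -hlw_hrw -hlw_comp wE.
by rewrite -(pk_lw ⌊e⌋ (ul UY e)) -(pk_rw ⌊e⌋ (ur UY e)) ulr.
Qed.
End FunctorUnit.

Section OplaxUnit.
Context {X Y : mbicat_data} {SX : strict X} {SY : strict Y}.
Variables (UX : units X) (UY : units Y).
Variables (f g : mor_data X Y) (hf : pfun f) (hg : pfun g) (σ : mtrans f g).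
Local Notation "'𝟙'" := (uob UX).
Local Notation "'𝕁'" := (uob UY).

Variables (x : X).
Variables (wf : mcell (one (𝕁 (f x))) (one (m1 f (𝟙 x)))).
Variables (wg : mcell (one (𝕁 (g x))) (one (m1 g (𝟙 x)))).
Hypotheses (hwf : iso2 wf) (hwg : iso2 wg).
Hypothesis wfE :
  pk wf ◁ ⌊m1 f (𝟙 x)⌋ * pk (m2 f (ul UX (𝟙 x))) = pk (ul UY (m1 f (𝟙 x))).
Hypothesis wgE :
  pk wg ◁ ⌊m1 g (𝟙 x)⌋ * pk (m2 g (ul UX (𝟙 x))) = pk (ul UY (m1 g (𝟙 x))).

Local Notation s := (σ x).
Local Notation fe := (m1 f (𝟙 x)).
Local Notation ge := (m1 g (𝟙 x)).

(** With k : (f(1),s) -> (s) and k' : (s,g(1)) -> (s) the unitors of s = σ_x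
    transported to f(1) and g(1), put θ = k^{-1} ; σ_1 ; k'.  Both unitors are
    actions of the multiplications f(l_1) and g(l_1), so that naturality of σ at
    l_1 reads θ = θ ; θ.  As θ is invertible, it is an identity, and the claim is
    σ_1 ; k' = k. *)
Lemma oplax_unit (Q : hcell (f x) (g x)) : is_moplax σ -> iso2 (mt1 σ (𝟙 x)) ->
  hinv (pk (ur UY s)) Q (snoc (one s) (𝕁 (g x))) (one s) ->
  pk wf ◁ ⌊s⌋ * pk (mt1 σ (𝟙 x)) = pk (ul UY s) * Q * ⌊s⌋ ▷ pk wg.
Proof.
move=> /is_moplaxP N hσ hQ.
have [F hF] := proj1 (hisoP _) hwf; have [twf tF _ _] := hF.
have [G hG] := proj1 (hisoP _) hwg; have [twg tG _ _] := hG.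
have [_ tQ _ _] := hQ.
(* f(1) and g(1) are units as well: through wf and wg they inherit natural
   unitors, whose components at s are k and k' below. *)
have Knat z (R : hcell (f x) z) Γ Δ : hty R Γ Δ ->
    ⌊fe⌋ ▷ R * (F ◁ osome Δ * pk (lun UY Δ))
    = F ◁ osome Γ * pk (lun UY Γ) * R.
  move=> tR; rewrite hcompA -(hexch tF tR) -!hcompA; congr (_ * _).
  exact: lun_nat.
have K'nat z (R : hcell z (g x)) Γ Δ : hty R Γ Δ ->
    R ◁ ⌊ge⌋ * (osome Δ ▷ G * pk (run UY Δ))
    = osome Γ ▷ G * pk (run UY Γ) * R.
  move=> tR; rewrite hcompA (hexch tR tG) -!hcompA; congr (_ * _).
  exact: run_nat.
have hul := proj1 (hisoP _) (ul_iso UY s).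
have hk : hiso (F ◁ ⌊s⌋ * pk (ul UY s)) (snoc (one fe) s) (one s).
  exact: (hiso_comp (hiso_rw ⌊s⌋ (hiso_inv hF)) hul).
have [k kE hk'] := hiso_cell hk.
have [k' k'E] : hty (⌊s⌋ ▷ G * pk (ur UY s)) (snoc (one s) ge) (one s).
  exact: (hty_comp (hty_lw ⌊s⌋ tG) (hty_pk (ur UY s))).
have fm : F ◁ ⌊fe⌋ * pk (ul UY fe) = pk (m2 f (ul UX (𝟙 x))).
  have tm : hty (pk (m2 f (ul UX (𝟙 x)))) (cat_no (one fe) ⌊fe⌋) (one fe).
    exact: hty_pk.
  by rewrite -wfE (hinvK (hinv_rw ⌊fe⌋ (hinv_sym hF)) tm).
have gm : ⌊ge⌋ ▷ G * pk (ur UY ge) = pk (m2 g (ul UX (𝟙 x))).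
  have tm : hty (pk (m2 g (ul UX (𝟙 x)))) (cat_on ⌊ge⌋ (one ge)) (one ge).
    exact: hty_pk.
  by rewrite -(funit_right hg hwg wgE) (hinvK (hinv_lw ⌊ge⌋ (hinv_sym hG)) tm).
set σe := mt1 σ (𝟙 x) in hσ *.
have [K1 hK1] := hk.
have [tk tK1 _ _] := hK1.
have [θ θE] : hty (K1 * (pk σe * pk k')) (one s) (one s).
  exact: (hty_comp tK1 (hty_comp (hty_pk σe) (hty_pk k'))).
have σk : pk σe * pk k' = pk k * pk θ.
  by rewrite -θE -kE (hinvK hK1 (hty_comp (hty_pk σe) (hty_pk k'))).
have H1 : pk (m2 f (ul UX (𝟙 x))) ◁ ⌊s⌋ * pk k = ⌊fe⌋ ▷ pk k * pk k.
  have := Knat _ _ _ _ (hty_pk k); rewrite kE => ->; congr (_ * _).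
  by rewrite -fm hrw_comp -hrw_ocat.
have H2 : ⌊s⌋ ▷ pk (m2 g (ul UX (𝟙 x))) * pk k' = pk k' ◁ ⌊ge⌋ * pk k'.
  have := K'nat _ _ _ _ (hty_pk k'); rewrite k'E => ->; congr (_ * _).
  rewrite run_snoc -gm hlw_comp; congr (_ * _).
  exact: esym (hlw_ocat ⌊s⌋ ⌊ge⌋ G).
have H3 : ⌊fe⌋ ▷ pk θ * pk k = pk k * pk θ.
  by have := Knat _ _ _ _ (hty_pk θ); rewrite kE.
have H4 : pk θ ◁ ⌊ge⌋ * pk k' = pk k' * pk θ.
  by have := K'nat _ _ _ _ (hty_pk θ); rewrite k'E.
have H5 : pk k ◁ ⌊ge⌋ * pk k' = ⌊fe⌋ ▷ pk k' * pk k.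
  have := Knat _ _ _ _ (hty_pk k'); rewrite kE => ->; congr (_ * _).
  rewrite -kE hrw_comp; congr (_ * _).
  exact: esym (hrw_ocat ⌊s⌋ ⌊ge⌋ F).
have hkk : hiso (⌊fe⌋ ▷ pk k * pk k) (snoc (snoc (one fe) fe) s) (one s).
  by move/hisoP in hk'; exact: (hiso_comp (hiso_lw ⌊fe⌋ hk') hk').
have hk'' : hiso (pk k') (snoc (one s) ge) (one s).
  rewrite -k'E; apply: (hiso_comp (hiso_lw ⌊s⌋ (hiso_inv hG))).
  exact/hisoP/ur_iso.
have hθ : hiso (pk θ) (one s) (one s).
  move/hisoP in hk'; move/hisoP in hσ.
  apply: (hiso_compl hk' (hty_pk θ)); rewrite -σk.
  exact: hiso_comp hσ hk''.
have θθ : pk θ * hid (one s) = pk θ * pk θ.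
  rewrite (hcomp_id (hty_pk θ)).
  apply: (hcancell hkk (hty_pk θ) (hty_comp (hty_pk θ) (hty_pk θ))).
  rewrite -{1}H1 -hcompA -σk hcompA.
  have E : pk (m2 f (ul UX (𝟙 x))) ◁ ⌊s⌋ * pk σe
      = ⌊fe⌋ ▷ pk σe * pk σe ◁ ⌊ge⌋ * ⌊s⌋ ▷ pk (m2 g (ul UX (𝟙 x))).
    by have := N _ _ _ _ (ul UX (𝟙 x)); rewrite /nat_at mt_seq_snoc.
  rewrite E -hcompA H2 !hcompA -(hcompA _ (pk σe ◁ _)) -hrw_comp σk.
  rewrite hrw_comp -!hcompA H4 (hcompA (pk k ◁ _)) H5 !hcompA -hlw_comp σk.
  by rewrite hlw_comp -(hcompA _ _ (pk k)) H3 !hcompA.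
have θ1 : hid (one s) = pk θ.
  exact: (hcancell hθ (hty_id _) (hty_pk θ) θθ).
have {}σk : pk σe * pk k' = pk k by rewrite σk -θ1 (hcomp_id (hty_pk k)).
apply: (hcancelr hk'' (hty_comp (hty_rw ⌊s⌋ twf) (hty_pk σe))
  (hty_comp (hty_comp (hty_pk (ul UY s)) tQ) (hty_lw ⌊s⌋ twg))).
rewrite -hcompA σk -kE (hinvK (hinv_rw ⌊s⌋ hF) (hty_pk (ul UY s))).
rewrite -k'E -!hcompA (hinvK (hinv_lw ⌊s⌋ hG) (hty_pk (ur UY s))).
by have [_ _ _ ->] := hQ; rewrite (hcomp_id (hty_pk (ul UY s))).
Qed.
End OplaxUnit.

Local Open Scope bicat_scope.

(** * The calculus of the merge-bicategory of a bicategory *)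

Section IntStrict.
Variable B : bicat.
Implicit Types x y z w : B.
Let hB := bicat_is_bicat B.

Lemma tens_compl x y z (a b c : @bhom B x y) (d : @bhom B y z)
    (p : bcell a b) (q : bcell b c) :
  (p ;; q) ⊠ bid2 d = (p ⊠ bid2 d) ;; (q ⊠ bid2 d).
Proof. by rewrite -(htens_vcomp hB) (vcomp1p hB). Qed.

Lemma tens_compr x y z (d : @bhom B x y) (a b c : @bhom B y z)
    (p : bcell a b) (q : bcell b c) :
  bid2 d ⊠ (p ;; q) = (bid2 d ⊠ p) ;; (bid2 d ⊠ q).
Proof. by rewrite -(htens_vcomp hB) (vcomp1p hB). Qed.

Lemma tens_lr x y z (a c : @bhom B x y) (b d : @bhom B y z)
    (p : bcell a c) (q : bcell b d) : (p ⊠ bid2 b) ;; (bid2 c ⊠ q) = p ⊠ q.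
Proof. by rewrite -(htens_vcomp hB) (vcomp1p hB) (vcompp1 hB). Qed.

Lemma tens_rl x y z (a c : @bhom B x y) (b d : @bhom B y z)
    (p : bcell a c) (q : bcell b d) : (bid2 a ⊠ q) ;; (p ⊠ bid2 d) = p ⊠ q.
Proof. by rewrite -(htens_vcomp hB) (vcomp1p hB) (vcompp1 hB). Qed.

Lemma assocK x y z w (a : @bhom B x y) (b : bhom y z) (c : bhom z w) :
  bassoc a b c ;; bassocV a b c = bid2 _.
Proof. by case: (bassocK hB a b c). Qed.

Lemma assocVK x y z w (a : @bhom B x y) (b : bhom y z) (c : bhom z w) :
  bassocV a b c ;; bassoc a b c = bid2 _.
Proof. by case: (bassocK hB a b c). Qed.

Lemma vcancel x y (a b c : @bhom B x y) (p : bcell a b) (q : bcell b a)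
  (r : bcell a c) : p ;; q = bid2 a -> p ;; (q ;; r) = r.
Proof. by move=> e; rewrite (vcompA hB) e (vcomp1p hB). Qed.

Lemma vcancelr x y (a b c : @bhom B x y) (p : bcell a b) (q : bcell b a)
  (r : bcell c a) : p ;; q = bid2 a -> r ;; p ;; q = r.
Proof. by move=> e; rewrite -(vcompA hB) e (vcompp1 hB). Qed.

Lemma splitK x y z (Γ : npath (@bhom B) x y) (Δ : npath (@bhom B) y z) :
  split Γ Δ ;; join Γ Δ = bid2 _.
Proof.
elim: Δ => [u a|u v Δ IH a] /=; first by rewrite (vcomp1p hB).
rewrite (vcompA hB) (vcancelr _ (assocK _ _ _)) -tens_compl IH.
by rewrite (htens_id hB).
Qed.

Lemma joinK x y z (Γ : npath (@bhom B) x y) (Δ : npath (@bhom B) y z) :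
  join Γ Δ ;; split Γ Δ = bid2 _.
Proof.
elim: Δ => [u a|u v Δ IH a] /=; first by rewrite (vcomp1p hB).
rewrite (vcompA hB) -(vcompA hB (bassocV _ _ _)) -tens_compl IH.
by rewrite (htens_id hB) (vcompp1 hB) assocVK.
Qed.

(** The transport between the composites of equal sequences.  All coherence
    isomorphisms that regroup a concatenation are of this form. *)
Definition pceq x y (Γ Δ : npath (@bhom B) x y) (e : Γ = Δ) :
    bcell (lcomp Γ) (lcomp Δ) :=
  match e in _ = Δ return bcell (lcomp Γ) (lcomp Δ) with
  | erefl => bid2 (lcomp Γ)
  end.

Lemma pceq_id x y (Γ : npath (@bhom B) x y) (e : Γ = Γ) : pceq e = bid2 _.
Proof. by rewrite (Eqdep.EqdepTheory.UIP_refl _ _ e). Qed.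

Lemma pceq_snoc x y z (Γ Δ : npath (@bhom B) x y) (a : bhom y z)
  (e : Γ = Δ) (e' : snoc Γ a = snoc Δ a) : pceq e' = pceq e ⊠ bid2 a.
Proof. by subst Δ; rewrite pceq_id /= (htens_id hB). Qed.

Local Notation "⟪ p ⟫" := (@pk (int_bicat B) _ _ _ _ p).

Lemma pk_pceql x y (Γ Δ Θ : npath (@bhom B) x y) (e : Γ = Δ)
  (p : bcell (lcomp Δ) (lcomp Θ)) : ⟪ pceq e ;; p ⟫ = ⟪ p ⟫.
Proof. by case: _ / e p => p; rewrite (vcomp1p hB). Qed.

Lemma pk_pceqr x y (Γ Δ Θ : npath (@bhom B) x y) (e : Δ = Θ)
  (p : bcell (lcomp Γ) (lcomp Δ)) : ⟪ p ;; pceq e ⟫ = ⟪ p ⟫.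
Proof. by case: _ / e; rewrite (vcompp1 hB). Qed.

Lemma pk_pceqm x y (Γ Δ Δ' Θ : npath (@bhom B) x y) (e : Δ = Δ')
  (p : bcell (lcomp Γ) (lcomp Δ)) (q : bcell (lcomp Δ') (lcomp Θ)) :
  ⟪ p ;; pceq e ;; q ⟫ = (⟪ p ⟫ * ⟪ q ⟫)%hcell.
Proof. by case: _ / e q => q; rewrite (vcompp1 hB) -[RHS]pk_comp. Qed.

Section Three.
Context {x y z w : B} (Γ1 : npath (@bhom B) x y) (Γ2 : npath (@bhom B) y z)
  (Γ3 : npath (@bhom B) z w).

Definition splitL : bcell (lcomp (cat (cat Γ1 Γ2) Γ3)) _ :=
  split (cat Γ1 Γ2) Γ3 ;; (split Γ1 Γ2 ⊠ bid2 (lcomp Γ3)).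
Definition joinL : bcell _ (lcomp (cat (cat Γ1 Γ2) Γ3)) :=
  (join Γ1 Γ2 ⊠ bid2 (lcomp Γ3)) ;; join (cat Γ1 Γ2) Γ3.
Definition splitR : bcell (lcomp (cat Γ1 (cat Γ2 Γ3))) _ :=
  split Γ1 (cat Γ2 Γ3) ;; (bid2 (lcomp Γ1) ⊠ split Γ2 Γ3).
Definition joinR : bcell _ (lcomp (cat Γ1 (cat Γ2 Γ3))) :=
  (bid2 (lcomp Γ1) ⊠ join Γ2 Γ3) ;; join Γ1 (cat Γ2 Γ3).

Lemma splitLK : splitL ;; joinL = bid2 _.
Proof.
rewrite /joinL /splitL (vcompA hB) -(vcompA hB _ (split _ _ ⊠ _)) -tens_compl.
by rewrite splitK (htens_id hB) (vcompp1 hB) splitK.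
Qed.

Lemma splitRK : splitR ;; joinR = bid2 _.
Proof.
rewrite /joinR /splitR (vcompA hB) -(vcompA hB _ (bid2 _ ⊠ split _ _)) -tens_compr.
by rewrite splitK (htens_id hB) (vcompp1 hB) splitK.
Qed.

Lemma joinRK : joinR ;; splitR = bid2 _.
Proof.
rewrite /joinR /splitR (vcompA hB) -(vcompA hB _ (join _ _)) joinK.
by rewrite (vcompp1 hB) -tens_compr joinK (htens_id hB).
Qed.
End Three.

(** By induction on the last sequence: the pentagon is the inductive step. *)
Lemma splitLR x y z w (Γ1 : npath (@bhom B) x y) (Γ2 : npath (@bhom B) y z)
  (Γ3 : npath (@bhom B) z w) (e : cat Γ1 (cat Γ2 Γ3) = cat (cat Γ1 Γ2) Γ3) :
  pceq e ;; splitL Γ1 Γ2 Γ3 ;; bassoc _ _ _ = splitR Γ1 Γ2 Γ3.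
Proof.
rewrite /splitL /splitR.
elim: Γ3 e => [u a|u v Γ3 IH a] /= e.
  by rewrite pceq_id !(vcomp1p hB) (htens_id hB) (vcompp1 hB).
have e' := catA Γ1 Γ2 Γ3; rewrite (pceq_snoc e') -(htens_id hB).
rewrite tens_compr !(vcompA hB) -(vcompA hB _ (bassoc _ _ _) (split _ _ ⊠ _)).
rewrite -(bassoc_nat hB) !(vcompA hB) -!tens_compl.
rewrite -(vcompA hB _ (bassoc _ _ _) (bassoc _ _ _)) -(pentagon hB).
rewrite !(vcompA hB) -tens_compl -(vcompA hB _ (split _ _)) IH.
by rewrite tens_compl -!(vcompA hB) (vcompA hB _ (bassoc _ _ _)) (bassoc_nat hB) !(vcompA hB).
Qed.

Lemma joinLR x y z w (Γ1 : npath (@bhom B) x y) (Γ2 : npath (@bhom B) y z)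
  (Γ3 : npath (@bhom B) z w) (e : cat Γ1 (cat Γ2 Γ3) = cat (cat Γ1 Γ2) Γ3) :
  joinL Γ1 Γ2 Γ3 = bassoc _ _ _ ;; joinR Γ1 Γ2 Γ3 ;; pceq e.
Proof.
suff H : bassoc _ _ _ ;; joinR Γ1 Γ2 Γ3 ;; pceq e ;; splitL Γ1 Γ2 Γ3 = bid2 _.
  by rewrite -[RHS](vcompp1 hB) -(splitLK Γ1 Γ2 Γ3) (vcompA hB) H (vcomp1p hB).
rewrite -[LHS](vcompp1 hB) -(assocK (lcomp Γ1) (lcomp Γ2) (lcomp Γ3)).
rewrite (vcompA hB); congr (_ ;; _).
rewrite -(vcompA hB _ (splitL _ _ _)) -(vcompA hB _ (pceq _)).
by rewrite (vcompA hB (pceq _)) splitLR -(vcompA hB) joinRK (vcompp1 hB).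
Qed.

Lemma pceqK x y (Γ Δ : npath (@bhom B) x y) (e : Γ = Δ) (e' : Δ = Γ) :
  pceq e ;; pceq e' = bid2 _.
Proof. by subst Δ; rewrite !pceq_id (vcomp1p hB). Qed.

(** The common source of the three laws on repeated whiskering: in each, one or
    two of the three 2-cells are identities. *)
Lemma pk_three x y z w (Γ1 Δ1 : npath (@bhom B) x y)
    (Γ2 Δ2 : npath (@bhom B) y z) (Γ3 Δ3 : npath (@bhom B) z w)
    (p1 : bcell (lcomp Γ1) (lcomp Δ1)) (p2 : bcell (lcomp Γ2) (lcomp Δ2))
    (p3 : bcell (lcomp Γ3) (lcomp Δ3)) :
  ⟪ splitL Γ1 Γ2 Γ3 ;; (p1 ⊠ p2 ⊠ p3) ;; joinL Δ1 Δ2 Δ3 ⟫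
  = ⟪ splitR Γ1 Γ2 Γ3 ;; (p1 ⊠ (p2 ⊠ p3)) ;; joinR Δ1 Δ2 Δ3 ⟫.
Proof.
have e := catA Γ1 Γ2 Γ3; have e' := catA Δ1 Δ2 Δ3.
rewrite -(splitLR e) -!(vcompA hB) pk_pceql (vcompA hB (bassoc _ _ _)).
rewrite -(bassoc_nat hB) -[in RHS](pk_pceqr e').
by rewrite (joinLR e') !(vcompA hB).
Qed.

Lemma regroupLE x y z w (Γ : npath (@bhom B) x y) (Λ : npath (@bhom B) y z)
    (Δ : npath (@bhom B) z w) (e : cat Γ (cat Λ Δ) = cat (cat Γ Λ) Δ) :
  regroupL (osome Γ) Λ Δ = pceq e.
Proof.
have -> : regroupL (osome Γ) Λ Δ = splitR Γ Λ Δ ;; bassocV _ _ _ ;; joinL Γ Λ Δ.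
  by rewrite /splitR /joinL !(vcompA hB).
rewrite (joinLR e) (vcompA hB _ _ (pceq e)) (vcompA hB _ (bassoc _ _ _)).
rewrite (vcancelr _ (assocVK _ _ _)).
by rewrite splitRK (vcomp1p hB).
Qed.

Lemma regroupRE x y z w (Γ : npath (@bhom B) x y) (Λ : npath (@bhom B) y z)
    (Δ : npath (@bhom B) z w) (e : cat (cat Γ Λ) Δ = cat Γ (cat Λ Δ)) :
  regroupR Γ Λ (osome Δ) = pceq e.
Proof.
have -> : regroupR Γ Λ (osome Δ) = splitL Γ Λ Δ ;; bassoc _ _ _ ;; joinR Γ Λ Δ.
  by rewrite /splitL /joinR !(vcompA hB).
rewrite -[LHS](vcomp1p hB) -(pceqK e (esym e)) -(vcompA hB).
by rewrite 2!(vcompA hB (pceq (esym e))) splitLR splitRK (vcompp1 hB).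
Qed.

Lemma int_lw_ocat x y z w (Θ : opath (@bhom B) x y) (Θ' : opath (@bhom B) y z)
    (Γ Δ : npath (@bhom B) z w) (p : bcell (lcomp Γ) (lcomp Δ)) :
  ⟪ lwhisk (ocat Θ Θ') p ⟫ = ⟪ lwhisk Θ (lwhisk Θ' p) ⟫.
Proof.
case: _ / Θ' Γ Δ p => [|u Θ'] Γ Δ p //.
case: _ / Θ Θ' => [|v Θ] Θ' //=.
have := pk_three (bid2 (lcomp Θ)) (bid2 (lcomp Θ')) p.
rewrite (htens_id hB) /splitL /joinL !(vcompA hB).
rewrite -(vcompA hB _ (split Θ Θ' ⊠ _)) tens_lr -(tens_rl (split Θ Θ') p).
rewrite (vcompA hB _ (bid2 _ ⊠ p)) -(vcompA hB _ (split Θ Θ' ⊠ _)) -tens_compl.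
rewrite splitK (htens_id hB) (vcompp1 hB) => ->.
by rewrite /splitR /joinR !tens_compr !(vcompA hB).
Qed.

Lemma int_rw_ocat x y z w (Θ : opath (@bhom B) y z) (Θ' : opath (@bhom B) z w)
    (Γ Δ : npath (@bhom B) x y) (p : bcell (lcomp Γ) (lcomp Δ)) :
  ⟪ rwhisk (ocat Θ Θ') p ⟫ = ⟪ rwhisk Θ' (rwhisk Θ p) ⟫.
Proof.
case: Θ' => [|u Θ'] //.
case: _ / Θ Θ' => [|v Θ] Θ' //=.
have := pk_three p (bid2 (lcomp Θ)) (bid2 (lcomp Θ')).
rewrite (htens_id hB) /splitR /joinR !(vcompA hB).
rewrite -(vcompA hB _ (_ ⊠ split Θ Θ')) tens_rl -(tens_lr p (split Θ Θ')).
rewrite (vcompA hB _ (p ⊠ _)) -(vcompA hB _ (_ ⊠ split Θ Θ')) -tens_compr.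
rewrite splitK (htens_id hB) (vcompp1 hB) => <-.
by rewrite /splitL /joinL !tens_compl !(vcompA hB).
Qed.

Lemma int_lw_rw x y z w (Θ : opath (@bhom B) x y) (Θ' : opath (@bhom B) z w)
    (Γ Δ : npath (@bhom B) y z) (p : bcell (lcomp Γ) (lcomp Δ)) :
  ⟪ lwhisk Θ (rwhisk Θ' p) ⟫ = ⟪ rwhisk Θ' (lwhisk Θ p) ⟫.
Proof.
case: Θ' => [|u Θ'] //.
case: _ / Θ Γ Δ p => [|v Θ] Γ Δ p //=.
have := pk_three (bid2 (lcomp Θ)) p (bid2 (lcomp Θ')).
rewrite /splitL /joinL /splitR /joinR !tens_compl !tens_compr !(vcompA hB).
by move=> ->.
Qed.

Lemma int_exch x y z (Γ Γ' : npath (@bhom B) x y) (Δ Δ' : npath (@bhom B) y z)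
    (p : bcell (lcomp Γ) (lcomp Γ')) (q : bcell (lcomp Δ) (lcomp Δ')) :
  rwhisk (osome Δ) p ;; lwhisk (osome Γ') q
  = lwhisk (osome Γ) q ;; rwhisk (osome Δ') p.
Proof.
rewrite /= !(vcompA hB) -(vcompA hB _ (join _ _)) joinK (vcompp1 hB).
rewrite -(vcompA hB _ (join Γ Δ')) joinK (vcompp1 hB).
rewrite -(vcompA hB (split Γ Δ) (p ⊠ bid2 _) (bid2 _ ⊠ q)) tens_lr.
by rewrite -(vcompA hB (split Γ Δ) (bid2 _ ⊠ q) (p ⊠ bid2 _)) tens_rl.
Qed.

Lemma lwhisk_id x y z (Θ : opath (@bhom B) x y) (Γ : npath (@bhom B) y z) :
  lwhisk Θ (bid2 (lcomp Γ)) = bid2 _.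
Proof.
case: _ / Θ Γ => [|u Θ] Γ //=.
by rewrite (htens_id hB) (vcompp1 hB) splitK.
Qed.

Lemma rwhisk_id x y z (Θ : opath (@bhom B) y z) (Γ : npath (@bhom B) x y) :
  rwhisk Θ (bid2 (lcomp Γ)) = bid2 _.
Proof.
case: Θ => [|u Θ] //=.
by rewrite (htens_id hB) (vcompp1 hB) splitK.
Qed.

Lemma lwhisk_comp x y z (Θ : opath (@bhom B) x y) (Γ Δ Λ : npath (@bhom B) y z)
    (p : bcell (lcomp Γ) (lcomp Δ)) (q : bcell (lcomp Δ) (lcomp Λ)) :
  lwhisk Θ (p ;; q) = lwhisk Θ p ;; lwhisk Θ q.
Proof.
case: _ / Θ Γ Δ Λ p q => [|u Θ] Γ Δ Λ p q //=.
rewrite !(vcompA hB) -(vcompA hB _ (join _ _)) joinK (vcompp1 hB).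
by rewrite tens_compr (vcompA hB).
Qed.

Lemma rwhisk_comp x y z (Θ : opath (@bhom B) y z) (Γ Δ Λ : npath (@bhom B) x y)
    (p : bcell (lcomp Γ) (lcomp Δ)) (q : bcell (lcomp Δ) (lcomp Λ)) :
  rwhisk Θ (p ;; q) = rwhisk Θ p ;; rwhisk Θ q.
Proof.
case: Θ => [|u Θ] //=.
rewrite !(vcompA hB) -(vcompA hB _ (join _ _)) joinK (vcompp1 hB).
by rewrite tens_compl (vcompA hB).
Qed.

#[global] Instance int_strict : strict (int_bicat B).
Proof.
refine (@Strict (int_bicat B) (fun x y Γ => bid2 (lcomp Γ))
  (fun x y z Θ Γ Δ p => lwhisk Θ p) (fun x y z Θ Γ Δ p => rwhisk Θ p)
  _ _ _ lwhisk_id rwhisk_id lwhisk_comp rwhisk_comp _ _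
  int_lw_ocat int_rw_ocat int_lw_rw int_exch _ _ _ _).
- by move=> x y Γ Δ p; exact: (vcomp1p hB).
- by move=> x y Γ Δ p; exact: (vcompp1 hB).
- by move=> x y Γ Δ Θ Λ p q r; exact: (vcompA hB).
- by [].
- by [].
- by [].
- move=> x u v y Γ1 Δ2 Γ Λ Δ t s.
  case: _ / Γ1 Γ Λ t s => [|u' Γ1] Γ Λ t s.
    by rewrite -pk_comp /= (vcompp1 hB).
  exact: etrans (congr1 _ (congr1 (fun k => _ ;; k ;; _)
    (regroupLE (catA Γ1 Λ Δ2)))) (pk_pceqm _ _ _).
- move=> x u v y Δ1 Γ2 Γ Λ Δ t s.
  case: Γ2 Δ s => [|w Γ2] Δ s.
    by rewrite -pk_comp /= (vcompp1 hB).
  exact: etrans (congr1 _ (congr1 (fun k => _ ;; k ;; _)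
    (regroupRE (esym (catA Δ1 Λ Γ2))))) (pk_pceqm _ _ _).
- by [].
Defined.

End IntStrict.


(** * Units of the merge-bicategory of a bicategory *)

Section IntUnits.
Variable B : bicat.
Implicit Types x y z w : B.
Let hB := bicat_is_bicat B.

Lemma assoc_monol x y z w (a : @bhom B x y) (b : bhom y z) (c : bhom z w)
    d (p q : bcell (a ⊗ (b ⊗ c)) d) :
  bassoc a b c ;; p = bassoc a b c ;; q -> p = q.
Proof.
move=> e; rewrite -(vcancel p (assocVK a b c)) e.
by rewrite (vcancel q (assocVK a b c)).
Qed.

Lemma unit_faithfull x y (a b : @bhom B x y) (p q : bcell a b) :
  bid2 (bid1 x) ⊠ p = bid2 (bid1 x) ⊠ q -> p = q.
Proof.
move=> e; have := blun_nat hB p; rewrite e (blun_nat hB) => /esym E.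
have [_ h] := blunK hB a.
by rewrite -(vcancel p h) E (vcancel q h).
Qed.

Lemma unit_faithfulr x y (a b : @bhom B x y) (p q : bcell a b) :
  p ⊠ bid2 (bid1 y) = q ⊠ bid2 (bid1 y) -> p = q.
Proof.
move=> e; have := brun_nat hB p; rewrite e (brun_nat hB) => /esym E.
have [_ h] := brunK hB a.
by rewrite -(vcancel p h) E (vcancel q h).
Qed.

(** Kelly's lemma: whiskering with 1 is faithful, and after it the equation
    follows from the pentagon for (1,1,a,b) and two triangles. *)
Lemma blun_tens x y z (a : @bhom B x y) (b : bhom y z) :
  bassoc (bid1 x) a b ;; blun (a ⊗ b) = blun a ⊠ bid2 b.
Proof.
apply: unit_faithfull; rewrite tens_compr.
set I := bid1 x.
apply: (@assoc_monol _ _ _ _ I (I ⊗ a) b).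
have [h1 h2] := bassocK hB I I a.
have K : (bassocV I I a ⊠ bid2 b) ;; (bassoc I I a ⊠ bid2 b) = bid2 _.
  by rewrite -tens_compl h2 (htens_id hB).
rewrite -[LHS](vcancel _ K) -[RHS](vcancel _ K); congr (_ ;; _).
rewrite !(vcompA hB) (pentagon hB) -(vcompA hB) triangle // -[in RHS](vcompA hB).
rewrite -(bassoc_nat hB) (vcompA hB) -tens_compl (triangle hB).
by rewrite (bassoc_nat hB) (htens_id hB).
Qed.

Lemma brun_tens x y z (a : @bhom B x y) (b : bhom y z) :
  bassoc a b (bid1 z) ;; (bid2 a ⊠ brun b) = brun (a ⊗ b).
Proof.
apply: unit_faithfulr; rewrite tens_compl.
set I := bid1 z.
have h0 : (brun (a ⊗ b) ⊠ bid2 I)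
    = bassoc (a ⊗ b) I I ;; (bid2 (a ⊗ b) ⊠ blun I) by rewrite (triangle hB).
have E : bassoc a b (I ⊗ I) ;; (bid2 a ⊠ (bid2 b ⊠ blun I))
    = (bid2 (a ⊗ b) ⊠ blun I) ;; bassoc a b I.
  by rewrite -(bassoc_nat hB) (htens_id hB).
have [h1 h2] := bassocK hB a b I.
rewrite -[LHS](vcancelr _ h1) -[RHS](vcancelr _ h1); congr (_ ;; _).
rewrite h0 -[in RHS](vcompA hB) -E (vcompA hB) -(pentagon hB).
rewrite -(vcompA hB _ (bid2 a ⊠ bassoc _ _ _)) -tens_compr (triangle hB).
by rewrite -!(vcompA hB) (bassoc_nat hB).
Qed.
End IntUnits.

Section IntStructure.
Variable B : bicat.
Implicit Types x y z w : B.
Let hB := bicat_is_bicat B.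

Lemma rwhisk1 x y z (Γ Δ : npath (@bhom B) x y) (a : bhom y z)
    (p : bcell (lcomp Γ) (lcomp Δ)) : rwhisk ⌊a⌋ p = p ⊠ bid2 a.
Proof. by rewrite /= (vcomp1p hB) (vcompp1 hB). Qed.

Lemma lwhisk_one x y z (Θ : npath (@bhom B) x y) (a b : bhom y z)
    (p : bcell a b) :
  @lwhisk B x y z (osome Θ) (one a) (one b) p = bid2 (lcomp Θ) ⊠ p.
Proof. by rewrite /= (vcomp1p hB) (vcompp1 hB). Qed.

Lemma int_lunit x y (Γ : npath (@bhom B) x y) :
  @lunit_seq (int_bicat B) _ (@bid1 B) (@blun B) x y Γ
  = split (one (bid1 x)) Γ ;; blun (lcomp Γ).
Proof.
elim: Γ => [z a|z w Γ IH a]; first by rewrite /= (vcomp1p hB).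
rewrite [LHS](_ : _ = @rwhisk B x z w ⌊a⌋ (cat (one (bid1 x)) Γ) Γ
  (@lunit_seq (int_bicat B) _ (@bid1 B) (@blun B) x z Γ)) // rwhisk1 IH.
rewrite tens_compl /= -(vcompA hB _ (bassoc _ _ _)).
by rewrite blun_tens.
Qed.

Lemma int_runit x y (Γ : npath (@bhom B) x y) :
  @runit_seq (int_bicat B) _ (@bid1 B) (@brun B) x y Γ = brun (lcomp Γ).
Proof.
case: Γ => [z a|z w Γ a] //.
rewrite [LHS](_ : _ = @lwhisk B x z w (osome Γ)
  (snoc (one a) (bid1 w)) (one a) (brun a)) //=.
by rewrite (htens_id hB) (vcomp1p hB) (vcompp1 hB) brun_tens.
Qed.

Definition int_units : units (int_bicat B).
Proof.
refine (@Units (int_bicat B) _ (@bid1 B) (@blun B) (@brun B) _ _ _ _ _).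
- by move=> x y a; exists (blunV a); exact: (blunK hB a).
- by move=> x y a; exists (brunV a); exact: (brunK hB a).
- move=> x y Γ Δ p; rewrite !int_lunit.
  suff E : @lwhisk B _ _ _ ⌊bid1 x⌋ Γ Δ p ;; (split (one (bid1 x)) Δ ;; blun (lcomp Δ))
      = split (one (bid1 x)) Γ ;; blun (lcomp Γ) ;; p by exact: E.
  rewrite /= !(vcompA hB) -(vcompA hB _ (join _ _)) joinK.
  by rewrite (vcompp1 hB) -!(vcompA hB) (blun_nat hB).
- move=> x y Γ Δ p; rewrite !int_runit.
  exact: etrans (congr1 (fun q => q ;; _) (rwhisk1 _ p)) (brun_nat hB p).
- move=> x y z a b.
  rewrite [LHS](rwhisk1 (Γ := snoc (one a) (bid1 y)) (Δ := one a)) /=.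
  by rewrite (htens_id hB) (vcomp1p hB) (vcompp1 hB) (triangle hB).
Defined.

(** In ∫B the 2-cells (a,b) -> (a⊗b) are the endomorphisms of a⊗b. *)
Definition int_tensors : tensors (int_bicat B).
Proof.
refine (@Tensors (int_bicat B) _ (@tens B) (fun x y z a b => bid2 (a ⊗ b)) _).
by move=> x y z a b; exists (bid2 (a ⊗ b)); split; exact: (vcomp1p hB).
Defined.

End IntStructure.

Section IntFunctor.
Variables (B C : bicat) (f : psfunctor B C).
Implicit Types x y z w : B.
Let hB := bicat_is_bicat B.
Let hC := bicat_is_bicat C.
Let hf := psf_is_psf f.

Lemma FtK1 x y z (a : @bhom B x y) (b : bhom y z) :
  Ft f a b ;; FtV f a b = bid2 _.
Proof. by case: (FtK hf a b). Qed.

Lemma FtVK x y z (a : @bhom B x y) (b : bhom y z) :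
  FtV f a b ;; Ft f a b = bid2 _.
Proof. by case: (FtK hf a b). Qed.

Lemma FseqK x y (Γ : npath (@bhom B) x y) : Fseq f Γ ;; FseqV f Γ = bid2 _.
Proof.
elim: Γ => [z a|z w Γ IH a] /=; first by rewrite (vcomp1p hC).
rewrite (vcompA hC) (vcancelr _ (FtK1 _ _)) -tens_compl IH.
by rewrite (htens_id hC).
Qed.

Lemma FseqVK x y (Γ : npath (@bhom B) x y) : FseqV f Γ ;; Fseq f Γ = bid2 _.
Proof.
elim: Γ => [z a|z w Γ IH a] /=; first by rewrite (vcomp1p hC).
rewrite (vcompA hC) -(vcompA hC (FtV _ _ _)) -tens_compl IH.
by rewrite (htens_id hC) (vcompp1 hC) FtVK.
Qed.

(** Compatibility of f_{a,b} with associators, extended to sequences. *)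
Lemma Fseq_split x y z (Θ : npath (@bhom B) x y) (Γ : npath (@bhom B) y z)
    (e : npmap (@F1 _ _ f) (cat Θ Γ)
       = cat (npmap (@F1 _ _ f) Θ) (npmap (@F1 _ _ f) Γ)) :
  pceq e ;; split (npmap (@F1 _ _ f) Θ) (npmap (@F1 _ _ f) Γ)
    ;; (Fseq f Θ ⊠ Fseq f Γ) ;; Ft f (lcomp Θ) (lcomp Γ)
  = Fseq f (cat Θ Γ) ;; F2 f (split Θ Γ).
Proof.
elim: Γ e => [u a|u v Γ IH a] /= e.
  by rewrite pceq_id !(vcomp1p hC) (F2_id hf) (vcompp1 hC).
have e' := npmap_cat (@F1 _ _ f) Θ Γ; rewrite (pceq_snoc e').
rewrite (F2_vcomp hf) !(vcompA hC) -(vcompA hC _ (Ft f _ a)) -(Ft_nat hf).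
rewrite (F2_id hf) !(vcompA hC) -[in RHS]tens_compl -IH.
rewrite [in RHS]tens_compl -[in RHS](vcompA hC) -[in RHS](vcompA hC).
rewrite (vcompA hC (Ft f _ _ ⊠ _)) (Ft_assoc hf) !(vcompA hC) tens_compl.
rewrite -[in RHS](vcompA hC _ ((Fseq f Θ ⊠ Fseq f Γ) ⊠ _)) (bassoc_nat hC).
rewrite tens_compl !(vcompA hC); congr (_ ;; _).
rewrite -[in RHS](vcompA hC _ (_ ⊠ _) (bid2 _ ⊠ _)).
by rewrite -[X in _ = _ ;; X](htens_vcomp hC) (vcompp1 hC).
Qed.

Lemma FseqV_join x y z (Θ : npath (@bhom B) x y) (Γ : npath (@bhom B) y z)
    (e : cat (npmap (@F1 _ _ f) Θ) (npmap (@F1 _ _ f) Γ)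
       = npmap (@F1 _ _ f) (cat Θ Γ)) :
  F2 f (join Θ Γ) ;; FseqV f (cat Θ Γ)
  = FtV f (lcomp Θ) (lcomp Γ) ;; (FseqV f Θ ⊠ FseqV f Γ)
    ;; join (npmap (@F1 _ _ f) Θ) (npmap (@F1 _ _ f) Γ) ;; pceq e.
Proof.
have /esym E := Fseq_split (esym e).
set b1 := RHS.
suff K : Fseq f (cat Θ Γ) ;; F2 f (split Θ Γ) ;; b1 = bid2 _.
  rewrite -[LHS](vcompp1 hC) -K !(vcompA hC).
  rewrite -(vcompA hC _ (FseqV _ _)) FseqVK (vcompp1 hC) -(F2_vcomp hf) joinK.
  by rewrite (F2_id hf) (vcomp1p hC).
rewrite E /b1 !(vcompA hC) (vcancelr _ (FtK1 _ _)).
rewrite -(vcompA hC _ (Fseq _ _ ⊠ _)) -(htens_vcomp hC) !FseqK (htens_id hC).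
by rewrite (vcompp1 hC) (vcancelr _ (splitK _ _)) pceqK.
Qed.

Lemma pk_int_fun_tens x y z (Θ Θ' : npath (@bhom B) x y)
    (Γ Γ' : npath (@bhom B) y z) (p : bcell (lcomp Θ) (lcomp Θ'))
    (q : bcell (lcomp Γ) (lcomp Γ')) :
  @pk (int_bicat C) _ _ _ _ (@m2 _ _ (int_fun f) _ _ (cat Θ Γ) (cat Θ' Γ')
      (split Θ Γ ;; (p ⊠ q) ;; join Θ' Γ'))
  = @pk (int_bicat C) _ _
      (cat (npmap (@F1 _ _ f) Θ) (npmap (@F1 _ _ f) Γ))
      (cat (npmap (@F1 _ _ f) Θ') (npmap (@F1 _ _ f) Γ'))
      (split _ _ ;; (@m2 _ _ (int_fun f) _ _ Θ Θ' p
                     ⊠ @m2 _ _ (int_fun f) _ _ Γ Γ' q) ;; join _ _).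
Proof.
have e := npmap_cat (@F1 _ _ f) Θ Γ; have e' := npmap_cat (@F1 _ _ f) Θ' Γ'.
rewrite [X in pk X](_ : _ = pceq e ;; (split _ _ ;;
  (@m2 _ _ (int_fun f) _ _ Θ Θ' p ⊠ @m2 _ _ (int_fun f) _ _ Γ Γ' q)
  ;; join _ _ ;; pceq (esym e'))); first by rewrite pk_pceql pk_pceqr.
rewrite [LHS]/= !(F2_vcomp hf) !(vcompA hC) -(Fseq_split e).
rewrite -(vcompA hC _ (Ft f _ _)) -(Ft_nat hf) (vcompA hC).
rewrite -[LHS](vcompA hC) (FseqV_join (esym e')) !(vcompA hC).
rewrite (vcancelr _ (FtK1 _ _)) /= !(htens_vcomp hC).
by rewrite !(vcompA hC).
Qed.

Lemma int_fun_id x y (Γ : npath (@bhom B) x y) :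
  @m2 _ _ (int_fun f) _ _ Γ Γ (bid2 (lcomp Γ)) = bid2 _.
Proof. by rewrite /= (F2_id hf) (vcompp1 hC) FseqK. Qed.

Lemma int_pfun : pfun (int_fun f).
Proof.
split.
- exact: int_fun_id.
- move=> x y Γ Δ Θ p q; 
  change (Fseq f Γ ;; F2 f (p ;; q) ;; FseqV f Θ
    = (Fseq f Γ ;; F2 f p ;; FseqV f Δ) ;; (Fseq f Δ ;; F2 f q ;; FseqV f Θ)).
  rewrite (F2_vcomp hf) !(vcompA hC) -(vcompA hC _ (FseqV _ _)) FseqVK.
  by rewrite (vcompp1 hC).
- move=> x y z Θ Γ Δ p; have := pk_int_fun_tens (bid2 (lcomp Θ)) p.
  by rewrite int_fun_id => E; exact: E.
- move=> x y z Θ Γ Δ p; have := pk_int_fun_tens p (bid2 (lcomp Θ)).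
  by rewrite int_fun_id => E; exact: E.
Qed.

End IntFunctor.

Lemma bij_between_iff (T T' : Type) (φ : T -> T') (ψ : T' -> T)
    (P : T -> Prop) (Q : T' -> Prop) :
  cancel φ ψ -> cancel ψ φ -> (forall t, P t <-> Q (φ t)) -> bij_between φ P Q.
Proof.
move=> φK ψK PQ; split=> [t /PQ //|t' Qt'].
exists (ψ t'); split=> [|t [_ <-]]; last by rewrite φK.
by split; [apply/PQ|]; rewrite ψK.
Qed.

(** * Transformations and modifications of bicategories *)

Section IntTrans.
Variables (B C : bicat) (f g : psfunctor B C).
Let hB := bicat_is_bicat B.
Let hC := bicat_is_bicat C.
Let hf := psf_is_psf f.
Let hg := psf_is_psf g.

Definition int_transV (τ : mtrans (int_fun f) (int_fun g)) : btrans f g :=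
  @BTrans B C f g τ (@mt1 _ _ _ _ τ).

Variable σ : btrans f g.
Local Notation σ' := (int_trans σ).
Local Notation "⟪ p ⟫" := (@pk (int_bicat C) _ _ _ _ p).

Lemma int_nat_one (x y : B) (a b : bhom x y) (p : bcell a b) :
  @nat_at _ _ _ _ _ σ' x y (one a) (one b) p <->
  (F2 f p ⊠ bid2 (σ y)) ;; bt1 σ b = bt1 σ a ;; (bid2 (σ x) ⊠ F2 g p).
Proof.
rewrite nat_atE.
have El : @rw (int_bicat C) _ _ _ _ ⌊σ y⌋ _ _ (@m2 _ _ (int_fun f) x y (one a) (one b) p)
    = F2 f p ⊠ bid2 (σ y).
  by rewrite [LHS]rwhisk1 /= (vcomp1p hC) (vcompp1 hC).
have Er : @lw (int_bicat C) _ _ _ _ ⌊σ x⌋ _ _ (@m2 _ _ (int_fun g) x y (one a) (one b) p)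
    = bid2 (σ x) ⊠ F2 g p.
  by rewrite [LHS]lwhisk_one /= (vcomp1p hC) (vcompp1 hC).
by rewrite El Er.
Qed.

Lemma int_mt_seq2 (x y z : B) (a : bhom x y) (b : bhom y z) :
  mt_seq σ' (snoc (one a) b)
  = bassoc (F1 f a) (F1 f b) (σ z) ;; (bid2 (F1 f a) ⊠ bt1 σ b)
    ;; bassocV (F1 f a) (σ y) (F1 g b) ;; (bt1 σ a ⊠ bid2 (F1 g b)).
Proof.
rewrite /= !(htens_id hC) !(vcomp1p hC) !(vcompp1 hC).
by rewrite assocK (vcompp1 hC).
Qed.

Lemma int_nat_tens (x y z : B) (a : bhom x y) (b : bhom y z) :
  nat_at σ' (tn (int_tensors B) a b) <->
  (Ft f a b ⊠ bid2 (σ z)) ;; bt1 σ (a ⊗ b)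
    = bassoc (F1 f a) (F1 f b) (σ z) ;; (bid2 (F1 f a) ⊠ bt1 σ b)
        ;; bassocV (F1 f a) (σ y) (F1 g b) ;; (bt1 σ a ⊠ bid2 (F1 g b))
        ;; bassoc (σ x) (F1 g a) (F1 g b) ;; (bid2 (σ x) ⊠ Ft g a b).
Proof.
rewrite nat_atE.
have El : @rw (int_bicat C) _ _ _ _ ⌊σ z⌋ _ _ (m2 (int_fun f) (tn (int_tensors B) a b))
    = Ft f a b ⊠ bid2 (σ z).
  rewrite [LHS](rwhisk1 (Γ := snoc (one _) _) (Δ := one _)) /=.
  by rewrite (htens_id hC) (F2_id hf) (vcomp1p hC) !(vcompp1 hC).
have Er : @lw (int_bicat C) _ _ _ _ ⌊σ x⌋ _ _ (m2 (int_fun g) (tn (int_tensors B) a b))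
    = bassoc (σ x) (F1 g a) (F1 g b) ;; (bid2 (σ x) ⊠ Ft g a b).
  rewrite [LHS]/= !(htens_id hC) (F2_id hg) !(vcomp1p hC) !(vcompp1 hC).
  by [].
rewrite El Er int_mt_seq2; split=> E.
  by apply: etrans E _; rewrite -[RHS](vcompA hC).
by apply: etrans E _; rewrite -[LHS](vcompA hC).
Qed.

Lemma int_moplaxP : is_moplax σ' <->
  (forall (x y : B) (a b : bhom x y) (p : bcell a b),
    (F2 f p ⊠ bid2 (σ y)) ;; bt1 σ b = bt1 σ a ;; (bid2 (σ x) ⊠ F2 g p)) /\
  (forall (x y z : B) (a : bhom x y) (b : bhom y z),
    (Ft f a b ⊠ bid2 (σ z)) ;; bt1 σ (a ⊗ b)
    = bassoc (F1 f a) (F1 f b) (σ z) ;; (bid2 (F1 f a) ⊠ bt1 σ b)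
        ;; bassocV (F1 f a) (σ y) (F1 g b) ;; (bt1 σ a ⊠ bid2 (F1 g b))
        ;; bassoc (σ x) (F1 g a) (F1 g b) ;; (bid2 (σ x) ⊠ Ft g a b)).
Proof.
split=> [/is_moplaxP N|[H1 H2]].
  by split=> *; [apply/int_nat_one | apply/int_nat_tens]; exact: N.
apply: (moplax_gen (int_pfun f) (int_pfun g) (T := int_tensors B)) => *.
  exact/int_nat_one.
exact/int_nat_tens.
Qed.

Lemma int_unit_iso (h : psfunctor B C) (x : B) :
  @iso2 (int_bicat C) _ _ _ (one (bid1 (h x))) (one (F1 h (bid1 x))) (Fu h x).
Proof. exact: (FuK (psf_is_psf h) x). Qed.

Lemma int_unitE (h : psfunctor B C) (x : B) :
  let w : @mcell (int_bicat C) _ _ (one (uob (int_units C) (h x)))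
            (one (F1 h (bid1 x))) := Fu h x in
  (pk w ◁ ⌊F1 h (bid1 x)⌋ * pk (m2 (int_fun h) (ul (int_units B) (bid1 x)))
  = pk (ul (int_units C) (F1 h (bid1 x))))%hcell.
Proof.
move=> w; rewrite -pk_rw -(pk_comp (rw _ w)); congr pk.
have E : m2 (int_fun h) (ul (int_units B) (bid1 x))
    = Ft h (bid1 x) (bid1 x) ;; F2 h (blun (bid1 x)).
  by rewrite /= (htens_id hC) (vcomp1p hC) (vcompp1 hC).
rewrite E; apply: etrans (Fu_left (psf_is_psf h) (bid1 x)).
rewrite -[RHS](vcompA hC).
exact: (congr1 (fun q => q ;; _)
  (rwhisk1 (Γ := one _) (Δ := one _) (F1 h (bid1 x)) (Fu h x))).
Qed.

Lemma int_unit_eq x :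
  ((Fu f x ⊠ bid2 (σ x)) ;; bt1 σ (bid1 x)
    = blun (σ x) ;; brunV (σ x) ;; (bid2 (σ x) ⊠ Fu g x)) <->
  ((@pk (int_bicat C) _ _ (one _) (one _) (Fu f x)) ◁ ⌊σ x⌋ * pk (mt1 σ' (bid1 x))
   = pk (ul (int_units C) (σ x))
     * @pk (int_bicat C) _ _ (one _) (snoc (one _) _) (brunV (σ x))
     * ⌊σ x⌋ ▷ (@pk (int_bicat C) _ _ (one _) (one _) (Fu g x)))%hcell.
Proof.
rewrite -pk_rw -pk_lw -!pk_comp.
have El : @rw (int_bicat C) _ _ _ _ ⌊σ x⌋ (one _) (one _) (Fu f x)
    = Fu f x ⊠ bid2 (σ x) by exact: rwhisk1.
have Er : @lw (int_bicat C) _ _ _ _ ⌊σ x⌋ (one _) (one _) (Fu g x)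
    = bid2 (σ x) ⊠ Fu g x by exact: lwhisk_one.
by rewrite El Er; split=> [E|/pk_inj]; [congr pk|].
Qed.

Lemma int_equiv1 (h : psfunctor B C) x y (e : @bhom B x y) :
  equiv1 (int_units B) e -> equiv1 (int_units C) (F1 h e).
Proof.
apply: (pf_equiv1 (int_pfun h)) => z.
by exists (Fu h z); exact: int_unit_iso.
Qed.

(** The unit axiom is traded for the invertibility of σ at units. *)
Lemma int_boplaxP :
  is_boplax σ <-> is_moplax σ' /\ forall x, is_iso2 (bt1 σ (bid1 x)).
Proof.
have hr x := brunK hC (σ x).
split=> [[n1 n2 nu]|[hm h1]].
  split=> [|x]; first by apply/int_moplaxP.
  have /int_unit_eq E := nu x.
  apply: (proj2 (hisoP (mt1 σ' (bid1 x)))).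
  have hl := proj1 (hisoP _) (int_unit_iso f x).
  apply: (hiso_compl (hiso_rw ⌊σ x⌋ hl) (hty_pk _)); rewrite E.
  apply: (hiso_comp (Δ := cat_on ⌊σ x⌋ (one (bid1 (g x))))).
    apply: (hiso_comp (Δ := one (σ x))).
      exact/hisoP/ul_iso.
    apply/hisoP; exists (brun (σ x)); case: (hr x) => *; by split.
  exact: (hiso_lw ⌊σ x⌋ (proj1 (hisoP _) (int_unit_iso g x))).
have [n1 n2] := proj1 int_moplaxP hm; split=> // x.
have hQ : hinv (pk (ur (int_units C) (σ x)))
    (@pk (int_bicat C) _ _ (one _) (snoc (one _) _) (brunV (σ x)))
    (snoc (one (σ x)) (uob (int_units C) (g x))) (one (σ x)).
  have [e1 e2] := hr x; split; try exact: hty_pk.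
    by rewrite -pk_comp; congr pk.
  by rewrite -pk_comp; congr pk.
apply/int_unit_eq.
exact: (@oplax_unit (int_bicat B) (int_bicat C) _ _ (int_units B) (int_units C)
  (int_fun f) (int_fun g) (int_pfun g) σ' x (Fu f x) (Fu g x) (int_unit_iso f x)
  (int_unit_iso g x) (int_unitE f x) (int_unitE g x) _ hm (h1 x) hQ).
Qed.

Lemma int_equivP x x' (e : @bhom C x x') : universal1 (X := int_bicat C) e <-> is_equiv1 e.
Proof. exact: (universal1P (int_units C) (int_tensors C)). Qed.

Lemma int_fairP : is_boplax σ <-> is_fair σ'.
Proof.
have := @is_fairP _ _ _ _ _ _ (int_pfun f) (int_pfun g) σ' (int_units B)
  (int_units C) (int_tensors B) (@int_equiv1 f) (@int_equiv1 g).
by move=> E; apply: iff_trans int_boplaxP (iff_sym E).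
Qed.

Lemma int_pseudoP : is_bpseudo σ <-> is_mpseudo σ'.
Proof.
split=> [[/int_boplaxP [hm _] hi]|[hm hi]].
  by split=> // x y a; apply/universal2P; exact: hi.
have {}hi x y (a : @bhom B x y) : is_iso2 (bt1 σ a).
  exact: (proj1 (universal2P (mt1 σ' a)) (hi _ _ a)).
by split=> //; apply/int_boplaxP.
Qed.

Lemma int_mequivP : is_bequiv σ <-> is_mequiv σ'.
Proof.
split=> [[/int_pseudoP [hm hi] he]|[hm hi he]].
  by split=> // x; apply/int_equivP; exact: he.
by split=> [|x]; [apply/int_pseudoP | apply/int_equivP; exact: he].
Qed.

End IntTrans.

Section IntMod.
Variables (B C : bicat).
Let hC := bicat_is_bicat C.

Local Notation F := (fun h : psfunctor B C => int_fun h).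
Local Notation tr :=
  (fun (h k : psfunctor B C) (σ : oplax_quiver h k) => int_trans (oplax_tr σ)).

(** The pasting of ∫ differs from the composite of transformations only by the
    coherence isomorphism that detaches the first 1-cell of its domain. *)
Lemma int_mts1 (f g : psfunctor B C) (Σ : npath (@oplax_quiver B C) f g)
    (x y : B) (a : bhom x y) :
  @mts1 (int_bicat B) (int_bicat C) _ _ F tr f g Σ x y a
  = split (one (F1 f a)) (bts0 (@oplax_tr B C) Σ y)
    ;; @bts1 B C _ _ _ (@oplax_tr B C) f g Σ x y a.
Proof.
elim: Σ => [k σ|k l Σ IH σ]; first by rewrite /= (vcomp1p hC).
rewrite /= [mts1 _ _ _]IH !(htens_id hC) !(vcomp1p hC) !(vcompp1 hC).
rewrite tens_compl !(vcompA hC) (vcancelr _ (assocK _ _ _)).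
by rewrite [in RHS](vcancelr _ (assocK _ _ _)).
Qed.

Lemma int_modP (f g : psfunctor B C) (Σ T : npath (@oplax_quiver B C) f g)
    (μ : forall x : B, bcell (bcomposite (@oplax_tr B C) Σ x)
                             (bcomposite (@oplax_tr B C) T x)) :
  is_bmod μ <-> @is_mmod (int_bicat B) (int_bicat C) _ _ F tr f g Σ T μ.
Proof.
have E x y (a : @bhom B x y) :
    @lwhisk C _ _ _ ⌊F1 f a⌋ (mts0 tr Σ y) (mts0 tr T y) (μ y)
      ;; @mts1 (int_bicat B) (int_bicat C) _ _ F tr f g T x y a
    = @mts1 (int_bicat B) (int_bicat C) _ _ F tr f g Σ x y a ;; bid2 _
      ;; @rwhisk C _ _ _ ⌊F1 g a⌋ (mts0 tr Σ x) (mts0 tr T x) (μ x) <->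
    bt1 (bcomposite (@oplax_tr B C) Σ) a ;; (μ x ⊠ bid2 (F1 g a))
    = (bid2 (F1 f a) ⊠ μ y) ;; bt1 (bcomposite (@oplax_tr B C) T) a.
  rewrite !int_mts1 (vcompp1 hC) rwhisk1 /= !(vcompA hC).
  rewrite -(vcompA hC _ (join _ _)) joinK (vcompp1 hC) -!(vcompA hC).
  split=> [H|->] //.
  rewrite -(vcancel (_ ;; (μ x ⊠ _)) (joinK (one (F1 f a)) (mts0 tr Σ y))).
  by rewrite -[X in _ ;; X]H (vcancel _ (joinK _ _)).
by split=> H x y a; [apply: (proj2 (E _ _ a)) | apply: (proj1 (E _ _ a))];
   exact: H.
Qed.
End IntMod.


(** * The calculus of a representable merge-bicategory *)

Section Wires.

Definition ports (c o n : nat) : seq port := [seq (c, k) | k <- iota o n].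

Lemma size_ports c o n : size (ports c o n) = n.
Proof. by rewrite size_map size_iota. Qed.

Lemma portsD c o m n : ports c o (m + n) = (ports c o m ++ ports c (o + m) n)%SEQ.
Proof. by rewrite /ports iotaD map_cat. Qed.

Lemma take_ports c o n s : take n (ports c o n ++ s) = ports c o n.
Proof. by rewrite take_size_cat ?size_ports. Qed.

Lemma drop_ports c o n s : drop n (ports c o n ++ s) = s.
Proof. by rewrite drop_size_cat ?size_ports. Qed.

Lemma take_all_ports c o n : take n (ports c o n) = ports c o n.
Proof. by rewrite take_oversize ?size_ports. Qed.

Lemma drop_all_ports c o n : drop n (ports c o n) = [::].
Proof. by rewrite drop_oversize ?size_ports. Qed.

Lemma takeD_ports c o m n s :
  take (m + n) (ports c o m ++ s) = (ports c o m ++ take n s)%SEQ.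
Proof.
by rewrite take_cat size_ports ltnNge leq_addr /= addKn.
Qed.

Lemma dropD_ports c o m n s : drop (m + n) (ports c o m ++ s) = drop n s.
Proof. by rewrite drop_cat size_ports ltnNge leq_addr /= addKn. Qed.

Lemma zip_ports c o c' o' n s s' :
  zip (ports c o n ++ s) (ports c' o' n ++ s')
  = (zip (ports c o n) (ports c' o' n) ++ zip s s')%SEQ.
Proof. by rewrite zip_cat // !size_ports. Qed.

Lemma singleE c n m :
  single c n m = Diagram (ports c 0 n) (ports c 0 m) [::].
Proof. by []. Qed.

End Wires.

(* Compares the wires of two pastings: the ports are cut into the consecutive
   blocks given by the concatenations, where take, drop and zip compute, and the
   remaining unions of blocks are compared as sets. *)
Ltac same_wires :=
  cbv beta iota zeta delta [gpos];
  rewrite ?(nlen_cat, nlen_cat_on, nlen_cat_no, olen_ocat);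
  cbn [olen];
  rewrite !singleE; cbv beta iota delta [paste wires ins outs];
  rewrite ?(add0n, addn0) -?addnA ?portsD ?(add0n, cat0s) -?seq.catA
    ?(take0, drop0, take_ports, drop_ports, take_all_ports,
      drop_all_ports, takeD_ports, dropD_ports, cats0, cat0s, addn0);
  rewrite ?zip_ports;
  move=> ?; rewrite ?mem_cat; by do ?case: (_ \in _).

Section RepStrict.
Variable Y : rep_mbicat.
Implicit Types x y z w : Y.
Let hY := rep_is_mbicat Y.

Lemma unit2P x y (Γ : npath (@mhom Y) x y) : is_unit (unit2 Γ).
Proof. exact: choose_exP. Qed.

(** Whiskering on both sides is merging with the unit on the resulting
    sequence. *)
Definition whisker x u v y (Γ1 : opath (@mhom Y) x u) (Γ2 : opath (@mhom Y) v y)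
  (Γ Λ : npath (@mhom Y) u v) (t : mcell Γ Λ) :
  mcell (cat_on Γ1 (cat_no Γ Γ2)) (cat_on Γ1 (cat_no Λ Γ2)) :=
  plug Γ1 Γ2 t (unit2 _).

Lemma rep_comp1p x y (Γ Δ : npath (@mhom Y) x y) (p : mcell Γ Δ) :
  comp (unit2 Γ) p = p.
Proof. exact: (proj1 (unit2P Γ) _ _ _ _ (Glue (LG onil) (RG onil) _ _ _)). Qed.

Lemma rep_compp1 x y (Γ Δ : npath (@mhom Y) x y) (p : mcell Γ Δ) :
  comp p (unit2 Δ) = p.
Proof. exact: (proj2 (unit2P Δ) _ _ _ _ (Glue (LG onil) (RG onil) _ _ _)). Qed.

Lemma whisker_unit x u v y (Γ1 : opath (@mhom Y) x u) (Γ2 : opath (@mhom Y) v y)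
  (Γ : npath (@mhom Y) u v) : whisker Γ1 Γ2 (unit2 Γ) = unit2 _.
Proof. exact: (proj1 (unit2P Γ) _ _ _ _ (Glue (LG Γ1) (RG Γ2) _ _ _)). Qed.

Lemma plug_comp x u v y (Γ1 : opath (@mhom Y) x u)
    (Γ2 : opath (@mhom Y) v y) (Γ Λ : npath (@mhom Y) u v)
    (Δ Θ : npath (@mhom Y) x y) (t : mcell Γ Λ)
    (s : mcell (cat_on Γ1 (cat_no Λ Γ2)) Δ) (q : mcell Δ Θ) :
  comp (plug Γ1 Γ2 t s) q = plug Γ1 Γ2 t (comp s q).
Proof.
apply: (mrg_assoc hY t s q (Glue (LG Γ1) (RG Γ2) _ _ _)
  (Glue (LG onil) (RG onil) _ _ _) (Glue (LG onil) (RG onil) _ _ _)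
  (Glue (LG Γ1) (RG Γ2) _ _ _)).
same_wires.
Qed.

Lemma plugE x u v y (Γ1 : opath (@mhom Y) x u)
    (Γ2 : opath (@mhom Y) v y) (Γ Λ : npath (@mhom Y) u v)
    (Δ : npath (@mhom Y) x y) (t : mcell Γ Λ)
    (s : mcell (cat_on Γ1 (cat_no Λ Γ2)) Δ) :
  plug Γ1 Γ2 t s = comp (whisker Γ1 Γ2 t) s.
Proof. by rewrite plug_comp rep_comp1p. Qed.

Lemma plug_plug x u v y (Γ1 : opath (@mhom Y) x u)
    (Γ2 : opath (@mhom Y) v y) (Γ Λ Θ : npath (@mhom Y) u v)
    (Δ : npath (@mhom Y) x y) (t : mcell Γ Λ) (s : mcell Λ Θ)
    (q : mcell (cat_on Γ1 (cat_no Θ Γ2)) Δ) :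
  plug Γ1 Γ2 (comp t s) q = plug Γ1 Γ2 t (plug Γ1 Γ2 s q).
Proof.
apply: (mrg_assoc hY t s q (Glue (LG onil) (RG onil) _ _ _)
  (Glue (LG Γ1) (RG Γ2) _ _ _) (Glue (LG Γ1) (RG Γ2) _ _ _)
  (Glue (LG Γ1) (RG Γ2) _ _ _)).
same_wires.
Qed.

Lemma whisker_comp x u v y (Γ1 : opath (@mhom Y) x u)
    (Γ2 : opath (@mhom Y) v y) (Γ Λ Θ : npath (@mhom Y) u v)
    (t : mcell Γ Λ) (s : mcell Λ Θ) :
  whisker Γ1 Γ2 (comp t s) = comp (whisker Γ1 Γ2 t) (whisker Γ1 Γ2 s).
Proof. by rewrite /whisker plug_plug plugE. Qed.

(** Concatenations that are equal only propositionally are absorbed in the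
    boundaries of a [glue]; here A and Ξ are variables so that the equations can
    be substituted. *)
Lemma glue_whisker x u v y (Γ1 : opath (@mhom Y) x u) (Γ2 : opath (@mhom Y) v y)
    (Γ Λ : npath (@mhom Y) u v) (A Ξ : npath (@mhom Y) x y) (i : mcell Ξ Ξ) :
  A = cat_on Γ1 (cat_no Γ Γ2) -> Ξ = cat_on Γ1 (cat_no Λ Γ2) -> i = unit2 Ξ ->
  exists W : glue Γ Λ Ξ Ξ A Ξ, gpos W = (0, olen Γ1, nlen Λ)%N /\
    forall t : mcell Γ Λ, pk (mrg W t i) = pk (whisker Γ1 Γ2 t).
Proof.
move=> eA eΞ ->; subst A Ξ; by exists (Glue (LG Γ1) (RG Γ2) _ _ _).
Qed.

(** By associativity the left-hand side is t merged into a whiskered unit, which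
    is a unit. *)
Lemma whisker_whisker x' x u v y y' (Γ1 : opath (@mhom Y) x' x) (Γ2 : opath (@mhom Y) y y')
    (Θ1 : opath (@mhom Y) x u) (Θ2 : opath (@mhom Y) v y)
    (Γ Λ : npath (@mhom Y) u v) (t : mcell Γ Λ) :
  pk (whisker Γ1 Γ2 (whisker Θ1 Θ2 t)) = pk (whisker (ocat Γ1 Θ1) (ocat Θ2 Γ2) t).
Proof.
have e (Δ : npath (@mhom Y) u v) : cat_on Γ1 (cat_no (cat_on Θ1 (cat_no Δ Θ2)) Γ2)
    = cat_on (ocat Γ1 Θ1) (cat_no Δ (ocat Θ2 Γ2)).
  by rewrite cat_on_ocat cat_no_ocat [in RHS]cat_on_no.
have [W [WE Wt]] := glue_whisker (e Γ) (e Λ) (erefl (unit2 _)).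
rewrite -Wt; congr pk.
have <- : whisker Γ1 Γ2 (unit2 (cat_on Θ1 (cat_no Λ Θ2))) = unit2 _ by exact: whisker_unit.
apply: (mrg_assoc hY t (unit2 _) (unit2 _) (Glue (LG Θ1) (RG Θ2) _ _ _)
  (Glue (LG Γ1) (RG Γ2) _ _ _) (Glue (LG Γ1) (RG Γ2) _ _ _) W).
rewrite WE.
same_wires.
Qed.

Lemma rep_exch x y z (Γ Γ' : npath (@mhom Y) x y)
    (Δ Δ' : npath (@mhom Y) y z) (p : mcell Γ Γ') (q : mcell Δ Δ') :
  comp (whisker onil (osome Δ) p) (whisker (osome Γ') onil q)
  = comp (whisker (osome Γ) onil q) (whisker onil (osome Δ') p).
Proof.
rewrite -[LHS]plugE -[RHS]plugE.
apply: (mrg_join hY p q (unit2 _) (Glue (LG (osome Γ')) (RG onil) _ _ _)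
  (Glue (LG onil) (RG (osome Δ)) _ _ _) (Glue (LG onil) (RG (osome Δ')) _ _ _)
  (Glue (LG (osome Γ)) (RG onil) _ _ _)).
same_wires.
Qed.

Lemma glue_plug x u v y (Γ1 : opath (@mhom Y) x u) (Γ2 : opath (@mhom Y) v y)
    (Γ Λ : npath (@mhom Y) u v) (Ξ A Δ : npath (@mhom Y) x y) :
  A = cat_on Γ1 (cat_no Γ Γ2) -> Ξ = cat_on Γ1 (cat_no Λ Γ2) ->
  exists W : glue Γ Λ Ξ Δ A Δ, gpos W = (0, olen Γ1, nlen Λ)%N /\
    forall (t : mcell Γ Λ) (s : mcell Ξ Δ),
      pk (mrg W t s) = pk (whisker Γ1 Γ2 t) * pk s.
Proof.
move=> eA eΞ; subst A Ξ; exists (Glue (LG Γ1) (RG Γ2) _ _ _); split=> // t s.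
by rewrite -pk_comp -plugE.
Qed.

Lemma rep_GD x u v y (Γ1 : opath (@mhom Y) x u)
    (Δ2 : npath (@mhom Y) v y) (Γ : npath (@mhom Y) u y)
    (Λ : npath (@mhom Y) u v) (Δ : npath (@mhom Y) x v)
    (t : mcell Γ (cat Λ Δ2)) (s : mcell (cat_on Γ1 Λ) Δ) :
  pk (mrg (Glue (LG Γ1) (RD Δ2) Γ Λ Δ) t s)
  = pk (whisker Γ1 onil t) * pk (whisker onil (osome Δ2) s).
Proof.
have [W [WE Wt]] := glue_plug (cat Δ Δ2) (erefl (cat_on Γ1 (cat_no Γ onil)))
  (esym (cat_on_no Γ1 Λ (osome Δ2))).
rewrite -Wt; congr pk.
rewrite -[LHS]rep_compp1.
apply: (mrg_assoc hY t s (unit2 _) (Glue (LG Γ1) (RD Δ2) _ _ _)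
  (Glue (LG onil) (RG onil) _ _ _) (Glue (LG onil) (RG (osome Δ2)) _ _ _) W).
rewrite WE.
same_wires.
Qed.

Lemma rep_DG x u v y (Δ1 : npath (@mhom Y) x u)
    (Γ2 : opath (@mhom Y) v y) (Γ : npath (@mhom Y) x v)
    (Λ : npath (@mhom Y) u v) (Δ : npath (@mhom Y) u y)
    (t : mcell Γ (cat Δ1 Λ)) (s : mcell (cat_no Λ Γ2) Δ) :
  pk (mrg (Glue (LD Δ1) (RG Γ2) Γ Λ Δ) t s)
  = pk (whisker onil Γ2 t) * pk (whisker (osome Δ1) onil s).
Proof.
have [W [WE Wt]] := glue_plug (cat Δ1 Δ) (erefl (cat_on onil (cat_no Γ Γ2)))
  (cat_on_no (osome Δ1) Λ Γ2).
rewrite -Wt; congr pk.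
rewrite -[LHS]rep_compp1.
apply: (mrg_assoc hY t s (unit2 _) (Glue (LD Δ1) (RG Γ2) _ _ _)
  (Glue (LG onil) (RG onil) _ _ _) (Glue (LG (osome Δ1)) (RG onil) _ _ _) W).
rewrite WE.
same_wires.
Qed.

Lemma rep_DD x u v y (Δ1 : npath (@mhom Y) x u)
    (Δ2 : npath (@mhom Y) v y) (Γ : npath (@mhom Y) x y)
    (Λ : npath (@mhom Y) u v) (Δ : npath (@mhom Y) u v)
    (t : mcell Γ (cat Δ1 (cat Λ Δ2))) (s : mcell Λ Δ) :
  mrg (Glue (LD Δ1) (RD Δ2) Γ Λ Δ) t s = comp t (whisker (osome Δ1) (osome Δ2) s).
Proof.
rewrite -[LHS]rep_compp1.
apply: (mrg_assoc hY t s (unit2 _) (Glue (LD Δ1) (RD Δ2) _ _ _)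
  (Glue (LG onil) (RG onil) _ _ _) (Glue (LG (osome Δ1)) (RG (osome Δ2)) _ _ _)
  (Glue (LG onil) (RG onil) _ _ _)).
same_wires.
Qed.

Lemma whisker0 x y (Γ Δ : npath (@mhom Y) x y) (p : mcell Γ Δ) : whisker onil onil p = p.
Proof. exact: rep_compp1. Qed.

Lemma whisker_lr x u v y (Γ1 : opath (@mhom Y) x u) (Γ2 : opath (@mhom Y) v y)
    (Γ Λ : npath (@mhom Y) u v) (t : mcell Γ Λ) :
  whisker Γ1 onil (whisker onil Γ2 t) = whisker Γ1 Γ2 t.
Proof. by apply: pk_inj; rewrite whisker_whisker. Qed.

#[global] Instance rep_strict : strict Y.
Proof.
refine (@Strict Y (fun x y Γ => unit2 Γ) (fun x y z Θ Γ Δ p => whisker Θ onil p)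
  (fun x y z Θ Γ Δ p => whisker onil Θ p) rep_comp1p rep_compp1 _ _ _ _ _ whisker0 whisker0
  _ _ _ rep_exch _ rep_GD rep_DG _).
- move=> x y Γ Δ Θ Λ p q r; exact: esym (@plug_comp x x y y onil onil Γ Δ Θ Λ p q r).
- by move=> *; rewrite whisker_unit.
- by move=> *; rewrite whisker_unit.
- by move=> *; rewrite whisker_comp.
- by move=> *; rewrite whisker_comp.
- by move=> x y z w Θ Θ' Γ Δ p; rewrite (whisker_whisker Θ onil Θ' onil p).
- by move=> x y z w Θ Θ' Γ Δ p; rewrite (whisker_whisker onil Θ' onil Θ p).
- move=> x y z w Θ Θ' Γ Δ p; rewrite (whisker_whisker Θ onil onil Θ' p).
  by rewrite (whisker_whisker onil Θ' Θ onil p) !ocat0.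
- by move=> x u v y Γ1 Γ2 Γ Λ Δ t s; rewrite (whisker_lr Γ1 Γ2 t); exact: plugE.
- by move=> x u v y Δ1 Δ2 Γ Λ Δ t s; rewrite (whisker_lr (osome Δ1) (osome Δ2) s); exact: rep_DD.
Defined.
End RepStrict.


(** * Chosen tensors and units *)

Section RepUnits.
Variables (Y : rep_mbicat) (c : tensor_choice Y).
Implicit Types x y z : Y.

Lemma unit_unique x y (Γ : npath (@mhom Y) x y) (i : mcell Γ Γ) :
  is_unit i -> i = unit2 Γ.
Proof.
move=> [_ h]; rewrite -[LHS](rep_comp1p i).
exact: (h _ _ _ _ (Glue (LG onil) (RG onil) Γ Γ Γ)).
Qed.

Lemma path_head x y (Γ : npath (@mhom Y) x y) :
  exists u (a : mhom x u) Γ', Γ = cat_no (one a) Γ'.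
Proof.
elim: Γ => [z a|z w Γ [u [a [Γ' ->]]] b]; first by exists z, a, onil.
by exists u, a, (ocat Γ' ⌊b⌋); rewrite cat_no_ocat.
Qed.

Lemma path_tail x y (Γ : npath (@mhom Y) x y) :
  exists u (a : mhom u y) Γ', Γ = cat_on Γ' (one a).
Proof.
case: Γ => [z a|z w Γ b]; first by exists x, a, onil.
by exists z, b, (osome Γ).
Qed.

(** The unitor of a sequence is the one of its first 1-cell. *)
Lemma lunit_seq_cat x u y (a : mhom x u) (Γ : opath mhom u y) :
  pk (lunit_seq (@cl _ c) (cat_no (one a) Γ)) = pk (cl c a) ◁ Γ.
Proof.
case: Γ => [|v Γ]; first by rewrite hrw_onil.
rewrite /cat_no; elim: Γ => [w b|w w' Γ IH b] //=.
rewrite [LHS](_ : _ = pk (lunit_seq (@cl _ c) (cat (one a) Γ)) ◁ ⌊b⌋) // IH.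
exact: esym (hrw_ocat (osome Γ) ⌊b⌋ _).
Qed.

Lemma rep_ul_nat x y (Γ Δ : npath (@mhom Y) x y) (p : mcell Γ Δ) :
  comp (lw ⌊cu c x⌋ p) (lunit_seq (@cl _ c) Δ)
  = comp (lunit_seq (@cl _ c) Γ) p.
Proof.
apply: pk_inj; rewrite !pk_comp pk_lw.
have [u [a [Γ' eΓ]]] := path_head Γ; have [v [b [Δ' eΔ]]] := path_head Δ.
subst Γ Δ; rewrite !lunit_seq_cat.
have eA := cat_on_no ⌊cu c x⌋ (one a) Γ'.
have [W' [W'E W'p]] := @glue_plug Y x x u y onil Γ'
  (snoc (one (cu c x)) a) (one a) (cat_no (one a) Γ') _ (cat_no (one b) Δ')
  eA erefl.
have {W'p}E := W'p (cl c a) p; rewrite -[RHS]E.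
case: y / Δ' Γ' p {eA} W' W'E {E} => [|w Δ'] Γ' p W' W'E.
  rewrite -(@cl_coh Y c _ _ _ _ _ _ _ _ p _ _ _ _
    (Glue (LG ⌊cu c x⌋) (RG onil) _ _ _) W') //.
  rewrite hrw_onil -(pk_comp (lw ⌊cu c x⌋ p)); congr pk.
  exact: esym (plugE (Γ1 := ⌊cu c x⌋) (Γ2 := onil) p (cl c b)).
rewrite -(@cl_coh Y c _ _ _ _ _ _ _ _ p _ _ _ _
    (Glue (LG ⌊cu c x⌋) (RD Δ') _ _ _) W') //.
exact: esym (rep_GD (Γ1 := ⌊cu c x⌋) p (cl c b)).
Qed.

Lemma rep_ur_nat x y (Γ Δ : npath (@mhom Y) x y) (p : mcell Γ Δ) :
  comp (rw ⌊cu c y⌋ p) (runit_seq (@cr _ c) Δ)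
  = comp (runit_seq (@cr _ c) Γ) p.
Proof.
have [u [a [Γ' eΓ]]] := path_tail Γ; have [v [b [Δ' eΔ]]] := path_tail Δ.
subst Γ Δ; case: u / Γ' a p => [|u Γ'] a p; case: v / Δ' b p => [|v Δ'] b p.
- have E := @cr_coh Y c _ _ _ _ a b onil onil p _ _ _ _
    (Glue (LG onil) (RG ⌊cu c y⌋) _ _ _) (Glue (LG onil) (RG onil) _ _ _)
    erefl erefl.
  by apply: etrans (etrans _ E) _; [exact: esym (plugE _ _) |].
- apply: pk_inj; rewrite pk_comp.
  have E := @cr_coh Y c _ _ _ _ a b onil (osome Δ') p _ _ _ _
    (Glue (LD Δ') (RG ⌊cu c y⌋) _ _ _) (Glue (LG onil) (RG onil) _ _ _)
    erefl erefl.
  by rewrite -[LHS](rep_DG (Δ1 := Δ') (Γ2 := ⌊cu c y⌋) (Λ := one b) p (cr c b)) E.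
- have E := @cr_coh Y c _ _ _ _ a b (osome Γ') onil p _ _ _ _
    (Glue (LG onil) (RG ⌊cu c y⌋) _ _ _) (Glue (LG (osome Γ')) (RG onil) _ _ _)
    erefl erefl.
  by apply: etrans (etrans _ E) _; [exact: esym (plugE _ _) | exact: (plugE (Γ1 := osome Γ') (Γ2 := onil) (cr c a) p)].
- apply: pk_inj; rewrite pk_comp.
  have E := @cr_coh Y c _ _ _ _ a b (osome Γ') (osome Δ') p _ _ _ _
    (Glue (LD Δ') (RG ⌊cu c y⌋) _ _ _) (Glue (LG (osome Γ')) (RG onil) _ _ _)
    erefl erefl.
  rewrite -[LHS](rep_DG (Δ1 := Δ') (Γ2 := ⌊cu c y⌋) (Λ := one b) p (cr c b)) E.
  by congr pk; exact: (plugE (Γ1 := osome Γ') (Γ2 := onil) (cr c a) p).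
Qed.

Definition rep_units : units Y.
Proof.
refine (@Units Y _ (cu c) (@cl _ c) (@cr _ c) _ _ rep_ul_nat rep_ur_nat _).
- by move=> x y a; apply/univ_outP; case: (clP c a).
- by move=> x y a; apply/univ_outP; case: (crP c a).
- move=> x y z a b.
  exact: (@clr_coh Y c _ _ _ _ _ a b onil onil _ (unit2 (snoc (one a) b)) _ _ _ _
    (Glue (LG onil) (RG ⌊b⌋) _ _ _) (Glue (LG ⌊a⌋) (RG onil) _ _ _)).
Defined.

Definition rep_tensors : tensors Y.
Proof.
refine (@Tensors Y _ (@ct_ob _ c) (@ct _ c) _).
by move=> x y z a b; apply/univ_outP; exact: (ctP c a b).
Defined.

End RepUnits.

(** * Strong morphisms *)

Section StrongPfun.
Variables (X Y : rep_mbicat) (cX : tensor_choice X) (f : strong_mor X Y).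
Let fm : is_mor f := @strong_is_mor X Y f.
Let fs := strong_is_strong f.

Lemma strong_comp x y (Γ Δ Θ : npath (@mhom X) x y) (p : mcell Γ Δ)
  (q : mcell Δ Θ) : m2 f (comp p q) = comp (m2 f p) (m2 f q).
Proof.
apply: (@fm x y Γ Δ x y Δ Θ x y Γ Θ (Glue (LG onil) (RG onil) Γ Δ Θ)
  (Glue (LG onil) (RG onil) (mpath f Γ) (mpath f Δ) (mpath f Θ)) p q).
by rewrite /= nlen_npmap.
Qed.

Lemma strong_unit1 x y (a : @mhom X x y) :
  m2 f (unit2 (one a)) = unit2 (one (m1 f a)).
Proof. by apply: unit_unique; apply: (strong_unit fs); exact: unit2P. Qed.

Lemma strong_tensor_iso x y z (a : @mhom X x y) (b : @mhom X y z) :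
  iso2 (m2 f (ct cX a b)).
Proof. by apply/univ_outP; apply: (strong_tensor fs); exact: ctP. Qed.

(** Iterated tensors are built by merging tensors, whose images are tensors. *)
Lemma strong_seq x y (Γ : npath (@mhom X) x y) :
  exists c (t : mcell Γ (one c)), iso2 (m2 f t).
Proof.
elim: Γ => [z a|z w Γ [c [t /hisoP ht]] a].
  exists a, (unit2 (one a)); rewrite strong_unit1.
  by apply/hisoP; exact: hiso_id.
exists (ct_ob cX c a), (plug onil ⌊a⌋ t (ct cX c a)); apply/hisoP.
have -> : m2 f (plug onil ⌊a⌋ t (ct cX c a))
    = plug onil ⌊m1 f a⌋ (m2 f t) (m2 f (ct cX c a)).
  apply: (@fm _ _ _ _ _ _ _ _ _ _ _ _ (Glue (LG onil) (RG ⌊a⌋) Γ (one c) _)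
    (Glue (LG onil) (RG ⌊m1 f a⌋) _ (one (m1 f c)) _) t (ct cX c a)).
  by [].
have := @pk_plug Y (rep_strict Y) _ _ _ _ onil ⌊m1 f a⌋ _ _ _ (m2 f t) (m2 f (ct cX c a)).
rewrite hlw_onil => ->; apply: (hiso_comp (hiso_rw ⌊m1 f a⌋ ht)).
exact/hisoP/strong_tensor_iso.
Qed.

(** Strong morphisms preserve units on single 1-cells by definition.  For a
    sequence, f(id) followed by the invertible f(t) is f(t). *)
Lemma strong_unit2 x y (Γ : npath (@mhom X) x y) :
  m2 f (unit2 Γ) = unit2 (mpath f Γ).
Proof.
have [c [t /hisoP ht]] := strong_seq Γ; apply: pk_inj.
apply: (hcancelr ht (hty_pk _) (hty_pk _)); rewrite -!pk_comp.
by rewrite -strong_comp !rep_comp1p.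
Qed.

Lemma strong_pfun : pfun f.
Proof.
split; [exact: strong_unit2 | exact: strong_comp | |].
- move=> x y z Θ Γ Δ p.
  have [W [WE Wt]] := glue_whisker (Γ1 := osome (mpath f Θ)) (Γ2 := onil)
    (npmap_cat (fun x y => @m1 _ _ f x y) Θ Γ)
    (npmap_cat (fun x y => @m1 _ _ f x y) Θ Δ) (strong_unit2 (cat Θ Δ)).
  rewrite -[RHS]Wt; congr pk.
  apply: (@fm _ _ _ _ _ _ _ _ _ _ _ _ (Glue (LG (osome Θ)) (RG onil) _ _ _) W
    p (unit2 _)).
  by rewrite WE /= !nlen_npmap.
- move=> x y z Θ Γ Δ p.
  have [W [WE Wt]] := glue_whisker (Γ1 := onil) (Γ2 := osome (mpath f Θ))
    (npmap_cat (fun x y => @m1 _ _ f x y) Γ Θ)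
    (npmap_cat (fun x y => @m1 _ _ f x y) Δ Θ) (strong_unit2 (cat Δ Θ)).
  rewrite -[RHS]Wt; congr pk.
  apply: (@fm _ _ _ _ _ _ _ _ _ _ _ _ (Glue (LG onil) (RG (osome Θ)) _ _ _) W
    p (unit2 _)).
  by rewrite WE /= !nlen_npmap.
Qed.

Variable cY : tensor_choice Y.

Definition Gunit_cell (x : X) : mcell (one (cu cY (f x))) (one (m1 f (cu cX x))) :=
  Fu (G_fun cX cY f) x.

Lemma Gunit_cellE (x : X) :
  pk (Gunit_cell x) ◁ ⌊m1 f (cu cX x)⌋ * pk (m2 f (cl cX (cu cX x)))
  = pk (cl cY (m1 f (cu cX x))).
Proof.
have E := choose_exP (Gfun_unit cX cY f x).
rewrite -{}E; have := @pk_plug Y (rep_strict Y) _ _ _ _ onil ⌊m1 f (cu cX x)⌋ _ _ _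
  (Gunit_cell x) (m2 f (cl cX (cu cX x))).
by rewrite hlw_onil => ->.
Qed.

Lemma strong_unit_equiv1 (x : X) : equiv1 (rep_units cY) (m1 f (cu cX x)).
Proof.
apply: tensor_universal_equiv1; apply: (strong_tensor1 fs).
exact: cu_tensor_universal.
Qed.

(** Whiskered with f(1) the 2-cell f_x is invertible, by its definition, and
    whiskering with f(1) reflects inverses since f(1) is tensor universal. *)
Lemma Gunit_cell_iso (x : X) : iso2 (Gunit_cell x).
Proof.
have he := strong_unit_equiv1 x; set e := m1 f _ in he.
have hm : hiso (pk (m2 f (cl cX (cu cX x)))) (snoc (one e) e) (one e).
  by apply/hisoP; apply: (pf_iso strong_pfun); exact: (ul_iso (rep_units cX)).
have [V [tw tV e1 e2]] :
    hiso (pk (Gunit_cell x) ◁ ⌊e⌋) (snoc (one (cu cY (f x))) e) (snoc (one e) e).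
  apply: (hiso_compr hm (hty_rw ⌊e⌋ (hty_pk (Gunit_cell x)))).
  by rewrite Gunit_cellE; apply/hisoP; exact: (ul_iso (rep_units cY)).
have [v vE] : exists v : mcell (one e) (one (cu cY (f x))), pk v ◁ ⌊e⌋ = V.
  exact: (rfull_equiv he).
exists v; split; apply: (rfaithful_equiv he); rewrite pk_comp hrw_comp vE.
  by rewrite e1 hrw_id.
by rewrite e2 hrw_id.
Qed.

Lemma strong_equiv1 x y (e : @mhom X x y) :
  equiv1 (rep_units cX) e -> equiv1 (rep_units cY) (m1 f e).
Proof.
apply: (pf_equiv1 strong_pfun) => z.
by exists (Gunit_cell z); exact: Gunit_cell_iso.
Qed.
End StrongPfun.

(** * The bicategory of a representable merge-bicategory *)

Section GCells.
Variables (Y : rep_mbicat) (c : tensor_choice Y).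
Implicit Types x y z w : Y.
Local Notation T a b := (pk (ct c a b)).

Lemma ct_iso x y z (a : @mhom Y x y) (b : mhom y z) :
  hiso (T a b) (snoc (one a) b) (one (ct_ob c a b)).
Proof. exact/hisoP/(tn_iso (rep_tensors c)). Qed.

Lemma factorP x y (Γ : npath (@mhom Y) x y) d (t : mcell Γ (one d))
    (h : @univ_out Y x x y y onil d onil Γ t) x' y' (Γ1 : opath mhom x' x)
    (Γ2 : opath mhom y y') (Δ : npath mhom x' y')
    (s : mcell (cat_on Γ1 (cat_no Γ Γ2)) Δ) :
  Γ1 ▷ (pk t ◁ Γ2) * pk (factor h s) = pk s.
Proof.
rewrite -pk_plug; congr pk.
exact: (proj1 (choose_exP (h _ _ Γ1 (LG Γ1) _ _ Γ2 (RG Γ2) Δ s))).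
Qed.

Lemma factor0P x y (Γ : npath (@mhom Y) x y) d (t : mcell Γ (one d))
    (h : @univ_out Y x x y y onil d onil Γ t) (Δ : npath mhom x y)
    (s : mcell Γ Δ) :
  pk t * pk (factor h (Γ1 := onil) (Γ2 := onil) s) = pk s.
Proof.
by rewrite -[RHS](factorP h (Γ1 := onil) (Γ2 := onil)) hlw_onil hrw_onil.
Qed.

Lemma Gcomp_pk x y (a b d : @mhom Y x y) (p : mcell (one a) (one b))
  (q : mcell (one b) (one d)) : pk (Gvcomp p q) = pk p * pk q.
Proof. exact: pk_comp. Qed.

Lemma pk_plug_l x y z (a : @mhom Y x y) (Γ Λ : npath (@mhom Y) y z) Δ
    (t : mcell Γ Λ) (s : mcell (cat (one a) Λ) Δ) :
  pk (plug ⌊a⌋ onil t s) = ⌊a⌋ ▷ pk t * pk s.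
Proof.
by rewrite (pk_plug (Γ1 := ⌊a⌋) (Γ2 := onil)) hrw_onil.
Qed.

Lemma pk_plug_r x y z (a : @mhom Y y z) (Γ Λ : npath (@mhom Y) x y) Δ
    (t : mcell Γ Λ) (s : mcell (snoc Λ a) Δ) :
  pk (plug onil ⌊a⌋ t s) = pk t ◁ ⌊a⌋ * pk s.
Proof.
by rewrite (pk_plug (Γ1 := onil) (Γ2 := ⌊a⌋)) hlw_onil.
Qed.

Lemma Ghtens_pk x y z (a a' : @mhom Y x y) (b b' : mhom y z)
    (p : mcell (one a) (one a')) (q : mcell (one b) (one b')) :
  T a b * pk (Ghtens c p q) = ⌊a⌋ ▷ pk q * (pk p ◁ ⌊b'⌋ * T a' b').
Proof.
rewrite factor0P; apply: etrans (pk_plug_l q (plug onil ⌊b'⌋ p (ct c a' b'))) _.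
congr (_ * _); exact: (pk_plug_r p (ct c a' b')).
Qed.

Lemma Ghtens_l x y z (a a' : @mhom Y x y) (b : mhom y z)
    (p : mcell (one a) (one a')) :
  T a b * pk (Ghtens c p (unit2 (one b))) = pk p ◁ ⌊b⌋ * T a' b.
Proof.
rewrite Ghtens_pk -/(hid (one b)) hlw_id.
exact: (hid_comp (hty_comp (hty_rw ⌊b⌋ (hty_pk p)) (hty_pk (ct c a' b)))).
Qed.

Lemma Ghtens_r x y z (a : @mhom Y x y) (b b' : mhom y z)
    (q : mcell (one b) (one b')) :
  T a b * pk (Ghtens c (unit2 (one a)) q) = ⌊a⌋ ▷ pk q * T a b'.
Proof.
rewrite Ghtens_pk -/(hid (one a)) hrw_id; congr (_ * _).
exact: (hid_comp (hty_pk (ct c a b'))).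
Qed.

Lemma Gcancel x y z (a : @mhom Y x y) (b : mhom y z) d
    (p q : mcell (one (ct_ob c a b)) (one d)) :
  T a b * pk p = T a b * pk q <-> p = q.
Proof.
split=> [|-> //]; move/(hcancell (ct_iso a b) (hty_pk p) (hty_pk q)).
exact: pk_inj.
Qed.

Lemma Gassoc_pk x y z w (a : @mhom Y x y) (b : mhom y z) (d : mhom z w) :
  T a b ◁ ⌊d⌋ * (T (ct_ob c a b) d * pk (Gassoc c a b d))
  = ⌊a⌋ ▷ T b d * T a (ct_ob c b d).
Proof.
rewrite factor0P; have := factorP (ctP c a b) (Γ1 := onil) (Γ2 := ⌊d⌋)
  (tern_r c a b d).
by rewrite hlw_onil => ->; exact: (pk_plug_l (ct c b d) (ct c a _)).
Qed.

Lemma GassocV_pk x y z w (a : @mhom Y x y) (b : mhom y z) (d : mhom z w) :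
  ⌊a⌋ ▷ T b d * (T a (ct_ob c b d) * pk (GassocV c a b d))
  = T a b ◁ ⌊d⌋ * T (ct_ob c a b) d.
Proof.
rewrite factor0P; have := factorP (ctP c b d) (Γ1 := ⌊a⌋) (Γ2 := onil)
  (tern_l c a b d).
by rewrite hrw_onil => ->; exact: (pk_plug_r (ct c a b) (ct c _ d)).
Qed.

Lemma Glun_pk x y (a : @mhom Y x y) : T (cu c x) a * pk (Glun c a) = pk (cl c a).
Proof. exact: factor0P. Qed.

Lemma GrunV_pk x y (a : @mhom Y x y) :
  pk (cr c a) * pk (GrunV c a) = T a (cu c y).
Proof. exact: factor0P. Qed.

Lemma Gequiv1 x y (e : @mhom Y x y) :
  is_equiv1 (B := G_bicat c) e <-> equiv1 (rep_units c) e.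
Proof.
split=> [[u [[p hp] [q hq]]]|[u [[p /hisoP hp] [q /hisoP hq]]]].
  have {}hp := proj1 (@hisoP Y (rep_strict Y) _ _ (one (ct_ob c e u)) (one (cu c x)) p) hp.
  have {}hq := proj1 (@hisoP Y (rep_strict Y) _ _ (one (ct_ob c u e)) (one (cu c y)) q) hq.
  have [p' _ hp'] := hiso_cell (hiso_comp (ct_iso e u) hp).
  have [q' _ hq'] := hiso_cell (hiso_comp (ct_iso u e) hq).
  by exists u; split; [exists p' | exists q'].
have [I /hiso_inv hI] := ct_iso e u; have [J /hiso_inv hJ] := ct_iso u e.
have [p' _ hp'] := hiso_cell (hiso_comp hI hp).
have [q' _ hq'] := hiso_cell (hiso_comp hJ hq).
by exists u; split; [exists p' | exists q'].
Qed.
End GCells.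

Section GTransformations.
Variables (X Y : rep_mbicat) (cX : tensor_choice X) (cY : tensor_choice Y).
Variables (f g : strong_mor X Y).
Local Notation T a b := (pk (ct cY a b)).
Local Notation F := (G_fun cX cY f).
Local Notation G := (G_fun cX cY g).

Lemma Gtens_pk (h : strong_mor X Y) x y z (a : @mhom X x y) (b : mhom y z) :
  T (m1 h a) (m1 h b) * pk (Ft (G_fun cX cY h) a b) = pk (m2 h (ct cX a b)).
Proof. exact: factor0P. Qed.

Section OneTransformation.
Variable σ : mtrans f g.
Local Notation Gσ := (G_trans cX cY σ).
Local Notation tr a := (bt1 Gσ a : mcell (one _) (one _)).

Lemma Gtrans_pk x y (a : @mhom X x y) :
  T (m1 f a) (σ y) * pk (tr a) = pk (mt1 σ a) * T (σ x) (m1 g a).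
Proof. by rewrite [LHS]factor0P [LHS]pk_comp. Qed.

Lemma Gtrans_iso x y (a : @mhom X x y) : iso2 (mt1 σ a) <-> iso2 (tr a).
Proof.
split=> [/hisoP h|/hisoP h]; apply/hisoP.
  apply: (hiso_compl (ct_iso cY (m1 f a) (σ y)) (hty_pk _)).
  by rewrite Gtrans_pk; apply: hiso_comp h (ct_iso _ _ _).
apply: (hiso_compr (ct_iso cY (σ x) (m1 g a)) (hty_pk _)).
by rewrite -Gtrans_pk; apply: hiso_comp (ct_iso _ _ _) h.
Qed.

Lemma Gnat_one x y (a b : @mhom X x y) (p : mcell (one a) (one b)) :
  nat_at σ p <->
  Gvcomp (Ghtens cY (m2 f p : mcell (one _) (one _)) (unit2 (one (σ y)))) (tr b)
  = Gvcomp (tr a) (Ghtens cY (unit2 (one (σ x))) (m2 g p : mcell (one _) (one _))).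
Proof.
rewrite -Gcancel !Gcomp_pk !hcompA Ghtens_l Gtrans_pk -!hcompA Gtrans_pk.
rewrite Ghtens_r !hcompA /nat_at; split=> [-> //|].
apply: (hcancelr (ct_iso cY (σ x) (m1 g b))).
  exact: (hty_comp (hty_rw ⌊σ y⌋ (hty_pk (m2 f p))) (hty_pk (mt1 σ b))).
exact: (hty_comp (hty_pk (mt1 σ a)) (hty_lw ⌊σ x⌋ (hty_pk (m2 g p)))).
Qed.

(** Both sides are compared after composing with the iterated tensor of
    (f(a),f(b),σ_z), which lets the associators and the 2-cells of Gσ be replaced
    by merges, one at a time from the left. *)
Lemma Gnat_tens x y z (a : @mhom X x y) (b : mhom y z) :
  nat_at σ (ct cX a b) <->
  Gvcomp (Ghtens cY (Ft F a b : mcell (one _) (one _)) (unit2 (one (σ z))))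
    (tr (ct_ob cX a b))
  = Gvcomp (Gvcomp (Gvcomp (Gvcomp (Gvcomp
      (Gassoc cY (m1 f a) (m1 f b) (σ z))
      (Ghtens cY (unit2 (one (m1 f a))) (tr b)))
      (GassocV cY (m1 f a) (σ y) (m1 g b)))
      (Ghtens cY (tr a) (unit2 (one (m1 g b)))))
      (Gassoc cY (σ x) (m1 g a) (m1 g b)))
      (Ghtens cY (unit2 (one (σ x))) (Ft G a b : mcell (one _) (one _))).
Proof.
set L := Gvcomp (Ghtens _ _ _) _; set R := Gvcomp _ _.
pose fa := m1 f a; pose fb := m1 f b; pose ga := m1 g a; pose gb := m1 g b.
have EL : T fa fb ◁ ⌊σ z⌋ * (T (ct_ob cY fa fb) (σ z) * pk L)
    = pk (m2 f (ct cX a b)) ◁ ⌊σ z⌋ * pk (mt1 σ (ct_ob cX a b))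
      * T (σ x) (m1 g (ct_ob cX a b)).
  rewrite Gcomp_pk !hcompA -(hcompA _ _ (pk (Ghtens _ _ _))) Ghtens_l.
  by rewrite hcompA -hrw_comp Gtens_pk -!hcompA Gtrans_pk.
have ER : T fa fb ◁ ⌊σ z⌋ * (T (ct_ob cY fa fb) (σ z) * pk R)
    = ⌊fa⌋ ▷ pk (mt1 σ b) * pk (mt1 σ a) ◁ ⌊gb⌋
      * ⌊σ x⌋ ▷ pk (m2 g (ct cX a b)) * T (σ x) (m1 g (ct_ob cX a b)).
  rewrite !Gcomp_pk !hcompA -(hcompA _ _ (pk (Gassoc cY fa _ _))) Gassoc_pk.
  rewrite -(hcompA _ _ (pk (Ghtens cY (unit2 (one fa)) _))) Ghtens_r.
  rewrite hcompA -hlw_comp Gtrans_pk hlw_comp.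
  rewrite -(hcompA _ _ (pk (GassocV cY _ _ _))) -(hcompA _ (⌊fa⌋ ▷ T _ _)).
  rewrite GassocV_pk !hcompA.
  rewrite -(hcompA _ _ (pk (Ghtens cY _ (unit2 (one gb))))) Ghtens_l !hcompA.
  rewrite -(hcompA _ (_ ◁ _) (_ ◁ _)) -hrw_comp Gtrans_pk hrw_comp !hcompA.
  rewrite -(hcompA _ _ (pk (Gassoc cY _ _ _))) -(hcompA _ (T _ _ ◁ _)) Gassoc_pk.
  rewrite !hcompA -(hcompA _ _ (pk (Ghtens cY _ _))) Ghtens_r !hcompA.
  by rewrite -(hcompA _ (⌊σ x⌋ ▷ T _ _)) -hlw_comp Gtens_pk.
have tM : hiso (T fa fb ◁ ⌊σ z⌋ * T (ct_ob cY fa fb) (σ z))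
    (snoc (snoc (one fa) fb) (σ z)) (one (ct_ob cY (ct_ob cY fa fb) (σ z))).
  exact: (hiso_comp (hiso_rw ⌊σ z⌋ (ct_iso cY fa fb)) (ct_iso cY _ (σ z))).
rewrite /nat_at mt_seq_snoc.
have -> : L = R <-> T fa fb ◁ ⌊σ z⌋ * (T (ct_ob cY fa fb) (σ z) * pk L)
    = T fa fb ◁ ⌊σ z⌋ * (T (ct_ob cY fa fb) (σ z) * pk R).
  split=> [-> //|]; rewrite !hcompA.
  by move/(hcancell tM (hty_pk L) (hty_pk R))/pk_inj.
rewrite EL ER; split=> [-> //|].
apply: (hcancelr (ct_iso cY (σ x) (m1 g (ct_ob cX a b)))).
  exact: (hty_comp (hty_rw ⌊σ z⌋ (hty_pk (m2 f (ct cX a b))))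
    (hty_pk (mt1 σ (ct_ob cX a b)))).
exact: (hty_comp (hty_comp (hty_lw ⌊fa⌋ (hty_pk (mt1 σ b)))
  (hty_rw ⌊gb⌋ (hty_pk (mt1 σ a)))) (hty_lw ⌊σ x⌋ (hty_pk (m2 g (ct cX a b))))).
Qed.

Lemma Gunit_eq (x : X) (Q : hcell (f x) (g x)) :
  hinv (pk (cr cY (σ x))) Q (snoc (one (σ x)) (cu cY (g x))) (one (σ x)) ->
  pk (Gunit_cell cX f cY x) ◁ ⌊σ x⌋ * pk (mt1 σ (cu cX x))
    = pk (cl cY (σ x)) * Q * ⌊σ x⌋ ▷ pk (Gunit_cell cX g cY x) <->
  Gvcomp (Ghtens cY (Gunit_cell cX f cY x) (unit2 (one (σ x)))) (tr (cu cX x))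
  = Gvcomp (Gvcomp (Glun cY (σ x)) (GrunV cY (σ x)))
      (Ghtens cY (unit2 (one (σ x))) (Gunit_cell cX g cY x)).
Proof.
move=> hQ; have [_ tQ _ _] := hQ.
have EV : pk (GrunV cY (σ x)) = Q * T (σ x) (cu cY (g x)).
  by rewrite -GrunV_pk (hinvK (hinv_sym hQ) (hty_pk (GrunV cY (σ x)))).
rewrite -Gcancel !Gcomp_pk !hcompA Ghtens_l Glun_pk EV -!hcompA Gtrans_pk.
rewrite Ghtens_r !hcompA; split=> [-> //|].
apply: (hcancelr (ct_iso cY (σ x) (m1 g (cu cX x)))).
  exact: (hty_comp (hty_rw ⌊σ x⌋ (hty_pk (Gunit_cell cX f cY x)))
    (hty_pk (mt1 σ (cu cX x)))).
exact: (hty_comp (hty_comp (hty_pk (cl cY (σ x))) tQ)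
  (hty_lw ⌊σ x⌋ (hty_pk (Gunit_cell cX g cY x)))).
Qed.

Lemma G_boplaxP :
  is_boplax Gσ <-> is_moplax σ /\ forall x, iso2 (mt1 σ (cu cX x)).
Proof.
have hr x : hiso (pk (cr cY (σ x))) _ _ := proj1 (hisoP _) (ur_iso (rep_units cY) (σ x)).
have hw (h : strong_mor X Y) x := proj1 (hisoP _) (Gunit_cell_iso cX h cY x).
split=> [[n1 n2 nu]|[hm h1]].
  split=> [|x].
    apply: (moplax_gen (strong_pfun cX f) (strong_pfun cX g)
      (T := rep_tensors cX)) => [x y a b p|x y z a b].
      exact/Gnat_one/n1.
    exact/Gnat_tens/n2.
  have [Q hQ] := hr x; have E := proj2 (Gunit_eq hQ) (nu x).
  apply/hisoP; apply: (hiso_compl (hiso_rw ⌊σ x⌋ (hw f x)) (hty_pk _)).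
  rewrite E; apply: hiso_comp (hiso_lw ⌊σ x⌋ (hw g x)).
  apply: hiso_comp (hiso_inv hQ); exact/hisoP/(ul_iso (rep_units cY)).
have N := proj1 (is_moplaxP σ) hm; split.
- by move=> x y a b p; apply: (proj1 (Gnat_one p)); exact: N.
- by move=> x y z a b; apply: (proj1 (Gnat_tens a b)); exact: N.
move=> x; have [Q hQ] := hr x; apply: (proj1 (Gunit_eq hQ)).
exact: (@oplax_unit X Y _ _ (rep_units cX) (rep_units cY) f g
  (strong_pfun cX g) σ x (Gunit_cell cX f cY x) (Gunit_cell cX g cY x)
  (Gunit_cell_iso cX f cY x) (Gunit_cell_iso cX g cY x) (Gunit_cellE cX f cY x)
  (Gunit_cellE cX g cY x) Q hm (h1 x) hQ).
Qed.

Lemma G_fairP : is_fair σ <-> is_boplax Gσ.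
Proof.
apply: iff_trans (iff_sym G_boplaxP).
exact: (@is_fairP _ _ _ _ _ _ (strong_pfun cX f) (strong_pfun cX g) σ
  (rep_units cX) (rep_units cY) (rep_tensors cX)
  (@strong_equiv1 X Y cX f cY) (@strong_equiv1 X Y cX g cY)).
Qed.

Lemma G_pseudoP : is_mpseudo σ <-> is_bpseudo Gσ.
Proof.
split=> [[hm hi]|[/G_boplaxP [hm _] hi]].
  have {}hi x y (a : @mhom X x y) : iso2 (mt1 σ a) by exact/universal2P.
  by split; [apply/G_boplaxP | move=> x y a; exact/Gtrans_iso].
by split=> // x y a; apply/universal2P/Gtrans_iso; exact: hi.
Qed.

Lemma G_equivP : is_mequiv σ <-> is_bequiv Gσ.
Proof.
have E x : universal1 (σ x) <-> is_equiv1 (B := G_bicat cY) (σ x).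
  apply: iff_trans (iff_sym (Gequiv1 cY (σ x))).
  exact: (universal1P (rep_units cY) (rep_tensors cY)).
split=> [[hm hi he]|[/G_pseudoP [hm hi] he]].
  by split=> [|x]; [apply/G_pseudoP | apply/E].
by split=> // x; apply/E; exact: he.
Qed.
End OneTransformation.

Definition ctV (x y z : Y) (a : mhom x y) (b : mhom y z) :
    mcell (one (ct_ob cY a b)) (snoc (one a) b) :=
  choose_ex (tn_iso (rep_tensors cY) a b).

Lemma ctVP (x y z : Y) (a : mhom x y) (b : mhom y z) :
  hinv (T a b) (pk (ctV a b)) (snoc (one a) b) (one (ct_ob cY a b)).
Proof.
have [e1 e2] := choose_exP (tn_iso (rep_tensors cY) a b).
by split; try exact: hty_pk; rewrite -pk_comp; congr pk.
Qed.

(** The inverse of σ ↦ Gσ, by solving the equation that defines (Gσ)_a. *)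
Definition G_transV (τ : btrans F G) : mtrans f g :=
  @MTrans X Y f g τ (fun x y a =>
    comp (ct cY (m1 f a) (τ y))
      (comp (bt1 τ a : mcell (one _) (one _)) (ctV (τ x) (m1 g a)))).

Lemma G_transK : cancel (G_trans cX cY (f := f) (g := g)) G_transV.
Proof.
move=> [σ0 σ1]; rewrite /G_transV; congr MTrans.
apply: functional_extensionality_dep => x; apply: functional_extensionality_dep => y.
apply: functional_extensionality_dep => a; apply: pk_inj.
rewrite !pk_comp hcompA (Gtrans_pk (MTrans σ1)).
by rewrite (hinvKr (ctVP _ _) (hty_pk (σ1 x y a))).
Qed.

Lemma G_transVK : cancel G_transV (G_trans cX cY (f := f) (g := g)).
Proof.
move=> [τ0 τ1]; rewrite /G_trans; congr BTrans.
apply: functional_extensionality_dep => x; apply: functional_extensionality_dep => y.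
apply: functional_extensionality_dep => a; apply: (proj1 (Gcancel _ _)).
apply: etrans (Gtrans_pk (G_transV (BTrans τ1)) a) _.
have -> : pk (mt1 (G_transV (BTrans τ1)) a)
    = T (m1 f a) (τ0 y) * (pk (τ1 x y a : mcell (one _) (one _))
      * pk (ctV (τ0 x) (m1 g a))).
  exact: etrans (pk_comp _ _) (congr1 _ (pk_comp _ _)).
rewrite -!hcompA.
by have [_ _ _ ->] := ctVP (τ0 x) (m1 g a); rewrite (hcomp_id (hty_pk _)).
Qed.
End GTransformations.

(** * Modifications *)

Section GModifications.
Variables (X Y : rep_mbicat) (cX : tensor_choice X) (cY : tensor_choice Y).
Local Notation T a b := (pk (ct cY a b)).
Local Notation Gtr :=
  (fun (h k : strong_mor X Y) (σ : fair_quiver h k) => G_trans cX cY (fair_tr σ)).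
Local Notation s0 Σ x := (mts0 (@fair_tr X Y) Σ x).
Local Notation s1 Σ a := (mts1 (@fair_tr X Y) Σ a).
Local Notation t0 Σ x := (@lcomp (G_bicat cY) _ _ (s0 Σ x)).
Local Notation cs Γ := (pk (ct_seq cY Γ)).

Lemma ct_seq_iso x y (Γ : npath (@mhom Y) x y) :
  hiso (cs Γ) Γ (one (@lcomp (G_bicat cY) _ _ Γ)).
Proof.
elim: Γ => [z a|z w Γ IH a]; first exact: hiso_id.
have -> : cs (snoc Γ a) = cs Γ ◁ ⌊a⌋ * T (@lcomp (G_bicat cY) _ _ Γ) a.
  exact: (pk_plug_r (ct_seq cY Γ) (ct cY (@lcomp (G_bicat cY) _ _ Γ) a)).
exact: (hiso_comp (hiso_rw ⌊a⌋ IH) (ct_iso cY _ a)).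
Qed.

Definition Gbts1 (f g : strong_mor X Y) (Σ : npath (@fair_quiver X Y) f g)
    (x y : X) (a : mhom x y) :
    mcell (one (ct_ob cY (m1 f a) (t0 Σ y))) (one (ct_ob cY (t0 Σ x) (m1 g a))) :=
  @bts1 (G_bicat cX) (G_bicat cY) _ _ _ Gtr f g Σ x y a.

(** By induction on the sequence: the associators in the composite of Gσ^1, ..,
    Gσ^n are eliminated by the tensors that precede them, and what is left is
    the pasting of σ^1, .., σ^n.  The last step exchanges the iterated tensor at
    x with the last σ. *)
Lemma Gmts1 (f g : strong_mor X Y) (Σ : npath (@fair_quiver X Y) f g)
    (x y : X) (a : mhom x y) :
  ⌊m1 f a⌋ ▷ cs (s0 Σ y) * (T (m1 f a) (t0 Σ y) * pk (Gbts1 Σ a))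
  = pk (s1 Σ a) * (cs (s0 Σ x) ◁ ⌊m1 g a⌋ * T (t0 Σ x) (m1 g a)).
Proof.
elim: Σ => [k σ|k l Σ IH σ].
  rewrite (Gtrans_pk cX cY (fair_tr σ) a) -!/(hid _) hlw_id hrw_id.
  rewrite (hid_comp (hty_pk (ct cY (fair_tr σ x) (m1 k a)))).
  exact: (hid_comp (hty_comp (hty_pk (mt1 (fair_tr σ) a)) (hty_pk _))).
set sx := fair_tr σ x; set sy := fair_tr σ y.
have Ey : cs (s0 (snoc Σ σ) y) = cs (s0 Σ y) ◁ ⌊sy⌋ * T (t0 Σ y) sy.
  exact: (pk_plug_r (ct_seq cY (s0 Σ y)) (ct cY _ _)).
have Ex : cs (s0 (snoc Σ σ) x) = cs (s0 Σ x) ◁ ⌊sx⌋ * T (t0 Σ x) sx.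
  exact: (pk_plug_r (ct_seq cY (s0 Σ x)) (ct cY _ _)).
have EM : pk (s1 (snoc Σ σ) a)
    = pk (s1 Σ a) ◁ ⌊sy⌋ * osome (s0 Σ x) ▷ pk (mt1 (fair_tr σ) a).
  exact: (rep_DG (Δ1 := s0 Σ x) (Γ2 := ⌊sy⌋) (Λ := one (m1 k a)) (s1 Σ a)
    (mt1 (fair_tr σ) a)).
have EB : pk (Gbts1 (snoc Σ σ) a)
    = pk (GassocV cY (m1 f a) (t0 Σ y) sy)
      * pk (Ghtens cY (Gbts1 Σ a) (unit2 (one sy)))
      * pk (Gassoc cY (t0 Σ x) (m1 k a) sy)
      * pk (Ghtens cY (unit2 (one (t0 Σ x)))
              (bt1 (Gtr k l σ) a : mcell (one _) (one _)))
      * pk (GassocV cY (t0 Σ x) sx (m1 l a)).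
  by rewrite -!Gcomp_pk.
rewrite Ey Ex EM {}EB {Ey Ex EM}.
have EX : cs (s0 Σ x) ◁ ⌊m1 k a⌋ ◁ ⌊sy⌋ * ⌊t0 Σ x⌋ ▷ pk (mt1 (fair_tr σ) a)
    = osome (s0 Σ x) ▷ pk (mt1 (fair_tr σ) a) * cs (s0 Σ x) ◁ ⌊sx⌋ ◁ ⌊m1 l a⌋.
  rewrite -(hrw_ocat ⌊m1 k a⌋ ⌊sy⌋) -(hrw_ocat ⌊sx⌋ ⌊m1 l a⌋).
  exact: (hexch (hty_pk (ct_seq cY (s0 Σ x))) (hty_pk (mt1 (fair_tr σ) a))).
change (t0 (snoc Σ σ) y) with (ct_ob cY (t0 Σ y) sy).
change (t0 (snoc Σ σ) x) with (ct_ob cY (t0 Σ x) sx).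
move: IH EX; set cx := cs (s0 Σ x); set cy := cs (s0 Σ y).
set Ax := t0 Σ x; set Ay := t0 Σ y => IH EX.
rewrite hlw_comp !hcompA -(hcompA _ _ (pk (GassocV cY (m1 f a) _ _))).
rewrite -(hcompA _ (⌊m1 f a⌋ ▷ T _ _)) GassocV_pk !hcompA.
rewrite -(hcompA _ _ (pk (Ghtens cY (Gbts1 Σ a) _))) Ghtens_l !hcompA.
rewrite hlw_hrw -!hrw_comp -(hcompA (⌊m1 f a⌋ ▷ cy)) IH !hrw_comp !hcompA.
rewrite -(hcompA _ _ (pk (Gassoc cY _ _ _))) -(hcompA _ (T _ _ ◁ _)) Gassoc_pk.
rewrite !hcompA -(hcompA _ _ (pk (Ghtens cY _ _))) Ghtens_r !hcompA.
rewrite -(hcompA _ (⌊Ax⌋ ▷ T _ _) (⌊Ax⌋ ▷ _)) -hlw_comp.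
rewrite (Gtrans_pk cX cY (fair_tr σ) a) hlw_comp !hcompA.
rewrite -(hcompA _ _ (pk (GassocV cY _ _ _))) -(hcompA _ (⌊Ax⌋ ▷ T _ _)).
rewrite GassocV_pk !hcompA -(hcompA _ (cx ◁ _ ◁ _)) EX.
by rewrite !hcompA.
Qed.

Lemma mmod_pk (f g : strong_mor X Y) (Σ T' : npath (@fair_quiver X Y) f g)
    (μ : forall x, mcell (s0 Σ x) (s0 T' x)) :
  @is_mmod X Y _ _ _ (@fair_tr X Y) f g Σ T' μ <->
  forall x y (a : @mhom X x y),
    ⌊m1 f a⌋ ▷ pk (μ y) * pk (s1 T' a) = pk (s1 Σ a) * pk (μ x) ◁ ⌊m1 g a⌋.
Proof.
have E x y (a : @mhom X x y) :
    mrg (Glue (LG ⌊m1 f a⌋) (RG onil) _ _ (snoc (s0 T' x) (m1 g a))) (μ y) (s1 T' a)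
    = mrg (Glue (LG onil) (RD (one (m1 g a))) (cat (one (m1 f a)) (s0 Σ y)) _ _)
        (s1 Σ a) (μ x) <->
    ⌊m1 f a⌋ ▷ pk (μ y) * pk (s1 T' a) = pk (s1 Σ a) * pk (μ x) ◁ ⌊m1 g a⌋.
  have EL := pk_plug_l (a := m1 f a) (μ y) (s1 T' a).
  have ER := rep_GD (Γ1 := onil) (Δ2 := one (m1 g a))
    (s1 Σ a : mcell _ (cat (s0 Σ x) (one _))) (μ x).
  rewrite (whisker0 (s1 Σ a)) in ER; split=> [/(congr1 pk) H|H].
    exact: etrans (esym EL) (etrans H ER).
  by apply: pk_inj; exact: etrans EL (etrans H (esym ER)).
by split=> H x y a; [apply: (proj1 (E _ _ a)) | apply: (proj2 (E _ _ a))];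
   exact: H.
Qed.

Section Correspondence.
Variables (f g : strong_mor X Y) (Σ T' : npath (@fair_quiver X Y) f g).

Lemma is_Gmod_pk (μ : forall x, mcell (s0 Σ x) (s0 T' x))
    (μ' : forall x, mcell (one (t0 Σ x)) (one (t0 T' x))) :
  @is_Gmod X Y cX cY f g Σ T' μ μ' <->
  forall x, cs (s0 Σ x) * pk (μ' x) = pk (μ x) * cs (s0 T' x).
Proof.
split=> H x; last by apply: pk_inj; rewrite [LHS]pk_comp [RHS]pk_comp; exact: H.
have := congr1 pk (H x).
by move=> {}H; apply: etrans (esym (pk_comp _ _)) (etrans H (pk_comp _ _)).
Qed.

(** Composed with the invertible tensors of (f(a),σ^1_y,..,σ^n_y), the equation
    for μ' is the one for μ followed by the tensors of its codomain. *)
Lemma Gmod_iff (μ : forall x, mcell (s0 Σ x) (s0 T' x))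
    (μ' : forall x, mcell (one (t0 Σ x)) (one (t0 T' x))) :
  @is_Gmod X Y cX cY f g Σ T' μ μ' ->
  @is_mmod X Y _ _ _ (@fair_tr X Y) f g Σ T' μ <->
  @is_bmod _ _ (G_fun cX cY f) (G_fun cX cY g)
    (bcomposite Gtr Σ) (bcomposite Gtr T') μ'.
Proof.
move=> /is_Gmod_pk R; apply: iff_trans (mmod_pk μ) _.
have E x y (a : @mhom X x y) :
    ⌊m1 f a⌋ ▷ pk (μ y) * pk (s1 T' a) = pk (s1 Σ a) * pk (μ x) ◁ ⌊m1 g a⌋ <->
    Gvcomp (Gbts1 Σ a) (Ghtens cY (μ' x) (unit2 (one (m1 g a))))
    = Gvcomp (Ghtens cY (unit2 (one (m1 f a))) (μ' y)) (Gbts1 T' a).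
  have hN := hiso_comp (hiso_lw ⌊m1 f a⌋ (ct_seq_iso (s0 Σ y)))
    (ct_iso cY (m1 f a) (t0 Σ y)).
  have hO := hiso_comp (hiso_rw ⌊m1 g a⌋ (ct_seq_iso (s0 T' x)))
    (ct_iso cY (t0 T' x) (m1 g a)).
  set L := Gvcomp (Gbts1 Σ a) _; set L' := Gvcomp _ (Gbts1 T' a).
  have EL : ⌊m1 f a⌋ ▷ cs (s0 Σ y) * T (m1 f a) (t0 Σ y) * pk L
      = pk (s1 Σ a) * pk (μ x) ◁ ⌊m1 g a⌋
        * (cs (s0 T' x) ◁ ⌊m1 g a⌋ * T (t0 T' x) (m1 g a)).
    rewrite Gcomp_pk !hcompA -(hcompA _ _ (pk (Gbts1 Σ a))) Gmts1 -!hcompA.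
    rewrite Ghtens_l (hcompA (cs _ ◁ _)) -hrw_comp R hrw_comp.
    by rewrite !hcompA.
  have EL' : ⌊m1 f a⌋ ▷ cs (s0 Σ y) * T (m1 f a) (t0 Σ y) * pk L'
      = ⌊m1 f a⌋ ▷ pk (μ y) * pk (s1 T' a)
        * (cs (s0 T' x) ◁ ⌊m1 g a⌋ * T (t0 T' x) (m1 g a)).
    rewrite Gcomp_pk !hcompA -(hcompA _ _ (pk (Ghtens _ _ _))) Ghtens_r hcompA.
    rewrite -hlw_comp R hlw_comp -!hcompA Gmts1.
    by rewrite !hcompA.
  split=> [H|H].
    apply/pk_inj/(hcancell hN (hty_pk L) (hty_pk L')).
    by rewrite EL EL' H.
  apply: (hcancelr hO _ _ _).
  - exact: (hty_comp (hty_lw ⌊m1 f a⌋ (hty_pk (μ y))) (hty_pk (s1 T' a))).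
  - exact: (hty_comp (hty_pk (s1 Σ a)) (hty_rw ⌊m1 g a⌋ (hty_pk (μ x)))).
  by rewrite -EL -EL' H.
by split=> H x y a; [apply: (proj1 (E _ _ a)) | apply: (proj2 (E _ _ a))];
   exact: H.
Qed.

Lemma Gmod_one_to_one :
  one_to_one (@is_Gmod X Y cX cY f g Σ T')
    (@is_mmod X Y _ _ _ (@fair_tr X Y) f g Σ T')
    (@is_bmod _ _ (G_fun cX cY f) (G_fun cX cY g)
      (bcomposite Gtr Σ) (bcomposite Gtr T')).
Proof.
split=> [μ hμ|μ' hμ'].
  have R x : exists p : mcell (one (t0 Σ x)) (one (t0 T' x)),
      cs (s0 Σ x) * pk p = pk (μ x) * cs (s0 T' x).
    have [V hV] := ct_seq_iso (s0 Σ x); have [_ tV _ _] := hV.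
    have [p pE] : hty (V * (pk (μ x) * cs (s0 T' x)))
        (one (t0 Σ x)) (one (t0 T' x)).
      exact: (hty_comp tV (hty_comp (hty_pk (μ x)) (hty_pk _))).
    by exists p; rewrite -pE (hinvK hV (hty_comp (hty_pk (μ x)) (hty_pk _))).
  pose μ' x := choose_ex (R x).
  have Rμ : @is_Gmod X Y cX cY f g Σ T' μ μ'.
    by apply: (proj2 (is_Gmod_pk μ μ')) => x; exact: choose_exP (R x).
  exists μ'; split=> [|ν [_ Rν']].
    by split=> //; apply: (proj1 (Gmod_iff Rμ)).
  apply: functional_extensionality_dep => x; apply: pk_inj.
  apply: (hcancell (ct_seq_iso (s0 Σ x)) (hty_pk _) (hty_pk (ν x : mcell (one _) (one _)))).
  by rewrite (proj1 (is_Gmod_pk μ μ') Rμ) (proj1 (is_Gmod_pk μ ν) Rν').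
have R x : exists p : mcell (s0 Σ x) (s0 T' x),
    cs (s0 Σ x) * pk (μ' x : mcell (one _) (one _)) = pk p * cs (s0 T' x).
  have [V hV] := ct_seq_iso (s0 T' x); have [_ tV _ _] := hV.
  have tR := hty_comp (hty_pk (ct_seq cY (s0 Σ x)))
    (hty_pk (μ' x : mcell (one (t0 Σ x)) (one (t0 T' x)))).
  have [p pE] := hty_comp tR tV.
  by exists p; rewrite -pE (hinvKr (hinv_sym hV) tR).
pose μ x := choose_ex (R x).
have Rμ : @is_Gmod X Y cX cY f g Σ T' μ μ'.
    by apply: (proj2 (is_Gmod_pk μ μ')) => x; exact: choose_exP (R x).
exists μ; split=> [|ν [_ Rν']].
  by split=> //; apply: (proj2 (Gmod_iff Rμ)).
apply: functional_extensionality_dep => x; apply: pk_inj.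
apply: (hcancelr (ct_seq_iso (s0 T' x)) (hty_pk _) (hty_pk (ν x))).
by rewrite -(proj1 (is_Gmod_pk μ μ') Rμ) -(proj1 (is_Gmod_pk ν μ') Rν').
Qed.
End Correspondence.
End GModifications.

(** * The correspondence of transformations and modifications *)

Theorem theorem5p33 :
  (forall (B C : bicat) (f g : psfunctor B C),
    [/\ bij_between (@int_trans B C f g)
          (@is_boplax B C f g) (@is_fair _ _ (int_fun f) (int_fun g)),
        forall (Σ T : npath (@oplax_quiver B C) f g)
          (μ : forall x : B, bcell (bcomposite (@oplax_tr B C) Σ x)
                                   (bcomposite (@oplax_tr B C) T x)),
          is_bmod μ <->
          @is_mmod (int_bicat B) (int_bicat C) _ _
            (fun h : psfunctor B C => int_fun h)
            (fun h k (σ : oplax_quiver h k) => int_trans (oplax_tr σ))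
            f g Σ T μ,
        bij_between (@int_trans B C f g)
          (@is_bpseudo B C f g) (@is_mpseudo _ _ (int_fun f) (int_fun g))
      & bij_between (@int_trans B C f g)
          (@is_bequiv B C f g) (@is_mequiv _ _ (int_fun f) (int_fun g))])
  /\
  (forall (X Y : rep_mbicat) (cX : tensor_choice X) (cY : tensor_choice Y)
          (f g : strong_mor X Y),
    [/\ bij_between (@G_trans X Y cX cY f g)
          (@is_fair X Y f g) (@is_boplax _ _ (G_fun cX cY f) (G_fun cX cY g)),
        forall Σ T : npath (@fair_quiver X Y) f g,
          one_to_one (@is_Gmod X Y cX cY f g Σ T)
            (@is_mmod X Y _ _ _ (@fair_tr X Y) f g Σ T)
            (@is_bmod _ _ (G_fun cX cY f) (G_fun cX cY g)
              (bcomposite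
                (fun h k (σ : fair_quiver h k) => G_trans cX cY (fair_tr σ)) Σ)
              (bcomposite
                (fun h k (σ : fair_quiver h k) => G_trans cX cY (fair_tr σ)) T)),
        bij_between (@G_trans X Y cX cY f g)
          (@is_mpseudo X Y f g) (@is_bpseudo _ _ (G_fun cX cY f) (G_fun cX cY g))
      & bij_between (@G_trans X Y cX cY f g)
          (@is_mequiv X Y f g) (@is_bequiv _ _ (G_fun cX cY f) (G_fun cX cY g))]).
Proof.
split=> [B C f g|X Y cX cY f g].
  have VK : cancel (@int_transV B C f g) (@int_trans B C f g) by case.
  have K : cancel (@int_trans B C f g) (@int_transV B C f g) by case.
  split; [|exact: int_modP| |]; apply: (bij_between_iff K VK).
  - exact: int_fairP.
  - exact: int_pseudoP.
  - exact: int_mequivP.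
have K := @G_transK X Y cX cY f g; have VK := @G_transVK X Y cX cY f g.
split; [|exact: Gmod_one_to_one| |]; apply: (bij_between_iff K VK).
- exact: G_fairP.
- exact: G_pseudoP.
- exact: G_equivP.
Qed.
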